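(* Let $(M^n,g)$ be a locally conformally flat Riemannian manifold and let $\Sigma\subset(M,g)$ be an umbilic submanifold of dimension $k$, $3\le k\le n-1$. For any $\ell\ge1$, the minimal submanifold extrinsic operator $P_{2\ell}$ equals the intrinsic operator $\overline P_{2\ell}$.
   Context: Laplacians have the sign $\Delta=\sum\partial_i^2$ on Euclidean space. Let $h$ be the metric induced on $\Sigma$ by $g$. Umbilic means that the trace-free part of the second fundamental form vanishes. **GJMS construction.** For an asymptotically hyperbolic metric $h_+$ on the interior of a manifold $Y^{k+1}$ with boundary $\Sigma^k$ (for a defining function $r$, $r^2h_+$ extends to a smooth metric on $Y$ with $|dr|^2_{r^2h_+}=1$ on $\Sigma$), a representative $h$ of its conformal infinity, a defining function $r$ with $r^2h_+|_{T\Sigma}=h$, and $\ell\in\mathbb N$: given $f\in C^\infty(\Sigma)$ there is $F\in C^\infty(Y)$, unique modulo $O(r^{2\ell})$, with $F|_\Sigma=f$ and such that $u:=r^{k/2-\ell}F$ satisfies $(\Delta_{h_+}+((k/2)^2-\ell^2))u=O(r^{k/2+\ell})$; then $\big(r^{-k/2-\ell}(\Delta_{h_+}+((k/2)^2-\ell^2))u\big)\big|_\Sigma=:a_\ell P_{2\ell}f$, $a_\ell^{-1}=(-1)^\ell2^{2(\ell-1)}((\ell-1)!)^2$, is independent of choices. It is known that under $\widehat h=e^{2\omega}h$ one has the covariance relation $\widehat P_{2\ell}=e^{(-k/2-\ell)\omega}\circ P_{2\ell}\circ e^{(k/2-\ell)\omega}$, and that $P_{2\ell}$ is unchanged if $h_+$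 is pulled back by a diffeomorphism restricting to the identity on $\Sigma$. **Extrinsic operators in this setting (all $\ell\ge1$).** A locally conformally flat $(M^n,[g])$, $n\ge3$, is the conformal infinity of a hyperbolic metric $g_+$ (constant sectional curvature $-1$) on a deleted neighborhood of $M=M\times\{0\}$ in $X=M\times[0,\epsilon)$, uniquely determined up to a diffeomorphism restricting to the identity on $M$. For $\Sigma$ umbilic of dimension $k\ge2$ there is a unique extension $Y^{k+1}$ of $\Sigma$ into $X$ near $\Sigma$ (with $Y\cap M=\Sigma$) which is totally geodesic with respect to $g_+$. Let $h_+$ be the metric induced on $Y$ by $g_+$. The minimal submanifold extrinsic operator $P_{2\ell}$ is the operator produced by the GJMS construction for $h_+$ with representative $h$; it is defined for all $\ell\ge1$. **Intrinsic operators (all $\ell\ge1$).** The conformal class $[h]$ on $\Sigma$ contains local Einstein representatives. For a local Einstein representative $h_0$ with $\mathrm{Ric}(h_0)=\lambda(k-1)h_0$, the intrinsic GJMS operator is $\overline P_{2\ell}=\prod_{j=1}^\ell(-\Delta_{h_0}+\lambda c_j)$, $c_j=(\frac k2+j-1)(\frac k2-j)$; equivalently, it is the operator produced by the GJMS construction for the canonical Poincaré metric $r^{-2}(dr^2+(1-\frac14\lambda r^2)^2h_0)$. For other representatives $e^{2\omega}h_0$ it is defined by the covariance relation above; this is known to be consistent, and it agrees with the usual GJMS operators of $h$ whenever those are defined. *)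

(* Defs.v *)
From HB Require Import structures.
From mathcomp Require Import all_boot all_order all_algebra.
From mathcomp Require Import all_classical all_reals all_analysis.

Set Implicit Arguments.
Unset Strict Implicit.
Unset Printing Implicit Defensive.

Import Order.TTheory GRing.Theory Num.Theory.
Import numFieldNormedType.Exports.

Local Open Scope classical_set_scope.
Local Open Scope ring_scope.

(* Throughout, b : bool says whether boundary points are allowed: coordinates
   range over R^n if b = false, and over {x_0 >= 0} if b = true. *)

Section Calculus.
Context {R : realType}.

Definition model (b : bool) n : set 'rV[R]_n :=
  [set x | b -> forall i : 'I_n, i = 0%N :> nat -> 0 <= x 0 i].

Definition diff_quot n (i : 'I_n) (f : 'rV[R]_n -> R) (x : 'rV[R]_n) : R -> R :=
  fun t => t^-1 * (f (x + t *: delta_mx 0 i) - f x).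

(* For b = false this is the deleted neighborhood filter 0^'; for b = true it is
   the one-sided filter 0^'+ exactly when x is on the wall and i is the normal
   direction. *)
Definition incr b n (i : 'I_n) (x : 'rV[R]_n) : set_system R :=
  within [set t | model b (x + t *: delta_mx 0 i)] 0^'.

(* The i-th partial derivative of f at x, one-sided where the half-space
   requires it. *)
Definition pd b n (i : 'I_n) (f : 'rV[R]_n -> R) : 'rV[R]_n -> R :=
  fun x => lim (diff_quot i f x @ incr b i x).

(* V is always relatively open in [model b n]. For b = true, smoothness up to
   the wall is existence and continuity of all iterated (one-sided) partial
   derivatives, which by Seeley's theorem is the same as the existence of local
   smooth extensions across the wall. *)
Fixpoint Ck b n (V : set 'rV[R]_n) (m : nat) (f : 'rV[R]_n -> R) : Prop :=
  {within V, continuous f} /\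
  match m with
  | 0%N => True
  | m'.+1 => forall i : 'I_n,
      (forall x, V x -> cvg (diff_quot i f x @ incr b i x)) /\
      Ck b V m' (pd b i f)
  end.

Definition smooth_on b n (V : set 'rV[R]_n) (f : 'rV[R]_n -> R) : Prop :=
  forall m, Ck b V m f.

(* Row vectors: the a-th row is the a-th partial derivative. *)
Definition jac b m n (phi : 'rV[R]_m -> 'rV[R]_n) (x : 'rV[R]_m) : 'M[R]_(m, n) :=
  \matrix_(a, i) pd b a (fun y => phi y 0 i) x.

Section CoordinateMetric.
Variables (b : bool) (n : nat) (g : 'rV[R]_n -> 'M[R]_n).

(* [christoffel i j m] is Gamma^m_ij. *)
Definition christoffel (i j m : 'I_n) (x : 'rV[R]_n) : R :=
  2^-1 * \sum_p invmx (g x) m p *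
    (pd b i (fun y => g y j p) x + pd b j (fun y => g y i p) x
     - pd b p (fun y => g y i j) x).

(* The coefficient of d_m in
   R(d_i, d_j) d_p = nabla_i nabla_j d_p - nabla_j nabla_i d_p. *)
Definition riemann (i j p m : 'I_n) (x : 'rV[R]_n) : R :=
  pd b i (christoffel j p m) x - pd b j (christoffel i p m) x
  + \sum_q (christoffel i q m x * christoffel j p q x
            - christoffel j q m x * christoffel i p q x).

Definition ricci (x : 'rV[R]_n) : 'M[R]_n :=
  \matrix_(j, p) \sum_i riemann i j p i x.

Definition inner (x u v : 'rV[R]_n) : R := (u *m g x *m v^T) 0 0.

Definition riemann_uvv (x u v : 'rV[R]_n) : 'rV[R]_n :=
  \row_m \sum_i \sum_j \sum_p u 0 i * v 0 j * v 0 p * riemann i j p m x.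

Definition sectional_curvature_eq (kappa : R) (x : 'rV[R]_n) : Prop :=
  forall u v : 'rV[R]_n,
    inner x (riemann_uvv x u v) u =
    kappa * (inner x u u * inner x v v - inner x u v ^+ 2).

(* Sign convention: the sum of the second derivatives on Euclidean space. *)
Definition laplacian (u : 'rV[R]_n -> R) (x : 'rV[R]_n) : R :=
  \sum_i \sum_j invmx (g x) i j *
    (pd b i (pd b j u) x - \sum_m christoffel i j m x * pd b m u x).

Definition grad_norm2 (u : 'rV[R]_n -> R) (x : 'rV[R]_n) : R :=
  \sum_i \sum_j invmx (g x) i j * pd b i u x * pd b j u x.

End CoordinateMetric.

(* Second fundamental form, by the Gauss formula
   II(d_a, d_e) = nabla^g_a d_e - nabla^h_a d_e,
   of an isometric immersion phi from (h, coordinates of type b) to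
   (g, coordinates of type b'); [sff _ _ h g phi x a e] is a vector in the
   target coordinates. *)
Definition sff b b' m n (h : 'rV[R]_m -> 'M[R]_m) (g : 'rV[R]_n -> 'M[R]_n)
    (phi : 'rV[R]_m -> 'rV[R]_n) (x : 'rV[R]_m) (a e : 'I_m) : 'rV[R]_n :=
  \row_p (pd b a (pd b e (fun y => phi y 0 p)) x
    - \sum_c christoffel b h a e c x * jac b phi x c p
    + \sum_i \sum_j christoffel b' g i j p (phi x)
        * jac b phi x a i * jac b phi x e j).

(* The mean curvature vector, normalized as an average. *)
Definition mean_curv b b' m n (h : 'rV[R]_m -> 'M[R]_m) (g : 'rV[R]_n -> 'M[R]_n)
    (phi : 'rV[R]_m -> 'rV[R]_n) (x : 'rV[R]_m) : 'rV[R]_n :=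
  m%:R^-1 *: \sum_a \sum_e invmx (h x) a e *: sff b b' h g phi x a e.

End Calculus.

(* [chart_inv] is only meaningful on the coordinate image of [chart_dom]. *)
Record chart (R : realType) (T : Type) (n : nat) := Chart {
  chart_dom : set T;
  chart_map : T -> 'rV[R]_n;
  chart_inv : 'rV[R]_n -> T }.

Definition in_charts (R : realType) T T' m n (c : chart R T m) (c' : chart R T' n)
    (phi : T -> T') : 'rV[R]_m -> 'rV[R]_n :=
  fun x => chart_map c' (phi (chart_inv c x)).

Definition smooth_map (R : realType) (T T' : topologicalType) b m n
    (A : set (chart R T m)) (A' : set (chart R T' n)) (phi : T -> T') : Prop :=
  continuous phi /\
  forall c c', A c -> A' c' -> forall i : 'I_n,
    smooth_on b (chart_map c @` (chart_dom c `&` phi @^-1` chart_dom c'))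
      (fun x => in_charts c c' phi x 0 i).

Definition is_chart (R : realType) (T : topologicalType) b n (c : chart R T n) : Prop :=
  [/\ open (chart_dom c),
      exists O : set 'rV[R]_n,
        open O /\ chart_map c @` chart_dom c = O `&` model b (n := n),
      forall p, chart_dom c p -> chart_inv c (chart_map c p) = p,
      {within chart_dom c, continuous (chart_map c)} &
      {within chart_map c @` chart_dom c, continuous (chart_inv c)}].

(* Smooth n-manifolds, without boundary (b = false) or with possibly empty
   boundary (b = true). The atlas need not be maximal. *)
Record manifold (R : realType) (b : bool) (n : nat) := Manifold {
  points :> topologicalType;
  atlas : set (chart R points n);
  manifold_hausdorff : hausdorff_space points;
  manifold_second_countable : @second_countable points;
  atlas_chart : forall c, atlas c -> is_chart b c;
  atlas_cover : forall p, exists2 c, atlas c & chart_dom c p;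
  atlas_compat : smooth_map b atlas atlas id }.

Section Geometry.
Context {R : realType}.

Definition smooth_fun (T : Type) b n (A : set (chart R T n)) (D : set T)
    (f : T -> R) : Prop :=
  forall c, A c ->
    smooth_on b (chart_map c @` (D `&` chart_dom c)) (f \o chart_inv c).

(* A symmetric 2-tensor, by its coefficients in every chart. *)
Definition tensor2 (T : Type) n := chart R T n -> 'rV[R]_n -> 'M[R]_n.

Definition is_pullback (T T' : Type) b m n (A : set (chart R T m))
    (A' : set (chart R T' n)) (D : set T) (phi : T -> T')
    (g : tensor2 T' n) (h : tensor2 T m) : Prop :=
  forall c c' p, A c -> A' c' -> D p -> chart_dom c p -> chart_dom c' (phi p) ->
    let J := jac b (in_charts c c' phi) (chart_map c p) in
    h c (chart_map c p) = J *m g c' (chart_map c' (phi p)) *m J^T.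

Definition is_metric (T : Type) b n (A : set (chart R T n)) (D : set T)
    (g : tensor2 T n) : Prop :=
  [/\ forall c, A c -> forall i j,
        smooth_on b (chart_map c @` (D `&` chart_dom c)) (fun x => g c x i j),
      forall c p, A c -> D p -> chart_dom c p ->
        (g c (chart_map c p))^T = g c (chart_map c p),
      forall c p, A c -> D p -> chart_dom c p ->
        forall v : 'rV[R]_n, v != 0 -> 0 < inner (g c) (chart_map c p) v v &
      is_pullback b A A D id g g].

Definition locally_conformally_flat (T : Type) n (A : set (chart R T n))
    (g : tensor2 T n) : Prop :=
  forall c p, A c -> chart_dom c p ->
  exists (V : set 'rV[R]_n) (psi : 'rV[R]_n -> 'rV[R]_n) (omega : 'rV[R]_n -> R),
    [/\ open V, V (chart_map c p), V `<=` chart_map c @` chart_dom c,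
        {in V &, injective psi} &
        [/\ forall i, smooth_on false V (fun x => psi x 0 i),
            smooth_on false V omega &
            forall x, V x ->
              g c x = expR (2 * omega x) *: (jac false psi x *m (jac false psi x)^T)]].

Definition embedding (T T' : topologicalType) b m n (A : set (chart R T m))
    (A' : set (chart R T' n)) (phi : T -> T') : Prop :=
  [/\ smooth_map b A A' phi,
      forall c c' p, A c -> A' c' -> chart_dom c p -> chart_dom c' (phi p) ->
        row_free (jac b (in_charts c c' phi) (chart_map c p)),
      injective phi &
      forall U : set T, open U -> exists2 V, open V & U = phi @^-1` V].

Definition umbilic (T T' : Type) m n (A : set (chart R T m))
    (A' : set (chart R T' n)) (phi : T -> T') (h : tensor2 T m) (g : tensor2 T' n)
    : Prop :=
  forall c c' p, A c -> A' c' -> chart_dom c p -> chart_dom c' (phi p) ->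
    let x := chart_map c p in let f := in_charts c c' phi in
    forall a e, sff false false (h c) (g c') f x a e
      - h c x a e *: mean_curv false false (h c) (g c') f x = 0.

Definition totally_geodesic (T T' : Type) m n (A : set (chart R T m))
    (A' : set (chart R T' n)) (D : set T) (phi : T -> T')
    (h : tensor2 T m) (g : tensor2 T' n) : Prop :=
  forall c c' p, A c -> A' c' -> D p -> chart_dom c p -> chart_dom c' (phi p) ->
    forall a e,
      sff true true (h c) (g c') (in_charts c c' phi) (chart_map c p) a e = 0.

Definition hyperbolic (T : Type) n (A : set (chart R T n)) (D : set T)
    (g : tensor2 T n) : Prop :=
  forall c p, A c -> D p -> chart_dom c p ->
    sectional_curvature_eq true (g c) (- 1) (chart_map c p).

Definition boundary (T : Type) n (A : set (chart R T n.+1)) : set T :=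
  [set p | exists c, [/\ A c, chart_dom c p & chart_map c p 0 ord0 = 0]].

(* D is an open subset, containing the boundary j(S), of the manifold with
   boundary given by A, and gp is a metric on D minus the boundary. This says
   that gp is asymptotically hyperbolic, that r is a defining function and that
   r^2 gp induces the representative h of the conformal infinity on S. *)
Definition defining_for (T S : Type) n (A : set (chart R T n.+1)) (D : set T)
    (AS : set (chart R S n)) (j : S -> T) (gp : tensor2 T n.+1) (r : T -> R)
    (h : tensor2 S n) : Prop :=
  [/\ smooth_fun true A D r,
      forall p, D p -> boundary A p -> r p = 0,
      forall c p, A c -> D p -> chart_dom c p -> ~ boundary A p -> 0 < r p &
      exists gbar : tensor2 T n.+1,
      [/\ is_metric true A D gbar,
          forall c p, A c -> D p -> chart_dom c p -> ~ boundary A p ->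
            gbar c (chart_map c p) = r p ^+ 2 *: gp c (chart_map c p),
          forall c p, A c -> D p -> chart_dom c p -> boundary A p ->
            grad_norm2 true (gbar c) (r \o chart_inv c) (chart_map c p) = 1 &
          is_pullback false AS A setT j gbar h]].

(* The smooth structure of M x [0, eps), a subset of M x R; the variable of
   [0, eps) is the first coordinate. *)
Definition collar_chart (T : Type) n (eps : R) (c : chart R T n)
    : chart R (T * R) n.+1 :=
  Chart [set q | chart_dom c q.1 /\ 0 <= q.2 < eps]
    (fun q => row_mx (const_mx q.2 : 'rV[R]_1) (chart_map c q.1) : 'rV[R]_(1 + n))
    (fun x => (chart_inv c (rsubmx (x : 'rV[R]_(1 + n))), x 0 ord0)).

Definition collar_atlas (T : Type) n (eps : R) (A : set (chart R T n))
    : set (chart R (T * R) n.+1) := collar_chart eps @` A.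

End Geometry.

Section Operators.
Context {R : realType}.

(* The reciprocal of the normalizing constant a_l in the construction. *)
Definition gjms_const (l : nat) : R :=
  (- 1) ^+ l * 2 ^+ (2 * (l - 1)) * ((l - 1)`!)%:R ^+ 2.

(* P is produced by the GJMS construction from the metric hp on the interior of
   Y, with boundary j : S -> Y, and the representative h: for every f there are
   r and F as in the construction from which P f is obtained. *)
Definition is_gjms k (Y : manifold R true k.+1) (S : manifold R false k)
    (j : S -> Y) (hp : tensor2 Y k.+1) (h : tensor2 S k) (l : nat)
    (P : (S -> R) -> S -> R) : Prop :=
  forall f : S -> R, smooth_fun false (atlas (m:=S)) setT f ->
  exists (r : Y -> R) (F : Y -> R),
    [/\ defining_for (atlas (m:=Y)) setT (atlas (m:=S)) j hp r h,
        smooth_fun true (atlas (m:=Y)) setT F,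
        forall p, F (j p) = f p &
        forall (c : chart R Y k.+1) (p : S), atlas c -> chart_dom c (j p) ->
          let u y := r y `^ (k%:R / 2 - l%:R) * F y in
          let Lu x := laplacian true (hp c) (u \o chart_inv c) x
            + ((k%:R / 2) ^+ 2 - l%:R ^+ 2) * u (chart_inv c x) in
          (* interior points tending to j p *)
          let filt := within
            [set x | (chart_map c @` chart_dom c) x /\ 0 < x 0 ord0]
            (nbhs (chart_map c (j p))) in
          (exists C : R, \forall x \near filt,
             `|Lu x| <= C * r (chart_inv c x) `^ (k%:R / 2 + l%:R)) /\
          gjms_const l * (r (chart_inv c x) `^ (- (k%:R / 2) - l%:R) * Lu x)
            @[x --> filt] --> P f p].

(* P is a minimal submanifold extrinsic operator of order 2l of the submanifold
   i : S -> M with induced metric h, for some choice of the hyperbolic metric gp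
   on N minus M x {0}, N being a neighborhood of M x {0} in M x [0, eps), and
   of the totally geodesic extension Phi : Y -> N of S. *)
Definition is_minimal_extrinsic n k (M : manifold R false n) (g : tensor2 M n)
    (S : manifold R false k) (i : S -> M) (h : tensor2 S k) (l : nat)
    (P : (S -> R) -> S -> R) : Prop :=
  exists (eps : R) (N : set (M * R)) (gp : tensor2 (M * R)%type n.+1)
    (Y : manifold R true k.+1) (j : S -> Y) (Phi : Y -> M * R)
    (hp : tensor2 Y k.+1),
  let X := collar_atlas eps (atlas (m:=M)) in
  let Nint := N `&` [set q | 0 < q.2] in
  let AY := atlas (m:=Y) in
  let Yint := ~` boundary AY in
  [/\ [/\ 0 < eps, exists O : set (M * R), open O /\ N = O `&` [set q | 0 <= q.2 < eps]
        & forall p, N (p, 0)],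
      [/\ is_metric true X Nint gp, hyperbolic X Nint gp &
          exists r, defining_for X N (atlas (m:=M)) (fun p => (p, 0)) gp r g],
      [/\ embedding false (atlas (m:=S)) AY j, range j = boundary AY,
          embedding true AY X Phi, range Phi `<=` N &
          (forall p, Phi (j p) = (i p, 0)) /\
          (forall y, (Phi y).2 = 0 -> range j y)],
      is_pullback true AY X Yint Phi gp hp /\
      totally_geodesic AY X Yint Phi hp gp &
      is_gjms j hp h l P].

(* The product over 1 <= j <= l of - Laplacian + lambda c_j. *)
Definition einstein_product k (h0 : 'rV[R]_k -> 'M[R]_k) (lambda : R) (l : nat)
    (f : 'rV[R]_k -> R) : 'rV[R]_k -> R :=
  foldr (fun (j : nat) v x => - laplacian false h0 v x
           + lambda * ((k%:R / 2 + j%:R - 1) * (k%:R / 2 - j%:R)) * v x)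
    f (iota 1 l).

(* P is the intrinsic GJMS operator of order 2l of h: for every local Einstein
   representative h0 = e^(-2 omega) h, on an open subset V of a coordinate
   image, P is related to [einstein_product h0] by the covariance relation. *)
Definition is_intrinsic_gjms k (S : manifold R false k) (h : tensor2 S k) (l : nat)
    (P : (S -> R) -> S -> R) : Prop :=
  forall (c : chart R S k) (V : set 'rV[R]_k) (h0 : 'rV[R]_k -> 'M[R]_k)
    (omega : 'rV[R]_k -> R) (lambda : R),
    atlas c -> open V -> V `<=` chart_map c @` chart_dom c ->
    smooth_on false V omega ->
    (forall x, V x -> h c x = expR (2 * omega x) *: h0 x) ->
    (forall x, V x -> ricci false h0 x = (lambda * (k%:R - 1)) *: h0 x) ->
  forall f : S -> R, smooth_fun false (atlas (m:=S)) setT f ->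
  forall x, V x ->
    P f (chart_inv c x) =
      expR ((- (k%:R / 2) - l%:R) * omega x) *
      einstein_product h0 lambda l
        (fun y => expR ((k%:R / 2 - l%:R) * omega y) * f (chart_inv c y)) x.

End Operators.

(* Main.v *)
(* Near a point of S, a conformally flat chart psi of M with conformal factor
   omega maps S to an umbilic submanifold of Euclidean space, whose mean
   curvature has constant norm.  A special conformal transformation makes it
   vanish at the given point, hence nearby, so that S becomes totally geodesic
   and h0 = exp(-2 omega) h flat: the intrinsic operator is conjugate to
   (-Laplacian(h0))^l.
   On the other side, extend -omega from S to a function a on Y such that, with
   rho = r exp(a) and g = rho^2 h_+, the eikonal equation |d rho|_g = 1 holds to
   high order along S.  As Y is totally geodesic, h_+ has curvature -1, and this
   becomes a Riccati equation for the Hessian A of rho, together with an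
   expression of the curvature of g in terms of A.  The boundary metric h0 being
   flat and k >= 3, induction on the order shows that A vanishes to high order
   along S.  Hence the gradient of rho commutes with the Laplacian to high order,
   and the power series solution F = sum_m kappa_m rho^(2m)/(2m)! (-Laplacian)^m f
   of the GJMS equation, with its obstruction, reduces to the product case. *)

(* The defining function r and the solution F come with the hypothesis on P and cannot be chosen.
   With s = k/2 - l, the pair rho = r exp(a), exp(-s a) F gives the same u as r, F, so the
   normalization of rho is a mere change of unknowns. No normal form by geodesic flow is used: the
   derivative D along the gradient of rho plays the part of the normal derivative, and identities
   hold modulo functions vanishing to a given order at the wall x_0 = 0. As only the coefficient of
   order 2l is read off, the eikonal equation need be solved only to order 2l + 2. The Riccati
   equation multiplies the leading coefficient of A at order m by m - 1, which forces it to vanish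
   except at the resonance m = 1. There the boundary decides: the Kulkarni-Nomizu product of that
   coefficient with h0 is the curvature of the wall, which is 0. The product with h0 is injective
   for k >= 3 but not for k = 2. A flat h0 has Einstein constant 0, so the constants c_j disappear
   and the two operators are compared as the same power of the Laplacian between the same powers of
   the conformal factor. *)
Require Import Defs.
From mathcomp Require Import all_boot all_order all_algebra.
From mathcomp Require Import all_classical all_reals all_analysis.
From mathcomp Require Import ring lra zify.
Import Order.TTheory GRing.Theory Num.Theory.
Import numFieldNormedType.Exports.
Local Open Scope classical_set_scope.
Local Open Scope ring_scope.

Set Implicit Arguments.
Unset Strict Implicit.
Unset Printing Implicit Defensive.

(** * Calculus on relatively open subsets of the model half-space *)

Section Calculus.
Context {R : realType}.

Definition box n (x : 'rV[R]_n) (e : R) : set 'rV[R]_n :=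
  [set y | forall i, `|y 0 i - x 0 i| < e].

Lemma nbhs_boxP n (x : 'rV[R]_n) (P : set 'rV[R]_n) :
  nbhs x P <-> exists2 e : R, 0 < e & box x e `<=` P.
Proof.
split=> [/nbhs_ballP[e e0 H]|[e e0 H]].
  exists e => // y hy; apply: H; split=> // i j.
  by rewrite ord1 /ball/= distrC.
apply/nbhs_ballP; exists e => // y [_ hy]; apply: H => i.
by have := hy 0 i; rewrite /ball/= distrC.
Qed.

Definition relopen b n (V : set 'rV[R]_n) :=
  V `<=` model b (n := n) /\
  forall x, V x -> exists2 e : R, 0 < e & model b (n := n) `&` box x e `<=` V.

Lemma stepE n (x : 'rV[R]_n) i t j :
  (x + t *: delta_mx 0 i) 0 j = x 0 j + t * (j == i)%:R.
Proof. by rewrite !mxE. Qed.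

Lemma incr_nearP b n (i : 'I_n) (x : 'rV[R]_n) (P : set R) :
  incr b i x P <-> exists2 e : R, 0 < e &
    forall t, t != 0 -> `|t| < e -> model b (x + t *: delta_mx 0 i) -> P t.
Proof.
rewrite /incr /within /dnbhs /=; split.
  move=> /nbhs_ballP[e e0 H]; exists e => // t t0 te mt.
  apply: H => //; by rewrite /ball/= sub0r normrN.
move=> [e e0 H]; apply/nbhs_ballP; exists e => // t.
by rewrite /ball/= sub0r normrN => te t0 mt; apply: H.
Qed.

Global Instance incr_filter b n (i : 'I_n) (x : 'rV[R]_n) : Filter (incr b i x).
Proof. exact: within_filter. Qed.

Lemma model_step b n (i : 'I_n) (x : 'rV[R]_n) t :
  model b x -> 0 <= t -> model b (x + t *: delta_mx 0 i).
Proof.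
move=> mx t0 hb j j0; rewrite stepE; apply: addr_ge0; first exact: mx.
by apply: mulr_ge0.
Qed.

Lemma incr_proper b n (i : 'I_n) (x : 'rV[R]_n) :
  model b x -> ProperFilter (incr b i x).
Proof.
move=> mx; apply: Build_ProperFilter_ex => P /incr_nearP[e e0 H].
exists (e / 2); apply: H; first by rewrite gt_eqF ?divr_gt0.
  by rewrite gtr0_norm ?divr_gt0 // ltr_pdivrMr // ltr_pMr // ltr1n.
by apply: model_step => //; rewrite ltW ?divr_gt0.
Qed.

Lemma relopen_near b n (V : set 'rV[R]_n) i x :
  relopen b V -> V x -> incr b i x [set t | V (x + t *: delta_mx 0 i)].
Proof.
move=> [_ oV] /oV[e e0 H]; apply/incr_nearP; exists e => // t t0 te mt.
apply: H; split=> // j; rewrite stepE addrAC subrr add0r.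
by case: eqP; rewrite ?mulr1 ?mulr0 ?normr0.
Qed.

(** [pd] is a [lim], whose value means nothing without convergence; this predicate carries the
    existence of the derivative together with its value. *)
Definition is_pd b n (i : 'I_n) (f : 'rV[R]_n -> R) x (l : R) :=
  diff_quot i f x @ incr b i x --> l.

Lemma is_pdE b n i (f : 'rV[R]_n -> R) x l :
  model b x -> is_pd b i f x l -> pd b i f x = l.
Proof. by move=> mx fl; have P := incr_proper i mx; apply: cvg_lim. Qed.

Lemma fmap_near_eq (T U : Type) (F : set_system T) (FF : Filter F) (f g : T -> U) :
  (\forall t \near F, f t = g t) -> f @ F = g @ F.
Proof.
move=> H; rewrite predeqE => P; rewrite /fmap /=; split=> FP;
by apply: filterS2 H FP => t /= ->.
Qed.

Lemma diff_quot_near b n (V : set 'rV[R]_n) i f g x :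
  relopen b V -> V x -> (forall y, V y -> f y = g y) ->
  diff_quot i f x @ incr b i x = diff_quot i g x @ incr b i x.
Proof.
move=> oV Vx fg; apply: fmap_near_eq.
by apply: filterS (relopen_near i oV Vx) => t Vt; rewrite /diff_quot !fg.
Qed.

Lemma pd_eq b n (V : set 'rV[R]_n) i f g x :
  relopen b V -> V x -> (forall y, V y -> f y = g y) -> pd b i f x = pd b i g x.
Proof. by move=> oV Vx fg; rewrite /pd (diff_quot_near i oV Vx fg). Qed.

Lemma incr_to0 b n (i : 'I_n) (x : 'rV[R]_n) : (fun t : R => t) @ incr b i x --> (0 : R).
Proof.
apply: cvg_trans (cvg_within _) _; exact: (@nbhs_dnbhs _ 0).
Qed.

Lemma incr_neq0 b n (i : 'I_n) (x : 'rV[R]_n) : \forall t \near incr b i x, t != 0.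
Proof. by apply/incr_nearP; exists 1. Qed.

Lemma is_pd_cont b n (i : 'I_n) f (x : 'rV[R]_n) l :
  is_pd b i f x l -> f (x + t *: delta_mx 0 i) @[t --> incr b i x] --> f x.
Proof.
move=> fl.
have H : f x + t * diff_quot i f x t @[t --> incr b i x] --> f x + 0 * l.
  by apply: cvgD; [exact: cvg_cst|apply: cvgM => //; exact: incr_to0].
rewrite mul0r addr0 in H; apply: cvg_trans H; apply: near_eq_cvg.
by apply: filterS (incr_neq0 b i x) => t t0; rewrite /diff_quot mulVKf // addrC subrK.
Qed.

Lemma is_pd_cst b n (i : 'I_n) (c : R) (x : 'rV[R]_n) : is_pd b i (fun=> c) x 0.
Proof.
rewrite /is_pd; have -> : diff_quot i (fun=> c) x = cst 0.
  by apply/funext => t; rewrite /diff_quot subrr mulr0.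
exact: cvg_cst.
Qed.

Lemma is_pdD b n (i : 'I_n) f g (x : 'rV[R]_n) l m :
  is_pd b i f x l -> is_pd b i g x m -> is_pd b i (fun y => f y + g y) x (l + m).
Proof.
move=> fl gm; rewrite /is_pd; have -> : diff_quot i (fun y => f y + g y) x =
  (fun t => diff_quot i f x t + diff_quot i g x t).
  by apply/funext => t; rewrite /diff_quot; ring.
exact: cvgD.
Qed.

Lemma is_pdM b n (i : 'I_n) f g (x : 'rV[R]_n) l m :
  is_pd b i f x l -> is_pd b i g x m ->
  is_pd b i (fun y => f y * g y) x (l * g x + f x * m).
Proof.
move=> fl gm; rewrite /is_pd; have -> : diff_quot i (fun y => f y * g y) x =
  (fun t => diff_quot i f x t * g x + f (x + t *: delta_mx 0 i) * diff_quot i g x t).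
  by apply/funext => t; rewrite /diff_quot; ring.
apply: cvgD; apply: cvgM => //; first exact: cvg_cst.
exact: is_pd_cont fl.
Qed.

Lemma is_pd_coord b n (i j : 'I_n) (x : 'rV[R]_n) :
  is_pd b i (fun y => y 0 j) x (j == i)%:R.
Proof.
rewrite /is_pd (@fmap_near_eq _ _ _ _ _ (cst (j == i)%:R)); first exact: cvg_cst.
apply: filterS (incr_neq0 b i x) => t t0.
by rewrite /diff_quot stepE addrAC subrr add0r mulKf.
Qed.

Lemma is_pd_comp1 b n (i : 'I_n) (h : R -> R) f (x : 'rV[R]_n) l d :
  is_derive (f x) (1 : R) h d -> is_pd b i f x l ->
  is_pd b i (fun y => h (f y)) x (d * l).
Proof.
move=> [hd dE] fl; rewrite /is_pd.
(* The difference quotient of h, extended by d at 0, is continuous there, so increments of f that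
   happen to vanish do no harm. *)
pose q (s : R) := if s == 0 then d else s^-1 * (h (f x + s) - h (f x)).
have -> : diff_quot i (fun y => h (f y)) x =
  (fun t => q (f (x + t *: delta_mx 0 i) - f x) * diff_quot i f x t).
  apply/funext => t; rewrite /diff_quot /q; case: ifPn => [|ne].
    by rewrite subr_eq0 => /eqP ->; rewrite !subrr !mulr0.
  rewrite (addrC (f x)) subrK; move: (f (x + _)) (t^-1) ne => z u ne; field.
  exact: ne.
apply: cvgM => //.
have q0 : q 0 = d by rewrite /q eqxx.
have qc : q @ (0 : R) --> d.
  rewrite -[X in _ --> X]q0; apply/(@continuous_withinNx R R); rewrite q0.
  have : s^-1 *: ((h \o shift (f x)) (s *: (1 : R)) - h (f x)) @[s --> (0 : R)^'] --> d.
    by rewrite -dE /derive; exact: hd.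
  apply: cvg_trans; apply: near_eq_cvg.
  apply: filterS (nbhs_dnbhs_neq (0 : R)) => s /= s0.
  by rewrite /q (negbTE s0) /= /shift /= scaler1 (addrC s).
have fc : f (x + t *: delta_mx 0 i) - f x @[t --> incr b i x] --> (0 : R).
  rewrite -(subrr (f x)); apply: cvgB; [exact: is_pd_cont fl|exact: cvg_cst].
exact: cvg_comp fc qc.
Qed.

Lemma cont_boxP n (V : set 'rV[R]_n) (f : 'rV[R]_n -> R) : {within V, continuous f} <->
  forall x, V x -> forall e : R, 0 < e ->
    exists2 d : R, 0 < d & forall y, V y -> box x d y -> `|f x - f y| < e.
Proof.
split=> [/subspace_continuousP H x Vx e e0|H].
  have /cvgrPdist_lt /(_ _ e0) := H x Vx.
  move=> /nbhs_boxP[d d0 Hd]; exists d => // y Vy by_; exact: Hd.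
apply/subspace_continuousP => x Vx; apply/cvgrPdist_lt => e e0.
have [d d0 Hd] := H x Vx e e0.
apply/nbhs_boxP; exists d => // y hy Vy; exact: Hd.
Qed.

Definition diffable b n (V : set 'rV[R]_n) f :=
  forall i x, V x -> is_pd b i f x (pd b i f x).

Lemma line_derive b n (V : set 'rV[R]_n) i (f : 'rV[R]_n -> R) x s t :
  V `<=` model b (n := n) -> diffable b V f ->
  (forall t, 0 <= t <= s -> V (x + t *: delta_mx 0 i)) -> t \in `]0, s[ ->
  is_derive t (1 : R) (fun t => f (x + t *: delta_mx 0 i))
    (pd b i f (x + t *: delta_mx 0 i)).
Proof.
move=> Vm fd hV; pose phi t := f (x + t *: delta_mx 0 i).
rewrite in_itv/= => /andP[t0 ts].
  have Vt : V (x + t *: delta_mx 0 i) by apply: hV; rewrite !ltW.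
  suff H : h^-1 *: ((phi \o shift t) (h *: (1 : R)) - phi t) @[h --> (0 : R)^']
     --> pd b i f (x + t *: delta_mx 0 i).
    by apply: DeriveDef; [apply/cvg_ex; eexists; exact: H|exact: cvg_lim H].
  move=> P /(fd i _ Vt) /incr_nearP[e e0 He].
  (* A step shorter than t and s - t stays on the segment, hence in the model: inside the segment
     the possibly one-sided quotient is two-sided. *)
  have m0 : 0 < Num.min e (Num.min t (s - t)) by rewrite !lt_min e0 t0 subr_gt0.
  apply/nbhs_ballP; exists (Num.min e (Num.min t (s - t))) => // h.
  rewrite /ball/= sub0r normrN !lt_min => /and3P[he ht hts] h0.
  have E : x + t *: delta_mx 0 i + h *: delta_mx 0 i = x + (h + t) *: delta_mx 0 i.
    by rewrite -addrA -scalerDl (addrC t).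
  have /= := He h h0 he _; rewrite /diff_quot E /phi /= /shift /= scaler1; apply.
  apply: Vm; apply: hV; move: ht hts; rewrite !ltr_norml => /andP[h1 h2] /andP[h3 h4].
  by apply/andP; split; lra.
Qed.

Lemma line_continuous n (V : set 'rV[R]_n) i (f : 'rV[R]_n -> R) x s :
  {within V, continuous f} ->
  (forall t, 0 <= t <= s -> V (x + t *: delta_mx 0 i)) ->
  {within `[0, s], continuous (fun t => f (x + t *: delta_mx 0 i))}.
Proof.
move=> fc hV.
apply/subspace_continuousP => t; rewrite /= in_itv /= => ht.
  apply/cvgrPdist_lt => e e0; have /cont_boxP fc' := fc.
  have [d d0 Hd] := fc' _ (hV _ ht) _ e0.
  apply/nbhs_ballP; exists d => // u; rewrite /ball/= => ut.
  rewrite in_itv/= => hu; apply: Hd; first exact: hV.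
  move=> j; rewrite !stepE opprD addrACA subrr add0r -mulrBl.
  by case: eqP; rewrite ?mulr1 ?mulr0 ?normr0 // distrC.
Qed.

Lemma mvt_pos b n (V : set 'rV[R]_n) i (f : 'rV[R]_n -> R) x s :
  V `<=` model b (n := n) -> {within V, continuous f} -> diffable b V f ->
  0 < s -> (forall t, 0 <= t <= s -> V (x + t *: delta_mx 0 i)) ->
  exists2 t, 0 <= t <= s &
    f (x + s *: delta_mx 0 i) - f x = s * pd b i f (x + t *: delta_mx 0 i).
Proof.
move=> Vm fc fd s0 hV.
have [c] := MVT s0 (fun t => line_derive Vm fd hV (t := t)) (line_continuous fc hV).
rewrite in_itv /= => /andP[c0 cs]; rewrite subr0 scale0r addr0 => E.
by exists c; [rewrite !ltW|rewrite E mulrC].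
Qed.

(** The parameter in [0, 1] covers both signs of s; a negative step is run backwards from its
    endpoint. *)
Lemma mvt_line b n (V : set 'rV[R]_n) i (f : 'rV[R]_n -> R) x s :
  V `<=` model b (n := n) -> {within V, continuous f} -> diffable b V f ->
  (forall t, 0 <= t <= 1 -> V (x + (t * s) *: delta_mx 0 i)) ->
  exists2 t, 0 <= t <= 1 &
    f (x + s *: delta_mx 0 i) - f x = s * pd b i f (x + (t * s) *: delta_mx 0 i).
Proof.
move=> Vm fc fd hV; have [s0|s0|<-] := ltgtP 0 s.
- have [|t /andP[t0 ts] E] := mvt_pos (x := x) (i := i) Vm fc fd s0.
    move=> t /andP[t0 ts]; have -> : t = (t / s) * s by rewrite divfK ?gt_eqF.
    by apply: hV; rewrite ler_pdivlMr // ler_pdivrMr // mul1r mul0r t0 ts.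
  exists (t / s); first by rewrite ler_pdivlMr // ler_pdivrMr // mul1r mul0r t0 ts.
  by rewrite divfK ?gt_eqF.
- have s0' : 0 < - s by rewrite oppr_gt0.
  have [|t /andP[t0 ts] E] := mvt_pos (x := x + s *: delta_mx 0 i) (i := i) Vm fc fd s0'.
    move=> t /andP[t0 ts]; rewrite -addrA -scalerDl.
    have -> : s + t = ((s + t) / s) * s by rewrite divfK ?lt_eqF.
    by apply: hV; apply/andP; split; [rewrite ler_ndivlMr //|rewrite ler_ndivrMr //]; lra.
  exists ((s + t) / s).
    by apply/andP; split; [rewrite ler_ndivlMr //|rewrite ler_ndivrMr //]; lra.
  have -> : (s + t) / s * s = s + t by rewrite divfK ?lt_eqF.
  move: E.
  rewrite -!addrA -!scalerDl subrr scale0r addr0 => /(congr1 -%R).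
  by rewrite opprB mulNr opprK.
- by exists 0; [rewrite lexx ler01|rewrite !mul0r scale0r addr0 subrr].
Qed.

(** A path of n coordinate segments joins x to x + v. Each increment is a mean value, taken where
    the partial derivative is within e of its value at x. Every coordinate moves monotonically from
    that of x to that of x + v, so the path does not leave the half-space. *)
Lemma box_total_diff b n (V : set 'rV[R]_n) (f : 'rV[R]_n -> R) x (e : R) :
  relopen b V -> {within V, continuous f} -> diffable b V f ->
  (forall i, {within V, continuous (pd b i f)}) -> V x -> 0 < e ->
  exists2 d : R, 0 < d & forall v : 'rV[R]_n, (forall i, `|v 0 i| < d) -> model b (x + v) ->
    `|f (x + v) - f x - \sum_i v 0 i * pd b i f x| <= e * \sum_i `|v 0 i|.
Proof.
move=> [Vm oV] fc fd pc Vx e0.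
have [d0 d00 Hd0] := oV x Vx.
have [d d1 [dd Hd]] : exists2 d : R, 0 < d & d <= d0 /\ forall i y, V y -> box x d y ->
    `|pd b i f x - pd b i f y| < e.
  have H i : exists2 d : R, 0 < d & forall y, V y -> box x d y ->
    `|pd b i f x - pd b i f y| < e by have /cont_boxP := pc i; apply.
  have /choice[D DP] : forall i, exists d : R, 0 < d /\ forall y, V y -> box x d y ->
    `|pd b i f x - pd b i f y| < e by move=> i; have [d ? ?] := H i; exists d.
  exists (\big[Num.min/d0]_i D i).
    by elim/big_ind: _ => // [a c a0 c0|i _]; [rewrite lt_min a0 c0|case: (DP i)].
  split; first by apply: bigmin_le_id.
  move=> i y Vy by_; apply: (DP i).2 => // j; apply: lt_le_trans (by_ j) _.
  exact: bigmin_le_cond.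
exists d => // v hv mv.
(* Corner m of the path: the first m coordinates are those of x + v, the others those of x. *)
pose p m : 'rV[R]_n := x + \row_j (if (j < m)%N then v 0 j else 0).
have pV (m : nat) (i : 'I_n) t : i = m :> nat -> 0 <= t <= 1 ->
    V (p m + (t * v 0 i) *: delta_mx 0 i) /\ box x d (p m + (t * v 0 i) *: delta_mx 0 i).
  move=> im /andP[t0 t1].
  have pj j : (p m + (t * v 0 i) *: delta_mx 0 i) 0 j - x 0 j =
      if (j < m)%N then v 0 j else if j == i then t * v 0 i else 0.
    rewrite stepE !mxE addrC addrA addrA (addrC (- _)) subrr add0r.
    case: (ltnP j m) => [jm|jm]; last by case: eqP; rewrite ?mulr1 ?mulr0 add0r.
    by rewrite -val_eqE /= im ltn_eqF // mulr0 addr0.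
  have B : box x d (p m + (t * v 0 i) *: delta_mx 0 i).
    move=> j; rewrite pj; case: ifP => // _; case: ifP => _; last by rewrite normr0.
    by rewrite normrM ger0_norm //; apply: le_lt_trans (hv i); rewrite ler_piMl.
  split=> //; apply: Hd0; split; last by move=> j; apply: lt_le_trans (B j) dd.
  move=> hb j j0; have mx := Vm _ Vx hb j j0; have := mv hb j j0; rewrite mxE => mxv.
  have -> : (p m + (t * v 0 i) *: delta_mx 0 i) 0 j = x 0 j +
    ((p m + (t * v 0 i) *: delta_mx 0 i) 0 j - x 0 j) by rewrite subrKC.
  rewrite pj; case: ifP => // _; case: eqP mx mxv => [->|_] mx mxv; last by rewrite addr0.
  have -> : x 0 i + t * v 0 i = (1 - t) * x 0 i + t * (x 0 i + v 0 i) by ring.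
  by apply: addr_ge0; apply: mulr_ge0; rewrite ?subr_ge0.
pose q m := p m.
have step (i : 'I_n) : exists y, [/\ V y, box x d y &
    f (p i.+1) - f (p i) = v 0 i * pd b i f y].
  have pi : p i.+1 = p i + v 0 i *: delta_mx 0 i.
    apply/rowP => j; rewrite stepE !mxE -addrA; congr (_ + _).
    rewrite ltnS leq_eqVlt -val_eqE /=; case: (ltngtP j i) => [ji|ji|ji] /=.
    - by rewrite mulr0 addr0.
    - by rewrite mulr0 addr0.
    - by rewrite add0r mulr1; congr (v 0 _); apply: val_inj.
  have [t ht E] := mvt_line (x := p i) (s := v 0 i) Vm fc fd
    (fun t ht => (pV i i t erefl ht).1).
  exists (p i + (t * v 0 i) *: delta_mx 0 i).
  by have [? ?] := pV i i t erefl ht; rewrite pi E.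
have -> : f (x + v) - f x = \sum_(i < n) (f (p i.+1) - f (p i)).
  rewrite -(big_mkord xpredT (fun i => f (p i.+1) - f (p i))) telescope_sumr //.
  congr (f _ - f _); apply/rowP => j; rewrite !mxE ?ltn_ord //.
  by rewrite addr0.
rewrite -sumrB mulr_sumr; apply: le_trans (ler_norm_sum _ _ _) _.
apply: ler_sum => i _; have [y [Vy By ->]] := step i.
rewrite -mulrBr normrM mulrC; apply: ler_wpM2r => //.
by rewrite distrC ltW // Hd.
Qed.

Lemma cvg_sumr (T I : Type) (F : set_system T) (FF : Filter F) (r : seq I)
    (q : I -> T -> R) (l : I -> R) :
  (forall i, q i t @[t --> F] --> l i) ->
  \sum_(i <- r) q i t @[t --> F] --> \sum_(i <- r) l i.
Proof.
move=> hq; elim: r => [|a r IH].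
  rewrite big_nil (_ : (fun t => _) = cst 0); first exact: cvg_cst.
  by apply/funext => t; rewrite big_nil.
rewrite big_cons (_ : (fun t => _) = fun t => q a t + \sum_(i <- r) q i t).
  exact: cvgD.
by apply/funext => t; rewrite big_cons.
Qed.

(** The remainder of [box_total_diff] is controlled by the increment of phi, whose quotients by t
    stay below a constant K; taking e / K for the tolerance makes the error at most e after division
    by t. *)
Lemma is_pd_comp b b' m n (V : set 'rV[R]_n) (f : 'rV[R]_n -> R)
    (phi : 'rV[R]_m -> 'rV[R]_n) (a : 'I_m) y (l : 'I_n -> R) :
  relopen b V -> {within V, continuous f} -> diffable b V f ->
  (forall i, {within V, continuous (pd b i f)}) -> V (phi y) -> model b' y ->
  (\forall t \near incr b' a y, V (phi (y + t *: delta_mx 0 a))) ->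
  (forall i, is_pd b' a (fun z => phi z 0 i) y (l i)) ->
  is_pd b' a (fun z => f (phi z)) y (\sum_i pd b i f (phi y) * l i).
Proof.
move=> oV fc fd pc Vy my nV hl; rewrite /is_pd.
pose q i := diff_quot a (fun z => phi z 0 i) y.
pose S t := \sum_i pd b i f (phi y) * q i t.
have hS : S t @[t --> incr b' a y] --> \sum_i pd b i f (phi y) * l i.
  by apply: cvg_sumr => i; apply: cvgM; [exact: cvg_cst|exact: hl].
have hN : \sum_i `|q i t| @[t --> incr b' a y] --> \sum_i `|l i|.
  by apply: cvg_sumr => i; apply: cvg_norm; exact: hl.
pose D := diff_quot a (fun z => f (phi z)) y.
suff H : D t - S t @[t --> incr b' a y] --> (0 : R).
  have E : D = (fun t => D t - S t) \+ S by apply/funext => t /=; rewrite subrK.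
  by rewrite -/D E -[X in _ --> X]add0r; apply: cvgD.
have PF := incr_proper a my.
apply/cvgrPdist_le => e e0.
pose K := \sum_i `|l i| + 1.
have K0 : 0 < K by rewrite ltr_wpDl // sumr_ge0.
have [d d0 Hd] := box_total_diff oV fc fd pc Vy (divr_gt0 e0 K0).
have nK : \forall t \near incr b' a y, \sum_i `|q i t| <= K.
  have /cvgrPdist_le /(_ 1 ltr01) := hN; apply: filterS => t.
  by rewrite /K ler_norml => /andP[h _]; lra.
have nd : \forall t \near incr b' a y, forall i,
    `|(phi (y + t *: delta_mx 0 a) - phi y) 0 i| < d.
  apply: filter_forall => i; have /is_pd_cont/cvgrPdist_lt/(_ _ d0) := hl i.
  by apply: filterS => t; rewrite !mxE distrC.
near=> t.
have t0 : t != 0 by near: t; exact: incr_neq0.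
rewrite sub0r normrN.
pose v := phi (y + t *: delta_mx 0 a) - phi y.
have vq i : v 0 i = t * q i t by rewrite /q /diff_quot mulVKf // !mxE.
have -> : D t - S t = t^-1 * (f (phi y + v) - f (phi y) -
    \sum_i v 0 i * pd b i f (phi y)).
  rewrite /v subrKC mulrBr /D /diff_quot; congr (_ - _).
  by rewrite mulr_sumr; apply: eq_bigr => i _; rewrite -/v vq -mulrA mulKf // mulrC.
rewrite normrM.
have Hv : forall i, `|v 0 i| < d by rewrite /v; near: t.
have mv : model b (phi y + v).
  by apply: oV.1; rewrite /v subrKC; near: t.
apply: le_trans (ler_wpM2l (normr_ge0 _) (Hd v Hv mv)) _.
have -> : \sum_i `|v 0 i| = `|t| * \sum_i `|q i t|.
  by rewrite mulr_sumr; apply: eq_bigr => i _; rewrite vq normrM.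
rewrite mulrCA (mulrA `|t^-1|) normfV mulVf ?normr_eq0 // mul1r.
have : \sum_i `|q i t| <= K by near: t.
move=> /(ler_wpM2l (ltW (divr_gt0 e0 K0))) /le_trans; apply.
by rewrite divfK ?gt_eqF.
Unshelve. all: by end_near.
Qed.

Lemma double_diff b n (V : set 'rV[R]_n) (f : 'rV[R]_n -> R) i j x s :
  V `<=` model b (n := n) -> diffable b V f -> {within V, continuous f} ->
  {within V, continuous (pd b i f)} -> diffable b V (pd b i f) -> 0 < s ->
  (forall u t, 0 <= u <= s -> 0 <= t <= s ->
     V (x + u *: delta_mx 0 i + t *: delta_mx 0 j)) ->
  exists u t, [/\ 0 <= u <= s, 0 <= t <= s &
    f (x + s *: delta_mx 0 i + s *: delta_mx 0 j) - f (x + s *: delta_mx 0 j) -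
    (f (x + s *: delta_mx 0 i) - f x) =
    s * (s * pd b j (pd b i f) (x + u *: delta_mx 0 i + t *: delta_mx 0 j))].
Proof.
move=> Vm fd fc pc pdd s0 hV.
have ss : 0 <= s <= s by rewrite lexx ltW.
have z0 : (0 : R) <= 0 <= s by rewrite lexx ltW.
pose y := x + s *: delta_mx 0 j.
have Vx t : 0 <= t <= s -> V (x + t *: delta_mx 0 i).
  by move=> ht; have := hV t 0 ht z0; rewrite scale0r addr0.
have Vy t : 0 <= t <= s -> V (y + t *: delta_mx 0 i).
  by move=> ht; rewrite /y addrAC; apply: hV.
have := @MVT _ (fun t => f (y + t *: delta_mx 0 i) - f (x + t *: delta_mx 0 i))
  (fun t => pd b i f (y + t *: delta_mx 0 i) - pd b i f (x + t *: delta_mx 0 i)) 0 s s0.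
case.
- move=> t ht; have h1 := line_derive Vm fd Vy ht; have h2 := line_derive Vm fd Vx ht.
  exact: is_deriveB.
- move=> t; apply: cvgB; [exact: (line_continuous fc Vy)|exact: (line_continuous fc Vx)].
move=> c; rewrite in_itv /= => /andP[c0 cs].
have hc : 0 <= c <= s by rewrite !ltW.
rewrite !scale0r !addr0 subr0 => E.
have [t ht Et] := mvt_pos (x := x + c *: delta_mx 0 i) (i := j) Vm pc pdd s0 (fun t => hV c t hc).
exists c, t; split=> //.
have e w : x + w *: delta_mx 0 i + s *: delta_mx 0 j = y + w *: delta_mx 0 i.
  by rewrite /y addrAC.
by rewrite -Et !e mulrC -E -/y; ring.
Qed.

Lemma dist_half (p q z z' e : R) : z = z' -> `|p - z| < e / 2 -> `|q - z'| < e / 2 ->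
  `|p - q| <= e + 0.
Proof.
by move=> ->; rewrite !ltr_norml ler_norml => /andP[? ?] /andP[? ?]; apply/andP; split; lra.
Qed.

(** Each mixed derivative, at some nearby point, equals the same second difference ([double_diff]).
    The square carrying this difference extends from x in the positive directions only, so it lies
    in the half-space even when x is on the wall. *)
Lemma schwarz b n (V : set 'rV[R]_n) (f : 'rV[R]_n -> R) i j x :
  relopen b V -> {within V, continuous f} -> diffable b V f ->
  (forall i, {within V, continuous (pd b i f)} /\ diffable b V (pd b i f)) ->
  (forall i j, {within V, continuous (pd b i (pd b j f))}) ->
  V x -> pd b i (pd b j f) x = pd b j (pd b i f) x.
Proof.
move=> oV fc fd f1 f2 Vx.
have [->//|ij] := eqVneq i j.
apply/eqP; rewrite -subr_eq0 -normr_le0; apply/ler_addgt0Pl => e e0.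
have [Vm oV'] := oV; have [d0 d00 Hd0] := oV' _ Vx.
have e20 : 0 < e / 2 by rewrite divr_gt0.
have /cont_boxP/(_ _ Vx _ e20)[d1 d10 H1] := f2 i j.
have /cont_boxP/(_ _ Vx _ e20)[d2 d20 H2] := f2 j i.
pose s := Num.min d0 (Num.min d1 d2) / 2.
have m0 : 0 < Num.min d0 (Num.min d1 d2) by rewrite !lt_min d00 d10 d20.
have s0 : 0 < s by rewrite divr_gt0.
have [sd0 sd1 sd2] : [/\ s < d0, s < d1 & s < d2].
  have : s < Num.min d0 (Num.min d1 d2) by rewrite /s ltr_pdivrMr // ltr_pMr // ltr1n.
  by rewrite !lt_min => /and3P[].
have bP i' j' u t d : i' != j' -> 0 <= u <= s -> 0 <= t <= s -> s < d ->
    box x d (x + u *: delta_mx 0 i' + t *: delta_mx 0 j').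
  move=> ij' /andP[u0 us] /andP[t0 ts] sd c; rewrite !stepE.
  have -> : x 0 c + u * (c == i')%:R + t * (c == j')%:R - x 0 c =
    u * (c == i')%:R + t * (c == j')%:R by ring.
  case: (eqVneq c i') => [->|_]; rewrite ?(negbTE ij') ?mulr1 ?mulr0 ?addr0 ?add0r.
    by rewrite ger0_norm //; apply: le_lt_trans sd.
  have d0' : 0 < d by apply: lt_trans sd.
  by case: eqP; rewrite ?mulr1 ?mulr0 ?normr0 ?ger0_norm // => _; apply: le_lt_trans sd.
have VP i' j' u t : i' != j' -> 0 <= u <= s -> 0 <= t <= s ->
    V (x + u *: delta_mx 0 i' + t *: delta_mx 0 j').
  move=> ij' hu ht; apply: Hd0; split; last exact: bP.
  move: hu ht => /andP[u0 _] /andP[t0 _].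
  by apply: model_step => //; apply: model_step => //; apply: Vm.
have ji : j != i by rewrite eq_sym.
have [u [t [hu ht E]]] := double_diff Vm fd fc (f1 j).1 (f1 j).2 s0
  (fun u t => VP j i u t ji).
have [u' [t' [hu' ht' E']]] := double_diff Vm fd fc (f1 i).1 (f1 i).2 s0
  (fun u t => VP i j u t ij).
have EE : pd b i (pd b j f) (x + u *: delta_mx 0 j + t *: delta_mx 0 i) =
  pd b j (pd b i f) (x + u' *: delta_mx 0 i + t' *: delta_mx 0 j).
  have s1 : s != 0 by rewrite gt_eqF.
  apply: (mulfI s1); apply: (mulfI s1).
  have aux (p q r w : R) : p - q - (r - w) = p - r - (q - w) by ring.
  have ee : x + s *: delta_mx 0 j + s *: delta_mx 0 i =
    x + s *: delta_mx 0 i + s *: delta_mx 0 j by exact: addrAC.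
  by apply: etrans (esym E) _; apply: etrans _ E'; rewrite ee; exact: aux.
exact: (dist_half EE (H1 _ (VP _ _ _ _ ji hu ht) (bP _ _ _ _ _ ji hu ht sd1))
  (H2 _ (VP _ _ _ _ ij hu' ht') (bP _ _ _ _ _ ij hu' ht' sd2))).
Qed.

Section Smooth.
Variables (b : bool) (n : nat) (V : set 'rV[R]_n).
Implicit Types (f g : 'rV[R]_n -> R).

Lemma CkS m f : Ck b V m.+1 f -> Ck b V m f.
Proof.
elim: m f => [|m IH] f; first by case.
by move=> [fc H]; split=> // i; have [h1 h2] := H i; split=> //; exact: IH.
Qed.

Lemma Ck_cont m f : Ck b V m f -> {within V, continuous f}.
Proof. by case: m => [|m] []. Qed.

Lemma Ck_is_pd m f i x : Ck b V m.+1 f -> V x -> is_pd b i f x (pd b i f x).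
Proof. by move=> [_ /(_ i)[h _]] /h. Qed.

Lemma Ck_pd m f i : Ck b V m.+1 f -> Ck b V m (pd b i f).
Proof. by move=> [_ /(_ i)[]]. Qed.

Lemma cont_eq f g : (forall y, V y -> f y = g y) ->
  {within V, continuous f} -> {within V, continuous g}.
Proof.
move=> fg /cont_boxP H; apply/cont_boxP => x Vx e /(H x Vx)[d d0 Hd].
by exists d => // y Vy /(Hd y Vy); rewrite !fg.
Qed.

Lemma Ck_sub (W : set 'rV[R]_n) m f : W `<=` V -> Ck b V m f -> Ck b W m f.
Proof.
move=> WV; elim: m f => [|m IH] f [fc H]; split=> //.
- by apply: continuous_subspaceW fc.
- by apply: continuous_subspaceW fc.
- by move=> i; have [h1 h2] := H i; split; [move=> x /WV; exact: h1|exact: IH].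
Qed.

Hypothesis oV : relopen b V.

Lemma Ck_eq m f g : (forall y, V y -> f y = g y) -> Ck b V m f -> Ck b V m g.
Proof.
elim: m f g => [|m IH] f g fg [fc H]; split=> //; try exact: cont_eq fc.
move=> i; have [h1 h2] := H i; split.
  by move=> x Vx; rewrite -(diff_quot_near i oV Vx fg); exact: h1.
by apply: IH h2 => y Vy; apply: pd_eq oV Vy fg.
Qed.

Lemma CkI m f (p : 'I_n -> 'rV[R]_n -> R) : {within V, continuous f} ->
  (forall i x, V x -> is_pd b i f x (p i x)) -> (forall i, Ck b V m (p i)) ->
  Ck b V m.+1 f.
Proof.
move=> fc hp cp; split=> // i; split.
  by move=> x Vx; apply/cvg_ex; exists (p i x); exact: hp.
apply: Ck_eq (cp i) => y Vy; symmetry; apply: is_pdE; last exact: hp.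
exact: oV.1.
Qed.

Lemma Ck_cst m c : Ck b V m (fun=> c).
Proof.
elim: m c => [|m IH] c.
  by split=> //; apply/cont_boxP => x _ e e0; exists 1 => // y _ _; rewrite subrr normr0.
apply: (CkI (p := fun _ _ => 0)) => //.
  by apply/cont_boxP => x _ e e0; exists 1 => // y _ _; rewrite subrr normr0.
by move=> i x _; exact: is_pd_cst.
Qed.

Lemma CkD m f g : Ck b V m f -> Ck b V m g -> Ck b V m (fun x => f x + g x).
Proof.
have cD f' g' : {within V, continuous f'} -> {within V, continuous g'} ->
   {within V, continuous (fun x => f' x + g' x)}.
  by move=> /subspace_continuousP h1 /subspace_continuousP h2;
     apply/subspace_continuousP => x Vx; apply: cvgD; [apply: h1|apply: h2].
elim: m f g => [|m IH] f g hf hg.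
  by split=> //; apply: cD; apply: Ck_cont; [exact: hf|exact: hg].
apply: (CkI (p := fun i x => pd b i f x + pd b i g x)).
- by apply: cD; apply: Ck_cont; [exact: hf|exact: hg].
- by move=> i x Vx; apply: is_pdD; [exact: Ck_is_pd hf Vx|exact: Ck_is_pd hg Vx].
- by move=> i; apply: IH; apply: Ck_pd.
Qed.

Lemma contM f g : {within V, continuous f} -> {within V, continuous g} ->
  {within V, continuous (fun x => f x * g x)}.
Proof.
by move=> /subspace_continuousP h1 /subspace_continuousP h2;
     apply/subspace_continuousP => x Vx; apply: cvgM; [apply: h1|apply: h2].
Qed.

Lemma CkM m f g : Ck b V m f -> Ck b V m g -> Ck b V m (fun x => f x * g x).
Proof.
elim: m f g => [|m IH] f g hf hg.
  by split=> //; apply: contM; apply: Ck_cont; [exact: hf|exact: hg].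
apply: (CkI (p := fun i x => pd b i f x * g x + f x * pd b i g x)).
- by apply: contM; apply: Ck_cont; [exact: hf|exact: hg].
- by move=> i x Vx; apply: is_pdM; [exact: Ck_is_pd hf Vx|exact: Ck_is_pd hg Vx].
- by move=> i; apply: CkD; [apply: IH (Ck_pd i hf) (CkS hg)|apply: IH (CkS hf) (Ck_pd i hg)].
Qed.

Lemma Ck_sum (I : Type) (r : seq I) m (F : I -> 'rV[R]_n -> R) :
  (forall i, Ck b V m (F i)) -> Ck b V m (fun x => \sum_(i <- r) F i x).
Proof.
move=> hF; elim: r => [|a r IH].
  by apply: Ck_eq (Ck_cst m 0) => y _; rewrite big_nil.
by apply: Ck_eq (CkD (hF a) IH) => y _; rewrite big_cons.
Qed.

(* Used with h = inv, exp and ln, whose derivatives are polynomial in functions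
   already known to preserve differentiability. *)
Lemma Ck_comp1 (P : R -> Prop) (h h' : R -> R) :
  (forall y, P y -> is_derive y (1 : R) h (h' y)) ->
  (forall m f, Ck b V m f -> (forall x, V x -> P (f x)) ->
     Ck b V m (fun x => h (f x)) -> Ck b V m (fun x => h' (f x))) ->
  forall m f, Ck b V m f -> (forall x, V x -> P (f x)) -> Ck b V m (fun x => h (f x)).
Proof.
move=> hd hh m f; elim: m => [|m IH] hf Pf.
  split=> //; apply/subspace_continuousP => x Vx.
  have /subspace_continuousP/(_ x Vx) fx := Ck_cont hf.
  have [dh _] := hd _ (Pf x Vx).
  have hc : {for f x, continuous h} by apply/differentiable_continuous/derivable1_diffP.
  exact: cvg_comp fx hc.
have hf' := CkS hf; have hc := IH hf' Pf.
apply: (CkI (p := fun i x => h' (f x) * pd b i f x)).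
- exact: Ck_cont hc.
- by move=> i x Vx; apply: is_pd_comp1; [exact: hd (Pf x Vx)|exact: Ck_is_pd hf Vx].
- by move=> i; apply: CkM; [exact: hh|exact: Ck_pd].
Qed.

End Smooth.

Lemma Ck_comp b b' m n (V : set 'rV[R]_n) (W : set 'rV[R]_m) (f : 'rV[R]_n -> R)
   (phi : 'rV[R]_m -> 'rV[R]_n) r :
  relopen b V -> relopen b' W -> (forall y, W y -> V (phi y)) ->
  Ck b V r f -> (forall i, Ck b' W r (fun y => phi y 0 i)) ->
  Ck b' W r (fun y => f (phi y)).
Proof.
move=> oV oW WV; elim: r f => [|r IH] f hf hphi.
  split=> //; apply/cont_boxP => y Wy e e0.
  have /cont_boxP/(_ _ (WV _ Wy) _ e0)[d d0 Hd] := Ck_cont hf.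
  have /choice[D DP] : forall i, exists d' : R, 0 < d' /\ forall z, W z -> box y d' z ->
    `|phi y 0 i - phi z 0 i| < d.
    move=> i; have /cont_boxP/(_ _ Wy _ d0)[d' ? ?] := Ck_cont (hphi i).
    by exists d'.
  exists (\big[Num.min/1]_i D i).
    by elim/big_ind: _ => // [a c a0 c0|i _]; [rewrite lt_min a0 c0|case: (DP i)].
  move=> z Wz hz; apply: Hd; first exact: WV.
  move=> i; rewrite distrC; apply: (DP i).2 => // j; apply: lt_le_trans (hz j) _.
  exact: bigmin_le_cond.
apply: (CkI oW (p := fun a y => \sum_i pd b i f (phi y) * pd b' a (fun z => phi z 0 i) y)).
- apply: Ck_cont (IH f (CkS hf) (fun i => CkS (hphi i))).
- move=> a y Wy; apply: (is_pd_comp oV) => //.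
  + exact: Ck_cont hf.
  + by move=> i x Vx; apply: Ck_is_pd hf Vx.
  + by move=> i; apply: Ck_cont (Ck_pd i hf).
  + exact: WV.
  + exact: oW.1.
  + by apply: filterS (relopen_near a oW Wy) => t; apply: WV.
  + by move=> i; apply: Ck_is_pd (hphi i) Wy.
- move=> a; apply: Ck_sum => // i; apply: CkM => //; last exact: Ck_pd.
  by apply: IH; [exact: Ck_pd|move=> j; apply: CkS].
Qed.

End Calculus.

(** * Smooth functions and directional derivatives *)

Section Smooth.
Context {R : realType}.

Section Rules.
Variables (b : bool) (n : nat) (V : set 'rV[R]_n).
Implicit Types (f g : 'rV[R]_n -> R).

Lemma smooth_sub (W : set 'rV[R]_n) f :
  W `<=` V -> smooth_on b V f -> smooth_on b W f.
Proof. by move=> WV sf m; apply: Ck_sub (sf m). Qed.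

Lemma smooth_pd i f : smooth_on b V f -> smooth_on b V (pd b i f).
Proof. by move=> sf m; apply: Ck_pd (sf m.+1). Qed.

Lemma smooth_is_pd i f x : smooth_on b V f -> V x -> is_pd b i f x (pd b i f x).
Proof. by move=> sf; apply: Ck_is_pd (sf 1%N). Qed.

Lemma smooth_cont f : smooth_on b V f -> {within V, continuous f}.
Proof. by move=> sf; apply: Ck_cont (sf 0%N). Qed.

Hypothesis oV : relopen b V.

Lemma smooth_eq f g : (forall y, V y -> f y = g y) ->
  smooth_on b V f -> smooth_on b V g.
Proof. by move=> fg sf m; apply: Ck_eq fg (sf m). Qed.

Lemma smooth_cst c : smooth_on b V (fun=> c).
Proof. by move=> m; apply: Ck_cst. Qed.

Lemma smoothD f g : smooth_on b V f -> smooth_on b V g ->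
  smooth_on b V (fun x => f x + g x).
Proof. by move=> sf sg m; apply: CkD. Qed.

Lemma smoothM f g : smooth_on b V f -> smooth_on b V g ->
  smooth_on b V (fun x => f x * g x).
Proof. by move=> sf sg m; apply: CkM. Qed.

Lemma smoothN f : smooth_on b V f -> smooth_on b V (fun x => - f x).
Proof.
move=> sf; apply: smooth_eq (smoothM (smooth_cst (-1)) sf) => y _.
by rewrite mulN1r.
Qed.

Lemma smoothB f g : smooth_on b V f -> smooth_on b V g ->
  smooth_on b V (fun x => f x - g x).
Proof. by move=> sf sg; apply: smoothD => //; apply: smoothN. Qed.

Lemma smooth_sum (I : Type) (r : seq I) (F : I -> 'rV[R]_n -> R) :
  (forall i, smooth_on b V (F i)) -> smooth_on b V (fun x => \sum_(i <- r) F i x).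
Proof. by move=> sF m; apply: Ck_sum => // i; apply: sF. Qed.

Lemma smooth_prod (I : Type) (r : seq I) (F : I -> 'rV[R]_n -> R) :
  (forall i, smooth_on b V (F i)) -> smooth_on b V (fun x => \prod_(i <- r) F i x).
Proof.
move=> sF; elim: r => [|a r IH].
  by apply: smooth_eq (smooth_cst 1) => y _; rewrite big_nil.
by apply: smooth_eq (smoothM (sF a) IH) => y _; rewrite big_cons.
Qed.

Lemma smoothX f k : smooth_on b V f -> smooth_on b V (fun x => f x ^+ k).
Proof.
move=> sf; elim: k => [|k IH]; first exact: smooth_cst.
by apply: smooth_eq (smoothM sf IH) => y _; rewrite exprS.
Qed.

Lemma is_derive_inv (y : R) : y != 0 -> is_derive y (1 : R) (fun z => z^-1) (- (y^-1 * y^-1)).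
Proof.
move=> y0; have := is_deriveV (f := id) (x := y) (v := 1) (t := 1) y0 _.
by rewrite /= /GRing.scale /= mulr1 expr2 invfM; apply; exact: is_derive_id.
Qed.

Lemma smoothV f : smooth_on b V f -> (forall x, V x -> f x != 0) ->
  smooth_on b V (fun x => (f x)^-1).
Proof.
move=> sf f0 m; apply: (Ck_comp1 oV (P := fun y => y != 0)
  (h' := fun y => - (y^-1 * y^-1))) => //.
- exact: is_derive_inv.
- move=> m' f' _ _ hf'.
  apply: Ck_eq (CkM oV (Ck_cst oV m' (-1)) (CkM oV hf' hf')) => // y _.
  by rewrite mulN1r.
Qed.

Lemma smooth_exp f : smooth_on b V f -> smooth_on b V (fun x => expR (f x)).
Proof.
by move=> sf m; apply: (Ck_comp1 oV (P := fun=> True) (h' := expR)).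
Qed.

Lemma smooth_ln f : smooth_on b V f -> (forall x, V x -> 0 < f x) ->
  smooth_on b V (fun x => ln (f x)).
Proof.
move=> sf f0 m; apply: (Ck_comp1 oV (P := fun y => 0 < y) (h' := fun y => y^-1)) => //.
- move=> m' f' cf' f'0 _.
  apply: (Ck_comp1 oV (P := fun y => y != 0) (h' := fun y => - (y^-1 * y^-1))) => //.
  + exact: is_derive_inv.
  + move=> m'' f'' _ _ hf'.
    apply: Ck_eq (CkM oV (Ck_cst oV m'' (-1)) (CkM oV hf' hf')) => // y _.
    by rewrite mulN1r.
  + by move=> x /f'0; rewrite lt0r => /andP[].
Qed.

Lemma smooth_coord j : smooth_on b V (fun x => x 0 j).
Proof.
case=> [|m].
  split=> //; apply/cont_boxP => x _ e e0; exists e => // y _ /(_ j).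
  by rewrite distrC.
apply: (CkI oV (p := fun i _ => (j == i)%:R)).
- apply/cont_boxP => x _ e e0; exists e => // y _ /(_ j).
  by rewrite distrC.
- by move=> i x _; apply: is_pd_coord.
- by move=> i; apply: Ck_cst.
Qed.

(** The direction is a vector, possibly the value at x of a field, rather than an index: tensor
    identities become scalar identities within reach of [ring]. *)
Definition dd (v : 'rV[R]_n) f x := \sum_i v 0 i * pd b i f x.

Lemma ddE v f x : dd v f x = \sum_i v 0 i * pd b i f x.
Proof. by []. Qed.

Lemma smooth_dd v f : smooth_on b V f -> smooth_on b V (dd v f).
Proof.
by move=> sf; apply: smooth_sum => i; apply: smoothM (smooth_cst _) (smooth_pd i sf).
Qed.

Lemma dd_delta i f x : dd (delta_mx 0 i) f x = pd b i f x.
Proof.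
rewrite /dd (bigD1 i) //= big1 ?addr0; first by rewrite mxE !eqxx mul1r.
by move=> j ji; rewrite mxE eqxx (negbTE ji) mul0r.
Qed.

Lemma dd_eq v f g x : V x -> (forall y, V y -> f y = g y) -> dd v f x = dd v g x.
Proof. by move=> Vx fg; apply: eq_bigr => i _; rewrite (pd_eq i oV Vx fg). Qed.

Let mV x : V x -> model b x. Proof. exact: oV.1. Qed.

Lemma is_pd_dd v f x (l : 'I_n -> R) : V x -> (forall i, is_pd b i f x (l i)) ->
  dd v f x = \sum_i v 0 i * l i.
Proof. by move=> Vx hl; apply: eq_bigr => i _; rewrite (is_pdE (mV Vx) (hl i)). Qed.

Lemma dd_cst v c x : V x -> dd v (fun=> c) x = 0.
Proof.
move=> Vx; rewrite (is_pd_dd v Vx (fun i => is_pd_cst b i c x)).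
by rewrite big1 // => i _; rewrite mulr0.
Qed.

Lemma dd_coord v j x : V x -> dd v (fun y => y 0 j) x = v 0 j.
Proof.
move=> Vx; rewrite (is_pd_dd v Vx (fun i => @is_pd_coord R b n i j x)).
rewrite (bigD1 j) //= eqxx mulr1 big1 ?addr0 // => i ij.
by rewrite eq_sym (negbTE ij) mulr0.
Qed.

Lemma ddD v f g x : smooth_on b V f -> smooth_on b V g -> V x ->
  dd v (fun y => f y + g y) x = dd v f x + dd v g x.
Proof.
move=> sf sg Vx; rewrite (is_pd_dd v Vx (fun i => is_pdD (smooth_is_pd (i:=i) sf Vx)
  (smooth_is_pd (i:=i) sg Vx))) -big_split /=.
by apply: eq_bigr => i _; rewrite mulrDr.
Qed.

Lemma ddM v f g x : smooth_on b V f -> smooth_on b V g -> V x ->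
  dd v (fun y => f y * g y) x = dd v f x * g x + f x * dd v g x.
Proof.
move=> sf sg Vx; rewrite (is_pd_dd v Vx (fun i => is_pdM (smooth_is_pd (i:=i) sf Vx)
  (smooth_is_pd (i:=i) sg Vx))) mulr_suml mulr_sumr -big_split /=.
by apply: eq_bigr => i _; rewrite mulrDr mulrA (mulrCA (f x)).
Qed.

Lemma dd_comp1 v (h : R -> R) f x d : is_derive (f x) (1 : R) h d ->
  smooth_on b V f -> V x -> dd v (fun y => h (f y)) x = d * dd v f x.
Proof.
move=> hd sf Vx.
rewrite (is_pd_dd v Vx (fun i => is_pd_comp1 hd (smooth_is_pd (i:=i) sf Vx))) mulr_sumr.
by apply: eq_bigr => i _; rewrite mulrCA.
Qed.

Lemma ddZ v c f x : smooth_on b V f -> V x -> dd v (fun y => c * f y) x = c * dd v f x.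
Proof. by move=> sf Vx; rewrite ddM ?dd_cst ?mul0r ?add0r //; exact: smooth_cst. Qed.

Lemma ddN v f x : smooth_on b V f -> V x -> dd v (fun y => - f y) x = - dd v f x.
Proof.
move=> sf Vx; rewrite (dd_eq v (g := fun y => -1 * f y) Vx).
  by rewrite ddZ // mulN1r.
by move=> y _; rewrite mulN1r.
Qed.

Lemma ddB v f g x : smooth_on b V f -> smooth_on b V g -> V x ->
  dd v (fun y => f y - g y) x = dd v f x - dd v g x.
Proof. by move=> sf sg Vx; rewrite ddD ?ddN //; exact: smoothN. Qed.

Lemma dd_sum v (I : Type) (r : seq I) (F : I -> 'rV[R]_n -> R) x :
  (forall i, smooth_on b V (F i)) -> V x ->
  dd v (fun y => \sum_(i <- r) F i y) x = \sum_(i <- r) dd v (F i) x.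
Proof.
move=> sF Vx; elim: r => [|a r IH].
  rewrite big_nil (dd_eq v (g := fun=> 0) Vx) ?dd_cst // => y _.
  by rewrite big_nil.
rewrite big_cons -IH -ddD //; last exact: smooth_sum.
by apply: dd_eq => // y _; rewrite big_cons.
Qed.

Lemma dd_exp v f x : smooth_on b V f -> V x ->
  dd v (fun y => expR (f y)) x = expR (f x) * dd v f x.
Proof. by move=> sf Vx; exact: (dd_comp1 v (is_derive_expR (f x)) sf Vx). Qed.

Lemma dd_ln v f x : smooth_on b V f -> V x -> 0 < f x ->
  dd v (fun y => ln (f y)) x = (f x)^-1 * dd v f x.
Proof. by move=> sf Vx f0; exact: (dd_comp1 v (is_derive1_ln f0) sf Vx). Qed.

Lemma ddvD u v f x : dd (u + v) f x = dd u f x + dd v f x.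
Proof. by rewrite /dd -big_split; apply: eq_bigr => i _; rewrite mxE mulrDl. Qed.

Lemma ddvZ c v f x : dd (c *: v) f x = c * dd v f x.
Proof. by rewrite /dd mulr_sumr; apply: eq_bigr => i _; rewrite mxE mulrA. Qed.

Lemma ddvN v f x : dd (- v) f x = - dd v f x.
Proof. by rewrite -scaleN1r ddvZ mulN1r. Qed.

Lemma ddvB u v f x : dd (u - v) f x = dd u f x - dd v f x.
Proof. by rewrite ddvD ddvN. Qed.

Lemma pdC i j f x : smooth_on b V f -> V x -> pd b i (pd b j f) x = pd b j (pd b i f) x.
Proof.
move=> sf; apply: (schwarz i j oV).
- exact: smooth_cont.
- by move=> a y; apply: smooth_is_pd.
- move=> a; split; first exact/smooth_cont/smooth_pd.
  by move=> c y; apply: smooth_is_pd; apply: smooth_pd.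
- by move=> a c; do 2 apply: smooth_pd || exact/smooth_cont/smooth_pd/smooth_pd.
Qed.

Lemma dd_dd u v f x : smooth_on b V f -> V x ->
  dd u (dd v f) x = \sum_i \sum_j u 0 i * v 0 j * pd b i (pd b j f) x.
Proof.
move=> sf Vx.
transitivity (\sum_j dd u (fun y => v 0 j * pd b j f y) x).
  by apply: dd_sum => // j; apply: smoothM (smooth_cst _) (smooth_pd j sf).
rewrite [RHS]exchange_big /=; apply: eq_bigr => j _.
rewrite ddZ ?mulr_sumr; [|exact: smooth_pd|by []].
by apply: eq_bigr => i _; rewrite mulrA (mulrC (v 0 j)).
Qed.

Lemma ddC u v f x : smooth_on b V f -> V x -> dd u (dd v f) x = dd v (dd u f) x.
Proof.
move=> sf Vx; rewrite !dd_dd // [RHS]exchange_big /=.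
apply: eq_bigr => i _; apply: eq_bigr => j _.
by rewrite pdC // (mulrC (u 0 i)).
Qed.

End Rules.

End Smooth.

Lemma relopen_pos (R : realType) b n (V : set 'rV[R]_n) f : relopen b V -> smooth_on b V f ->
  relopen b (V `&` [set x | 0 < f x]).
Proof.
move=> oV sf; split=> [x [/(oV.1) //]|x [Vx fx]].
have /cont_boxP/(_ x Vx _ fx)[d d0 hd] := smooth_cont sf.
have [e e0 he] := oV.2 _ Vx.
exists (Num.min d e); first by rewrite lt_min d0 e0.
move=> y [my hy]; have Vy : V y.
  by apply: he; split=> // i; have := hy i; rewrite lt_min => /andP[].
have hy' : box x d y by move=> i; have := hy i; rewrite lt_min => /andP[].
split=> //=; have := hd y Vy hy'; rewrite ltr_norml => /andP[_].
by rewrite ltrBlDr ltrDl.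
Qed.

(** * Bilinear forms, fields of vectors and of matrices *)

Section Fields.
Context {R : realType}.

Definition bil p q (B : 'M[R]_(p, q)) (u : 'rV[R]_p) (w : 'rV[R]_q) : R :=
  (u *m B *m w^T) 0 0.

Lemma bilE p q (B : 'M[R]_(p, q)) u w :
  bil B u w = \sum_i \sum_j u 0 i * B i j * w 0 j.
Proof.
rewrite /bil mxE exchange_big /=; apply: eq_bigr => j _.
by rewrite !mxE mulr_suml.
Qed.

Lemma bil_def p q (B : 'M[R]_(p, q)) u w : bil B u w = (u *m B *m w^T) 0 0.
Proof. by []. Qed.

Lemma bilDl p q (B : 'M[R]_(p, q)) u u' w : bil B (u + u') w = bil B u w + bil B u' w.
Proof. by rewrite /bil !mulmxDl mxE. Qed.
Lemma bilDr p q (B : 'M[R]_(p, q)) u w w' : bil B u (w + w') = bil B u w + bil B u w'.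
Proof. by rewrite /bil linearD mulmxDr mxE. Qed.
Lemma bilZl p q (B : 'M[R]_(p, q)) c u w : bil B (c *: u) w = c * bil B u w.
Proof. by rewrite /bil -!scalemxAl mxE. Qed.
Lemma bilZr p q (B : 'M[R]_(p, q)) c u w : bil B u (c *: w) = c * bil B u w.
Proof. by rewrite /bil linearZ -scalemxAr mxE. Qed.
Lemma bilNl p q (B : 'M[R]_(p, q)) u w : bil B (- u) w = - bil B u w.
Proof. by rewrite -scaleN1r bilZl mulN1r. Qed.
Lemma bilNr p q (B : 'M[R]_(p, q)) u w : bil B u (- w) = - bil B u w.
Proof. by rewrite -scaleN1r bilZr mulN1r. Qed.
Lemma bilBl p q (B : 'M[R]_(p, q)) u u' w : bil B (u - u') w = bil B u w - bil B u' w.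
Proof. by rewrite bilDl bilNl. Qed.
Lemma bilBr p q (B : 'M[R]_(p, q)) u w w' : bil B u (w - w') = bil B u w - bil B u w'.
Proof. by rewrite bilDr bilNr. Qed.
Lemma bil0l p q (B : 'M[R]_(p, q)) w : bil B 0 w = 0.
Proof. by rewrite -(scale0r 0) bilZl mul0r. Qed.
Lemma bil0r p q (B : 'M[R]_(p, q)) u : bil B u 0 = 0.
Proof. by rewrite -(scale0r 0) bilZr mul0r. Qed.
Lemma bil_suml p q (B : 'M[R]_(p, q)) u w :
  bil B u w = \sum_i u 0 i * bil B (delta_mx 0 i) w.
Proof.
rewrite /bil -mulmxA mxE; apply: eq_bigr => i _.
by rewrite -mulmxA -rowE !mxE.
Qed.
Lemma bil_delta p q (B : 'M[R]_(p, q)) i j :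
  bil B (delta_mx 0 i) (delta_mx 0 j) = B i j.
Proof. by rewrite /bil -rowE trmx_delta -colE !mxE. Qed.
Lemma bilC p (B : 'M[R]_p) u w : B^T = B -> bil B u w = bil B w u.
Proof.
move=> Bs; rewrite /bil -[u *m B *m w^T]trmxK mxE !trmx_mul trmxK Bs.
by rewrite mulmxA.
Qed.
Lemma bil_mulmxl p q r (B : 'M[R]_(p, q)) (J : 'M[R]_(r, p)) u w :
  bil (J *m B) u w = bil B (u *m J) w.
Proof. by rewrite /bil mulmxA. Qed.
Lemma bil_mulmxr p q s (B : 'M[R]_(p, q)) (K : 'M[R]_(s, q)) u w :
  bil (B *m K^T) u w = bil B u (w *m K).
Proof. by rewrite /bil trmx_mul !mulmxA. Qed.
Lemma bil_mulmx p q r s (B : 'M[R]_(p, q)) (J : 'M[R]_(r, p)) (K : 'M[R]_(s, q)) u w :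
  bil (J *m B *m K^T) u w = bil B (u *m J) (w *m K).
Proof. by rewrite /bil trmx_mul !mulmxA. Qed.

Lemma bilMD p q (A B : 'M[R]_(p, q)) u w : bil (A + B) u w = bil A u w + bil B u w.
Proof. by rewrite /bil mulmxDr mulmxDl mxE. Qed.
Lemma bilMZ p q c (B : 'M[R]_(p, q)) u w : bil (c *: B) u w = c * bil B u w.
Proof. by rewrite /bil -scalemxAr -scalemxAl mxE. Qed.
Lemma bilMN p q (B : 'M[R]_(p, q)) u w : bil (- B) u w = - bil B u w.
Proof. by rewrite -scaleN1r bilMZ mulN1r. Qed.

Lemma rowD n (u v : 'rV[R]_n) j : (u + v) 0 j = u 0 j + v 0 j.
Proof. by rewrite mxE. Qed.
Lemma rowN n (u : 'rV[R]_n) j : (- u) 0 j = - u 0 j.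
Proof. by rewrite mxE. Qed.
Lemma rowZ n c (u : 'rV[R]_n) j : (c *: u) 0 j = c * u 0 j.
Proof. by rewrite mxE. Qed.

Variables (b : bool) (n : nat) (V : set 'rV[R]_n).

Definition vsmooth p (Z : 'rV[R]_n -> 'rV[R]_p) :=
  forall j, smooth_on b V (fun y => Z y 0 j).
Definition msmooth p q (B : 'rV[R]_n -> 'M[R]_(p, q)) :=
  forall i j, smooth_on b V (fun y => B y i j).

Definition vd p v (Z : 'rV[R]_n -> 'rV[R]_p) x : 'rV[R]_p :=
  \row_j dd b v (fun y => Z y 0 j) x.
Definition md p q v (B : 'rV[R]_n -> 'M[R]_(p, q)) x : 'M[R]_(p, q) :=
  \matrix_(i, j) dd b v (fun y => B y i j) x.

Lemma vdE p v (Z : 'rV[R]_n -> 'rV[R]_p) j :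
  (fun y => vd v Z y 0 j) = dd b v (fun y => Z y 0 j).
Proof. by apply/funext => y; rewrite mxE. Qed.

Lemma vdjE p v (Z : 'rV[R]_n -> 'rV[R]_p) j x :
  vd v Z x 0 j = dd b v (fun y => Z y 0 j) x.
Proof. by rewrite mxE. Qed.

Lemma mdE p q v (B : 'rV[R]_n -> 'M[R]_(p, q)) i j x :
  md v B x i j = dd b v (fun y => B y i j) x.
Proof. by rewrite mxE. Qed.

Hypothesis oV : relopen b V.

Lemma vsmooth_cst p (v : 'rV[R]_p) : vsmooth (fun=> v).
Proof. by move=> j; apply: smooth_cst. Qed.

Lemma vd_jac p v (Z : 'rV[R]_n -> 'rV[R]_p) x : vd v Z x = v *m jac b Z x.
Proof.
by apply/rowP => j; rewrite !mxE; apply: eq_bigr => i _; rewrite mxE.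
Qed.

Lemma vdDl p u v (Z : 'rV[R]_n -> 'rV[R]_p) x : vd (u + v) Z x = vd u Z x + vd v Z x.
Proof. by rewrite !vd_jac mulmxDl. Qed.
Lemma vdNl p v (Z : 'rV[R]_n -> 'rV[R]_p) x : vd (- v) Z x = - vd v Z x.
Proof. by rewrite !vd_jac mulNmx. Qed.
Lemma vdZl p c v (Z : 'rV[R]_n -> 'rV[R]_p) x : vd (c *: v) Z x = c *: vd v Z x.
Proof. by rewrite !vd_jac scalemxAl. Qed.

Lemma vd_cst p u (v : 'rV[R]_p) x : V x -> vd u (fun=> v) x = 0.
Proof. by move=> Vx; apply/rowP => j; rewrite !mxE (dd_cst oV) //. Qed.

Lemma smooth_bil p q (B : 'rV[R]_n -> 'M[R]_(p, q)) Z W :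
  msmooth B -> vsmooth Z -> vsmooth W -> smooth_on b V (fun y => bil (B y) (Z y) (W y)).
Proof.
move=> sB sZ sW.
have H : smooth_on b V (fun y => \sum_i \sum_j Z y 0 i * B y i j * W y 0 j).
  apply: smooth_sum => // i; apply: smooth_sum => // j.
  by apply: smoothM => //; apply: smoothM.
by apply: smooth_eq H => // y _; rewrite bilE.
Qed.

(** A product rule for expressions linear in a field: once Z is differentiated, once Z is frozen at
    x and the rest is differentiated. Linearity is stated as expansion in the standard basis, the
    form in which the proof uses it. *)
Lemma dd_lin p (L : 'rV[R]_p -> 'rV[R]_n -> R) (Z : 'rV[R]_n -> 'rV[R]_p) u x :
  (forall z y, V y -> L z y = \sum_i z 0 i * L (delta_mx 0 i) y) ->
  (forall i, smooth_on b V (L (delta_mx 0 i))) -> vsmooth Z -> V x ->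
  dd b u (fun y => L (Z y) y) x = L (vd u Z x) x + dd b u (L (Z x)) x.
Proof.
move=> hL sL sZ Vx.
rewrite (dd_eq oV _ (g := fun y => \sum_i Z y 0 i * L (delta_mx 0 i) y)) //; last first.
  by move=> y Vy; rewrite hL.
rewrite (dd_sum oV) //; last by move=> i; apply: smoothM.
rewrite hL // (dd_eq oV _ (f := L (Z x)) (g := fun y => \sum_i Z x 0 i * L (delta_mx 0 i) y)) //;
  last by move=> y Vy; rewrite hL.
rewrite (dd_sum oV) //; last by move=> i; apply: smoothM => //; apply: smooth_cst.
rewrite -big_split /=; apply: eq_bigr => i _.
by rewrite (ddM oV) // (ddZ oV) // mxE.
Qed.

Lemma dd_ddZ (f : 'rV[R]_n -> R) Z u x : smooth_on b V f -> vsmooth Z -> V x ->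
  dd b u (fun y => dd b (Z y) f y) x = dd b (vd u Z x) f x + dd b u (dd b (Z x) f) x.
Proof.
move=> sf sZ Vx; apply: (dd_lin (L := fun z y => dd b z f y)) => //.
- by move=> z y Vy; apply: eq_bigr => i _; rewrite dd_delta.
- by move=> i; apply: smooth_dd.
Qed.

Lemma smooth_ddZ (f : 'rV[R]_n -> R) Z : smooth_on b V f -> vsmooth Z ->
  smooth_on b V (fun y => dd b (Z y) f y).
Proof.
by move=> sf sZ; apply: smooth_sum => // i; apply: smoothM => //; apply: smooth_pd.
Qed.

Lemma dd_bil p q (B : 'rV[R]_n -> 'M[R]_(p, q)) Z W u x :
  msmooth B -> vsmooth Z -> vsmooth W -> V x ->
  dd b u (fun y => bil (B y) (Z y) (W y)) x =
  bil (md u B x) (Z x) (W x) + bil (B x) (vd u Z x) (W x) + bil (B x) (Z x) (vd u W x).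
Proof.
move=> sB sZ sW Vx.
rewrite (dd_eq oV _ (g := fun y => \sum_i \sum_j Z y 0 i * B y i j * W y 0 j)) //;
  last by move=> y _; rewrite bilE.
have s1 i j : smooth_on b V (fun y => Z y 0 i * B y i j) by apply: smoothM.
have s2 i j : smooth_on b V (fun y => Z y 0 i * B y i j * W y 0 j) by apply: smoothM.
rewrite (dd_sum oV) //; last by move=> i; apply: smooth_sum.
rewrite !bilE -!big_split /=; apply: eq_bigr => i _.
rewrite (dd_sum oV) // -!big_split /=; apply: eq_bigr => j _.
rewrite (ddM oV) // (ddM oV) // !mxE.
move: (dd _ _ _ _) (dd _ _ _ _) (dd _ _ _ _) (Z x 0 i) (B x i j) (W x 0 j) => a c d e f h.
ring.
Qed.

Lemma md_bil p q (B : 'rV[R]_n -> 'M[R]_(p, q)) u v w x : msmooth B -> V x ->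
  bil (md u B x) v w = dd b u (fun y => bil (B y) v w) x.
Proof.
move=> sB Vx; rewrite (dd_bil _ sB (vsmooth_cst v) (vsmooth_cst w) Vx).
by rewrite !vd_cst // bil0l bil0r !addr0.
Qed.

Lemma smooth_det p (B : 'rV[R]_n -> 'M[R]_p) : msmooth B ->
  smooth_on b V (fun y => \det (B y)).
Proof.
move=> sB; apply: smooth_sum => // s; apply: smoothM => //; first exact: smooth_cst.
exact: smooth_prod.
Qed.

Lemma smooth_invmx p (B : 'rV[R]_n -> 'M[R]_p) : msmooth B ->
  (forall x, V x -> B x \in unitmx) -> msmooth (fun y => invmx (B y)).
Proof.
move=> sB uB i j.
have H : smooth_on b V (fun y => (\det (B y))^-1 * \adj (B y) i j).
  apply: smoothM => //.
    by apply: smoothV => //; [exact: smooth_det|move=> x /uB; rewrite unitmxE unitfE].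
  have : smooth_on b V (fun y => (-1) ^+ (j + i) * \det (row' j (col' i (B y)))).
    apply: smoothM => //; first exact: smooth_cst.
    apply: smooth_det => a c; have := sB (lift j a) (lift i c).
    by apply: smooth_eq => // y _; rewrite !mxE.
  by apply: smooth_eq => // y _; rewrite mxE /cofactor.
by apply: smooth_eq H => // y Vy; rewrite /invmx uB // !mxE.
Qed.

End Fields.

(** * Chain rule and product rules for maps *)

Section ChainRule.
Context {R : realType}.
Variables (b b' : bool) (m n : nat) (V : set 'rV[R]_n) (W : set 'rV[R]_m).
Hypotheses (oV : relopen b V) (oW : relopen b' W).
Variable phi : 'rV[R]_m -> 'rV[R]_n.
Hypotheses (WV : forall y, W y -> V (phi y)) (sphi : vsmooth b' W phi).

Lemma smooth_comp f : smooth_on b V f -> smooth_on b' W (fun y => f (phi y)).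
Proof.
move=> sf r; apply: (Ck_comp oV oW WV (sf r)) => i; exact: sphi.
Qed.

Lemma dd_comp f v y : smooth_on b V f -> W y ->
  dd b' v (fun z => f (phi z)) y = dd b (vd b' v phi y) f (phi y).
Proof.
move=> sf Wy.
have H a : is_pd b' a (fun z => f (phi z)) y
    (\sum_i pd b i f (phi y) * pd b' a (fun z => phi z 0 i) y).
  apply: (is_pd_comp oV) => //.
  + exact: smooth_cont sf.
  + by move=> i x Vx; apply: smooth_is_pd.
  + by move=> i; apply/smooth_cont/smooth_pd.
  + exact: WV.
  + exact: oW.1.
  + by apply: filterS (relopen_near a oW Wy) => t; apply: WV.
  + by move=> i; apply: (smooth_is_pd (sphi i)).
rewrite (is_pd_dd oW v Wy H) /dd.
transitivity (\sum_a \sum_i v 0 a * (pd b i f (phi y) * pd b' a (fun z => phi z 0 i) y)).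
  by apply: eq_bigr => a _; rewrite mulr_sumr.
rewrite exchange_big /=; apply: eq_bigr => i _.
by rewrite mxE /dd mulr_suml; apply: eq_bigr => a _; rewrite mulrCA mulrC.
Qed.

End ChainRule.

Section VectorRules.
Context {R : realType}.
Variables (b : bool) (m n : nat) (W : set 'rV[R]_m).
Hypothesis oW : relopen b W.
Implicit Types (Z Y : 'rV[R]_m -> 'rV[R]_n) (c : 'rV[R]_m -> R).

Lemma vsmoothD Z Y : vsmooth b W Z -> vsmooth b W Y -> vsmooth b W (fun x => Z x + Y x).
Proof.
move=> sZ sY j; apply: (smooth_eq oW (f := fun x => Z x 0 j + Y x 0 j)); last exact: smoothD.
by move=> y _; rewrite rowD.
Qed.

Lemma vsmoothZ c Z : smooth_on b W c -> vsmooth b W Z -> vsmooth b W (fun x => c x *: Z x).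
Proof.
move=> sc sZ j; apply: (smooth_eq oW (f := fun x => c x * Z x 0 j)); last exact: smoothM.
by move=> y _; rewrite rowZ.
Qed.

Lemma vdD u Z Y x : vsmooth b W Z -> vsmooth b W Y -> W x ->
  vd b u (fun y => Z y + Y y) x = vd b u Z x + vd b u Y x.
Proof.
move=> sZ sY Wx; apply/rowP => j; rewrite rowD !vdjE -(ddD oW u (sZ j) (sY j) Wx).
by apply: (dd_eq oW u Wx) => y _; rewrite rowD.
Qed.

Lemma vdZ u c Z x : smooth_on b W c -> vsmooth b W Z -> W x ->
  vd b u (fun y => c y *: Z y) x = dd b u c x *: Z x + c x *: vd b u Z x.
Proof.
move=> sc sZ Wx; apply/rowP => j; rewrite rowD !rowZ !vdjE.
rewrite (dd_eq oW u (g := fun y => c y * Z y 0 j) Wx); last by move=> y _; rewrite rowZ.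
by rewrite (ddM oW u sc (sZ j) Wx); ring.
Qed.

End VectorRules.

Global Opaque dd bil.

(* ring compares atoms up to conversion, which is slow on these terms. *)
Ltac gen_atoms := repeat match goal with
  | |- context [@dd ?a ?b ?c ?d ?e ?f] => generalize (@dd a b c d e f); intro
  | |- context [@bil ?a ?b ?c ?d ?e ?f] => generalize (@bil a b c d e f); intro
  end.

(** * Metrics, connection and curvature in coordinates *)

Section Metric.
Context {R : realType}.
Variables (b : bool) (n : nat) (V : set 'rV[R]_n).

Definition metric_on (g : 'rV[R]_n -> 'M[R]_n) :=
  [/\ msmooth b V g, forall x, V x -> (g x)^T = g x &
      forall x, V x -> forall v, v != 0 -> 0 < bil (g x) v v].

Variable g : 'rV[R]_n -> 'M[R]_n.
Hypotheses (oV : relopen b V) (mg : metric_on g).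

Let sg : msmooth b V g. Proof. by case: mg. Qed.
Let symg x : V x -> (g x)^T = g x. Proof. by case: mg => _ + _; apply. Qed.
Let posg x : V x -> forall v, v != 0 -> 0 < bil (g x) v v.
Proof. by case: mg => _ _; apply. Qed.

Lemma metric_unit x : V x -> g x \in unitmx.
Proof.
move=> Vx; rewrite -row_free_unit; apply: inj_row_free => v vg.
apply: contraTeq isT => v0; have := posg Vx v0.
by rewrite bil_def vg mul0mx mxE ltxx.
Qed.

Lemma inner_sym x u v : V x -> bil (g x) u v = bil (g x) v u.
Proof. by move=> Vx; apply: bilC; exact: symg. Qed.

Lemma metric_nondeg x z z' : V x -> (forall w, bil (g x) z w = bil (g x) z' w) -> z = z'.
Proof.
move=> Vx H; apply/eqP; rewrite -subr_eq0; apply: contraTT isT => d0.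
by have := posg Vx d0; rewrite bilBl H subrr ltxx.
Qed.

Lemma invmx_sym x : V x -> (invmx (g x))^T = invmx (g x).
Proof. by move=> Vx; rewrite trmx_inv symg. Qed.

Lemma smooth_ginv : msmooth b V (fun y => invmx (g y)).
Proof. by apply: smooth_invmx => //; exact: metric_unit. Qed.

Definition Gam x u v : 'rV[R]_n :=
  \row_m bil (\matrix_(i, j) christoffel b g i j m x) u v.

Lemma GamjE x u v m :
  Gam x u v 0 m = bil (\matrix_(i, j) christoffel b g i j m x) u v.
Proof. by rewrite mxE. Qed.

Lemma GamDl x u u' v : Gam x (u + u') v = Gam x u v + Gam x u' v.
Proof. by apply/rowP => m; rewrite !mxE bilDl. Qed.
Lemma GamDr x u v v' : Gam x u (v + v') = Gam x u v + Gam x u v'.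
Proof. by apply/rowP => m; rewrite !mxE bilDr. Qed.
Lemma GamZl x c u v : Gam x (c *: u) v = c *: Gam x u v.
Proof. by apply/rowP => m; rewrite !mxE bilZl. Qed.
Lemma GamZr x c u v : Gam x u (c *: v) = c *: Gam x u v.
Proof. by apply/rowP => m; rewrite !mxE bilZr. Qed.
Lemma GamNl x u v : Gam x (- u) v = - Gam x u v.
Proof. by rewrite -scaleN1r GamZl scaleN1r. Qed.
Lemma GamNr x u v : Gam x u (- v) = - Gam x u v.
Proof. by rewrite -scaleN1r GamZr scaleN1r. Qed.

Lemma smooth_chr i j m : smooth_on b V (christoffel b g i j m).
Proof.
apply: smoothM => //; first exact: smooth_cst.
apply: smooth_sum => // p; apply: smoothM => //; first exact: smooth_ginv.
apply: smoothB => //; last exact: smooth_pd.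
by apply: smoothD => //; exact: smooth_pd.
Qed.

Lemma smooth_Gam Z W : vsmooth b V Z -> vsmooth b V W ->
  vsmooth b V (fun y => Gam y (Z y) (W y)).
Proof.
move=> sZ sW m; apply: (smooth_eq oV (f := fun y =>
  bil (\matrix_(i, j) christoffel b g i j m y) (Z y) (W y))).
  by move=> y _; rewrite !mxE.
apply: smooth_bil => // i j; apply: (smooth_eq oV (f := christoffel b g i j m)).
  by move=> y _; rewrite mxE.
exact: smooth_chr.
Qed.

Lemma dd_bilE u v w x : V x -> dd b u (fun y => bil (g y) v w) x =
  \sum_i \sum_j \sum_p u 0 i * v 0 j * w 0 p * pd b i (fun y => g y j p) x.
Proof.
move=> Vx; rewrite -(md_bil oV) // bilE.
transitivity (\sum_j \sum_p \sum_i u 0 i * v 0 j * w 0 p * pd b i (fun y => g y j p) x).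
  apply: eq_bigr => j _; apply: eq_bigr => p _.
  rewrite mxE ddE mulrC mulrA mulr_sumr; apply: eq_bigr => i _.
  by rewrite mulrA (mulrC (w 0 p)) (mulrC _ (u 0 i)) !mulrA.
under eq_bigr => j _ do rewrite exchange_big /=.
by rewrite exchange_big.
Qed.

(** Koszul's formula for constant coordinate fields, whose brackets vanish. *)
Lemma koszul u v w x : V x -> bil (g x) (Gam x u v) w =
  2^-1 * (dd b u (fun y => bil (g y) v w) x + dd b v (fun y => bil (g y) u w) x
          - dd b w (fun y => bil (g y) u v) x).
Proof.
move=> Vx.
pose D i j p := pd b i (fun y => g y j p) x + pd b j (fun y => g y i p) x
     - pd b p (fun y => g y i j) x.
pose T : 'rV[R]_n := \row_p \sum_i \sum_j u 0 i * v 0 j * D i j p.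
have -> : Gam x u v = 2^-1 *: (T *m invmx (g x)).
  apply/rowP => m; rewrite mxE bilE !mxE mulr_sumr.
  under eq_bigr => i _ do under eq_bigr => j _ do
    rewrite mxE /christoffel -/(D i j _) mulrC mulrA mulrCA mulr_sumr mulr_sumr.
  under eq_bigr => i _ do rewrite exchange_big /=.
  rewrite exchange_big /=; apply: eq_bigr => p _.
  rewrite mxE mulr_suml mulr_sumr; apply: eq_bigr => i _.
  rewrite mulr_suml mulr_sumr; apply: eq_bigr => j _.
  rewrite -{2}(invmx_sym Vx) mxE -/(D i j p).
  move: (u 0 i) (v 0 j) (D i j p) (invmx _ _ _) (2^-1) => a c d e f; ring.
rewrite bilZl; congr (_ * _).
rewrite bil_def mulmxKV ?metric_unit // !dd_bilE // mxE.
under eq_bigr => p _ do rewrite !mxE mulr_suml.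
rewrite exchange_big /=.
have -> : \sum_i \sum_j \sum_p v 0 i * u 0 j * w 0 p * pd b i (fun y => g y j p) x =
  \sum_i \sum_j \sum_p u 0 i * v 0 j * w 0 p * pd b j (fun y => g y i p) x.
  rewrite exchange_big /=; do 3 (apply: eq_bigr => ? _).
  by rewrite (mulrC (v _ _)).
have -> : \sum_i \sum_j \sum_p w 0 i * u 0 j * v 0 p * pd b i (fun y => g y j p) x =
  \sum_i \sum_j \sum_p u 0 i * v 0 j * w 0 p * pd b p (fun y => g y i j) x.
  rewrite exchange_big /=; apply: eq_bigr => i _; rewrite exchange_big /=.
  apply: eq_bigr => j _; apply: eq_bigr => p _.
  by rewrite (mulrC (w _ _)) -!mulrA (mulrCA (w _ _)).
rewrite -big_split -sumrB /=; apply: eq_bigr => i _.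
under eq_bigr => p _ do rewrite mulr_suml.
rewrite exchange_big /= -big_split -sumrB /=; apply: eq_bigr => j _.
rewrite -big_split -sumrB /=; apply: eq_bigr => p _.
rewrite /D; move: (pd _ _ _ _) (pd _ _ _ _) (pd _ _ _ _) (u _ _) (v _ _) (w _ _) => a c d e f h.
ring.
Qed.

Lemma GamC u v x : V x -> Gam x u v = Gam x v u.
Proof.
move=> Vx; apply: (metric_nondeg Vx) => w; rewrite !koszul //.
rewrite (dd_eq oV w (f := fun y => bil (g y) v u) (g := fun y => bil (g y) u v)) //; last first.
  by move=> y Vy; rewrite inner_sym.
by rewrite [dd b u _ x + _]addrC.
Qed.

Lemma metric_compat u v w x : V x ->
  dd b u (fun y => bil (g y) v w) x = bil (g x) (Gam x u v) w + bil (g x) v (Gam x u w).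
Proof.
move=> Vx; rewrite (inner_sym v) // !koszul //.
have E a c : dd b a (fun y => bil (g y) v c) x = dd b a (fun y => bil (g y) c v) x.
  by apply: (dd_eq oV _ Vx) => y Vy; rewrite inner_sym.
rewrite -(E u w).
move: (dd b u _ _) (dd b v _ _) (dd b w _ _) => p q r; lra.
Qed.

Definition cov u (Z : 'rV[R]_n -> 'rV[R]_n) x := vd b u Z x + Gam x u (Z x).

Lemma dd_inner u Z W x : vsmooth b V Z -> vsmooth b V W -> V x ->
  dd b u (fun y => bil (g y) (Z y) (W y)) x =
  bil (g x) (cov u Z x) (W x) + bil (g x) (Z x) (cov u W x).
Proof.
move=> sZ sW Vx; rewrite (dd_bil oV) // (md_bil oV) // metric_compat //.
rewrite /cov bilDl bilDr; move: (bil _ _ _) (bil _ _ _) (bil _ _ _) (bil _ _ _) => p q r s.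
ring.
Qed.

Definition Rm x (u v w : 'rV[R]_n) : 'rV[R]_n :=
  \row_m \sum_i \sum_j \sum_p u 0 i * v 0 j * w 0 p * riemann b g i j p m x.

Lemma Rm_uvv x u v : riemann_uvv b g x u v = Rm x u v v.
Proof. by []. Qed.

(** For constant fields there is no bracket term, and nabla_v w is the field [Gam y v w], so the
    curvature is the plain commutator of two covariant derivatives. *)
Lemma RmE x u v w : V x -> Rm x u v w =
  vd b u (fun y => Gam y v w) x + Gam x u (Gam x v w)
  - (vd b v (fun y => Gam y u w) x + Gam x v (Gam x u w)).
Proof.
move=> Vx; apply/rowP => m; rewrite !mxE.
have sC i j m' : smooth_on b V (christoffel b g i j m') by exact: smooth_chr.
have E u' v' w' : dd b u' (fun y => Gam y v' w' 0 m) x +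
   bil (\matrix_(i, j) christoffel b g i j m x) u' (Gam x v' w') =
   \sum_i \sum_j \sum_p u' 0 i * v' 0 j * w' 0 p *
   (pd b i (christoffel b g j p m) x + \sum_q christoffel b g i q m x * christoffel b g j p q x).
  have -> : dd b u' (fun y => Gam y v' w' 0 m) x =
    \sum_j \sum_p \sum_i u' 0 i * v' 0 j * w' 0 p * pd b i (christoffel b g j p m) x.
    rewrite (dd_eq oV _ (g := fun y => \sum_j \sum_p v' 0 j * christoffel b g j p m y * w' 0 p)) //;
      last by move=> y _; rewrite mxE bilE; do 2 (apply: eq_bigr => ? _); rewrite mxE.
    have s1 j p : smooth_on b V (fun y => v' 0 j * christoffel b g j p m y).
      by apply: smoothM => //; apply: smooth_cst.
    have s2 j p : smooth_on b V (fun y => v' 0 j * christoffel b g j p m y * w' 0 p).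
      by apply: smoothM => //; apply: smooth_cst.
    rewrite (dd_sum oV) //; last by move=> j; apply: smooth_sum.
    apply: eq_bigr => j _; rewrite (dd_sum oV) //; apply: eq_bigr => p _.
    rewrite (ddM oV) //; last exact: smooth_cst.
    rewrite (ddZ oV) // (dd_cst oV) // mulr0 addr0 ddE mulrC mulrA mulr_sumr.
    apply: eq_bigr => i _; move: (u' _ _) (v' _ _) (w' _ _) (pd _ _ _ _) => e f h k; ring.
  have -> : bil (\matrix_(i, j) christoffel b g i j m x) u' (Gam x v' w') =
    \sum_i \sum_j \sum_p u' 0 i * v' 0 j * w' 0 p *
       \sum_q christoffel b g i q m x * christoffel b g j p q x.
    rewrite bilE; apply: eq_bigr => i _.
    under eq_bigr => q _.
      rewrite !mxE bilE mulr_sumr.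
      under eq_bigr => j _ do (rewrite mulr_sumr; under eq_bigr => p _ do rewrite mxE).
      over.
    rewrite exchange_big /=; apply: eq_bigr => j _.
    rewrite exchange_big /=; apply: eq_bigr => p _.
    rewrite mulr_sumr; apply: eq_bigr => q _.
    move: (u' _ _) (v' _ _) (w' _ _) (christoffel _ _ _ _ _ _) (christoffel _ _ _ _ _ _) => e f h k l; ring.
  under eq_bigr => j _ do rewrite exchange_big /=.
  rewrite exchange_big -big_split /=; apply: eq_bigr => i _.
  rewrite -big_split /=; apply: eq_bigr => j _.
  by rewrite -big_split /=; apply: eq_bigr => p _; rewrite mulrDr.
rewrite !E -sumrN; under [X in _ = _ + X]eq_bigr => i _.
  rewrite -sumrN; under eq_bigr => j _ do rewrite -sumrN. over.
rewrite [X in _ + X]exchange_big /= -big_split /=; apply: eq_bigr => i _.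
rewrite -big_split /=; apply: eq_bigr => j _.
rewrite -big_split /=; apply: eq_bigr => p _.
rewrite /riemann sumrB.
move: (pd _ _ _ _) (pd _ _ _ _) (\sum_q _) (\sum_q _) (u _ _) (v _ _) (w _ _) => a c d e f h k; ring.
Qed.

End Metric.

Lemma metric_on_sub (R : realType) b n (V W : set 'rV[R]_n) g :
  W `<=` V -> metric_on b V g -> metric_on b W g.
Proof.
move=> WV [s1 s2 s3]; split=> [i j|x /WV|x /WV].
- exact: (smooth_sub WV).
- exact: s2.
- exact: s3.
Qed.

Lemma row_eq_ring (R : realType) n (u v : 'rV[R]_n) : (forall q, u 0 q = v 0 q) -> u = v.
Proof. by move=> H; apply/rowP. Qed.

Ltac gen_vecs := repeat match goal with
  | |- context [@Gam ?a ?b ?c ?d ?e ?f ?g] => generalize (@Gam a b c d e f g); intro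
  | |- context [@vd ?a ?b ?c ?d ?e ?f ?g] => generalize (@vd a b c d e f g); intro
  end.

Global Opaque Rm Gam md.

Section Locality.
Context {R : realType}.
Variables (b : bool) (n : nat) (V : set 'rV[R]_n) (g g' : 'rV[R]_n -> 'M[R]_n).
Hypotheses (oV : relopen b V) (gg : forall x, V x -> g x = g' x).

Lemma chr_eq i j m x : V x -> christoffel b g i j m x = christoffel b g' i j m x.
Proof.
move=> Vx; rewrite /christoffel gg //; congr (_ * _); apply: eq_bigr => p _.
have E c d e : pd b c (fun y => g y d e) x = pd b c (fun y => g' y d e) x.
  by apply: (pd_eq c oV Vx) => y Vy; rewrite gg.
by rewrite !E.
Qed.

Lemma riemann_eq i j p m x : V x -> riemann b g i j p m x = riemann b g' i j p m x.
Proof.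
move=> Vx; rewrite /riemann.
have E c d e f : pd b c (christoffel b g d e f) x = pd b c (christoffel b g' d e f) x.
  by apply: (pd_eq c oV Vx) => y Vy; rewrite chr_eq.
by rewrite !E; congr (_ + _); apply: eq_bigr => q _; rewrite !chr_eq.
Qed.

Lemma laplacian_eq f f' x : V x -> (forall y, V y -> f y = f' y) ->
  laplacian b g f x = laplacian b g' f' x.
Proof.
move=> Vx ff; rewrite /laplacian gg //.
have E c y : V y -> pd b c f y = pd b c f' y by move=> Vy; apply: (pd_eq c oV Vy).
have E2 c d : pd b c (pd b d f) x = pd b c (pd b d f') x.
  by apply: (pd_eq c oV Vx) => y Vy; apply: E.
apply: eq_bigr => i _; apply: eq_bigr => j _; rewrite E2.
by under eq_bigr => m _ do rewrite (chr_eq _ _ _ Vx) (E _ _ Vx).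
Qed.

End Locality.

(** * Hessian, gradient and the Ricci identity *)

Section Hessian.
Context {R : realType}.
Variables (b : bool) (n : nat) (V : set 'rV[R]_n) (g : 'rV[R]_n -> 'M[R]_n).

Definition Hm (f : 'rV[R]_n -> R) x : 'M[R]_n :=
  \matrix_(i, j) (pd b i (pd b j f) x - \sum_m christoffel b g i j m x * pd b m f x).

Definition gr (f : 'rV[R]_n -> R) x : 'rV[R]_n :=
  (\row_i pd b i f x) *m invmx (g x).

Lemma laplacianE f x :
  laplacian b g f x = \sum_i \sum_j invmx (g x) i j * Hm f x i j.
Proof. by do 2 (apply: eq_bigr => ? _); rewrite mxE. Qed.

Hypotheses (oV : relopen b V) (mg : metric_on b V g).

Lemma bil_Hm f u v x : smooth_on b V f -> V x ->
  bil (Hm f x) u v = dd b u (dd b v f) x - dd b (Gam b g x u v) f x.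
Proof.
move=> sf Vx; rewrite (dd_dd oV) // bilE.
have -> : dd b (Gam b g x u v) f x =
  \sum_i \sum_j u 0 i * v 0 j * \sum_m christoffel b g i j m x * pd b m f x.
  rewrite ddE; under eq_bigr => m _ do rewrite GamjE bilE mulr_suml.
  rewrite exchange_big /=; apply: eq_bigr => i _.
  under eq_bigr => m _ do rewrite mulr_suml.
  rewrite exchange_big /=; apply: eq_bigr => j _.
  rewrite mulr_sumr; apply: eq_bigr => m _.
  by rewrite mxE; move: (u _ _) (v _ _) (christoffel _ _ _ _ _ _) (pd _ _ _ _) => a c d e; ring.
rewrite -sumrB; apply: eq_bigr => i _; rewrite -sumrB; apply: eq_bigr => j _.
rewrite mxE; move: (u _ _) (v _ _) (pd _ _ _ _) (\sum_m _) => a c d e; ring.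
Qed.

Lemma smooth_Hm f : smooth_on b V f -> msmooth b V (Hm f).
Proof.
move=> sf i j.
have H : smooth_on b V (fun x => pd b i (pd b j f) x - \sum_m christoffel b g i j m x * pd b m f x).
  apply: smoothB => //; first exact/smooth_pd/smooth_pd.
  apply: smooth_sum => // m; apply: smoothM => //; last exact: smooth_pd.
  exact: (smooth_chr oV mg).
by apply: smooth_eq H => // y _; rewrite mxE.
Qed.

Lemma smooth_laplacian f : smooth_on b V f -> smooth_on b V (laplacian b g f).
Proof.
move=> sf; apply: (smooth_eq oV (f := fun x => \sum_i \sum_j invmx (g x) i j * Hm f x i j)).
  by move=> y _; rewrite laplacianE.
apply: smooth_sum => // i; apply: smooth_sum => // j; apply: smoothM => //.
  exact: (smooth_ginv oV mg).
exact: smooth_Hm.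
Qed.

Lemma Hm_sym f x : smooth_on b V f -> V x -> (Hm f x)^T = Hm f x.
Proof.
move=> sf Vx; apply/matrixP => i j; rewrite mxE -!bil_delta !bil_Hm //.
by rewrite (ddC oV) // (GamC oV mg).
Qed.

Lemma gr_inner f w x : V x -> bil (g x) (gr f x) w = dd b w f x.
Proof.
move=> Vx; rewrite bil_def /gr mulmxKV ?(metric_unit mg) // mxE ddE.
by apply: eq_bigr => i _; rewrite !mxE mulrC.
Qed.

Lemma smooth_gr f : smooth_on b V f -> vsmooth b V (gr f).
Proof.
move=> sf j; apply: (smooth_eq oV (f := fun x => \sum_i pd b i f x * invmx (g x) i j)).
  by move=> y _; rewrite mxE; apply: eq_bigr => i _; rewrite mxE.
apply: smooth_sum => // i; apply: smoothM => //; first exact: smooth_pd.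
exact: (smooth_ginv oV mg).
Qed.

Lemma gr_cov f u w x : smooth_on b V f -> V x ->
  bil (g x) (cov b g u (gr f) x) w = bil (Hm f x) u w.
Proof.
move=> sf Vx; have sG := smooth_gr sf.
have := dd_inner oV mg u sG (vsmooth_cst oV w) Vx.
rewrite (dd_eq oV _ (g := dd b w f)) //; last by move=> y Vy; rewrite gr_inner.
move/esym/eqP; rewrite eq_sym -subr_eq => /eqP <-.
by rewrite {1}/cov (vd_cst oV) // add0r gr_inner // bil_Hm.
Qed.

Lemma dd_Hm f u v w x : smooth_on b V f -> V x ->
  dd b u (fun y => bil (Hm f y) v w) x = dd b u (dd b v (dd b w f)) x
   - dd b (vd b u (fun y => Gam b g y v w) x) f x - dd b u (dd b (Gam b g x v w) f) x.
Proof.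
move=> sf Vx.
have sG := smooth_Gam oV mg (vsmooth_cst oV v) (vsmooth_cst oV w).
rewrite (dd_eq oV _ (g := fun y => dd b v (dd b w f) y - dd b (Gam b g y v w) f y)) //;
  last by move=> y Vy; rewrite bil_Hm.
have s1 : smooth_on b V (dd b v (dd b w f)) by apply: (smooth_dd oV); apply: (smooth_dd oV).
have s2 := smooth_ddZ oV sf sG.
apply: etrans (ddB oV u s1 s2 Vx) _.
by rewrite (dd_ddZ oV u sf sG Vx) opprD addrA.
Qed.

(** The left side is (nabla_u Hess f)(v, v) - (nabla_v Hess f)(u, v), expanded for constant vectors.
    Third derivatives of f cancel and the derivatives of the connection assemble into the
    curvature. *)
Lemma ricci_identity f u v x : smooth_on b V f -> V x ->
  dd b u (fun y => bil (Hm f y) v v) x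
  - bil (Hm f x) (Gam b g x u v) v - bil (Hm f x) v (Gam b g x u v)
  - (dd b v (fun y => bil (Hm f y) u v) x
  - bil (Hm f x) (Gam b g x v u) v - bil (Hm f x) u (Gam b g x v v))
  = - dd b (Rm b g x u v v) f x.
Proof.
move=> sf Vx; have C : Gam b g x v u = Gam b g x u v by rewrite (GamC oV mg).
rewrite (RmE oV mg) // C.
rewrite (dd_Hm u v v sf Vx) (dd_Hm v u v sf Vx).
rewrite (bil_Hm v (Gam b g x u v) sf Vx) (bil_Hm u (Gam b g x v v) sf Vx).
rewrite ddvB !ddvD (ddC oV u v (smooth_dd oV v sf) Vx).
gen_atoms; ring.
Qed.

End Hessian.

Global Opaque Hm.

(** * Isometric immersions and the Gauss equation *)

Section Immersion.
Context {R : realType}.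
Variables (b b' : bool) (m n : nat) (V : set 'rV[R]_n) (W : set 'rV[R]_m).
Variables (g : 'rV[R]_n -> 'M[R]_n) (h : 'rV[R]_m -> 'M[R]_m) (phi : 'rV[R]_m -> 'rV[R]_n).
Hypotheses (oV : relopen b V) (oW : relopen b' W).
Hypotheses (WV : forall y, W y -> V (phi y)) (sphi : vsmooth b' W phi).
Hypotheses (mg : metric_on b V g) (mh : metric_on b' W h).

Local Notation J := (vd b').

Lemma smooth_vd p u (Z : 'rV[R]_m -> 'rV[R]_p) : vsmooth b' W Z -> vsmooth b' W (J u Z).
Proof.
by move=> sZ j; rewrite vdE; apply: (smooth_dd oW).
Qed.

Lemma vd_eq p u (Z Z' : 'rV[R]_m -> 'rV[R]_p) x : W x -> (forall y, W y -> Z y = Z' y) ->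
  J u Z x = J u Z' x.
Proof.
by move=> Wx ZZ; apply/rowP => j; rewrite !mxE; apply: (dd_eq oW _ Wx) => y Wy; rewrite ZZ.
Qed.

Lemma vdC p u v (Z : 'rV[R]_m -> 'rV[R]_p) x : vsmooth b' W Z -> W x ->
  J u (J v Z) x = J v (J u Z) x.
Proof.
move=> sZ Wx; apply/rowP => j; rewrite !mxE.
by rewrite !vdE; exact: (ddC oW u v (sZ j) Wx).
Qed.

(** The pulled-back connection: the covariant derivative along phi of a field Z of target
    vectors. *)
Definition covphi u (Z : 'rV[R]_m -> 'rV[R]_n) x :=
  J u Z x + Gam b g (phi x) (J u phi x) (Z x).

Lemma smooth_gphi : msmooth b' W (fun y => g (phi y)).
Proof.
by move=> i j; apply: (smooth_comp oV oW WV sphi (f := fun y => g y i j)); case: mg.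
Qed.

Lemma dd_inner_phi u (Z Y : 'rV[R]_m -> 'rV[R]_n) x : vsmooth b' W Z -> vsmooth b' W Y -> W x ->
  dd b' u (fun y => bil (g (phi y)) (Z y) (Y y)) x =
  bil (g (phi x)) (covphi u Z x) (Y x) + bil (g (phi x)) (Z x) (covphi u Y x).
Proof.
move=> sZ sY Wx.
rewrite (dd_bil oW u smooth_gphi sZ sY Wx) (md_bil oW u _ _ smooth_gphi Wx).
have sc : smooth_on b V (fun y => bil (g y) (Z x) (Y x)).
  by apply: (smooth_bil oV) => //; [case: mg|apply: vsmooth_cst|apply: vsmooth_cst].
rewrite (dd_comp oV oW WV sphi u sc Wx) (metric_compat oV mg _ _ _ (WV Wx)).
rewrite /covphi bilDl bilDr; gen_atoms; ring.
Qed.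

Lemma covphiC u v x : W x -> covphi u (J v phi) x = covphi v (J u phi) x.
Proof. by move=> Wx; rewrite /covphi vdC // (GamC oV mg) //; apply: WV. Qed.

(** Koszul's formula for h, with each derivative of h expanded by compatibility of the pulled-back
    connection; the symmetry [covphiC] cancels all but one pair of terms. *)
Lemma gauss_formula u v w x :
  (forall y a c, W y -> bil (h y) a c = bil (g (phi y)) (J a phi y) (J c phi y)) -> W x ->
  bil (g (phi x)) (covphi u (J v phi) x) (J w phi x) = bil (h x) (Gam b' h x u v) w.
Proof.
move=> iso Wx; rewrite (koszul oW mh) //.
have E a c d : dd b' a (fun y => bil (h y) c d) x =
   bil (g (phi x)) (covphi a (J c phi) x) (J d phi x)
   + bil (g (phi x)) (covphi a (J d phi) x) (J c phi x).
  rewrite (dd_eq oW a (g := fun y => bil (g (phi y)) (J c phi y) (J d phi y)) Wx).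
    rewrite (dd_inner_phi _ (smooth_vd c sphi) (smooth_vd d sphi) Wx).
    by rewrite (inner_sym mg (J c phi x)) //; apply: WV.
  by move=> y Wy; apply: iso.
rewrite !E (covphiC v u) // (covphiC w u) // (covphiC w v) //.
gen_atoms; lra.
Qed.

Lemma vd_vd p u (Z : 'rV[R]_m -> 'rV[R]_p) (Y : 'rV[R]_m -> 'rV[R]_m) x :
  vsmooth b' W Z -> vsmooth b' W Y -> W x ->
  J u (fun y => J (Y y) Z y) x = J (J u Y x) Z x + J u (J (Y x) Z) x.
Proof.
move=> sZ sY Wx; apply/rowP => j; rewrite !mxE.
rewrite (dd_eq oW _ (g := fun y => dd b' (Y y) (fun z => Z z 0 j) y) Wx);
  last by move=> y _; rewrite mxE.
rewrite (dd_ddZ oW _ (sZ j) sY Wx); congr (_ + _).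
by apply: (dd_eq oW _ Wx) => y _; rewrite mxE.
Qed.

Lemma hess_comp f u v x : smooth_on b V f -> W x ->
  dd b' u (dd b' v (fun y => f (phi y))) x =
  bil (Hm b g f (phi x)) (J u phi x) (J v phi x) + dd b (covphi u (J v phi) x) f (phi x).
Proof.
move=> sf Wx; have Vx := WV Wx.
rewrite (dd_eq oW u (g := fun y => dd b (J v phi y) f (phi y)) Wx); last first.
  by move=> y Wy; rewrite (dd_comp oV oW WV sphi v sf Wy).
have sJ := smooth_vd v sphi.
have H := dd_lin oW (L := fun z y => dd b z f (phi y)) u (x := x) _ _ sJ Wx.
rewrite H.
- rewrite (dd_comp oV oW WV sphi u (smooth_dd oV (J v phi x) sf) Wx).
  rewrite (bil_Hm g oV _ _ sf Vx) /covphi ddvD; gen_atoms; ring.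
- by move=> z y Wy; rewrite ddE; apply: eq_bigr => i _; rewrite dd_delta.
- move=> i; apply: (smooth_comp oV oW WV sphi (f := dd b (delta_mx 0 i) f)).
  exact: (smooth_dd oV).
Qed.

Lemma vd_Gam_phi w (Z Y : 'rV[R]_m -> 'rV[R]_n) x :
  vsmooth b' W Z -> vsmooth b' W Y -> W x ->
  J w (fun y => Gam b g (phi y) (Z y) (Y y)) x =
  vd b (J w phi x) (fun z => Gam b g z (Z x) (Y x)) (phi x)
  + Gam b g (phi x) (J w Z x) (Y x) + Gam b g (phi x) (Z x) (J w Y x).
Proof.
move=> sZ sY Wx; apply/rowP => q; rewrite !(rowD, vdjE, GamjE).
pose C y := \matrix_(i, j) christoffel b g i j q y.
have sC : msmooth b V C.
  move=> i j; apply: (smooth_eq oV (f := christoffel b g i j q)).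
    by move=> y _; rewrite mxE.
  exact: (smooth_chr oV mg).
have sCphi : msmooth b' W (fun y => C (phi y)).
  by move=> i j; apply: (smooth_comp oV oW WV sphi (f := fun y => C y i j)).
rewrite (dd_eq oW _ (g := fun y => bil (C (phi y)) (Z y) (Y y)) Wx); last by move=> y _; rewrite GamjE.
rewrite (dd_bil oW _ sCphi sZ sY Wx) (md_bil oW _ _ _ sCphi Wx).
have sc : smooth_on b V (fun y => bil (C y) (Z x) (Y x)).
  by apply: (smooth_bil oV) => //; apply: vsmooth_cst.
rewrite (dd_comp oV oW WV sphi w sc Wx); congr (_ + _ + _).
by apply: (dd_eq oV _ (WV Wx)) => y _; rewrite GamjE.
Qed.

Section TotallyGeodesic.
Hypothesis tg : forall u v y, W y -> covphi u (J v phi) y = J (Gam b' h y u v) phi y.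

(** Differentiating [tg] once more and antisymmetrizing removes the third derivatives of phi. The
    result is an equality of target vectors, so it contains the Codazzi equation as well as the
    Gauss equation. *)
Lemma gauss_totally_geodesic w u v x : W x ->
  J (Rm b' h x w u v) phi x = Rm b g (phi x) (J w phi x) (J u phi x) (J v phi x).
Proof.
move=> Wx.
(* The derivative of [tg] in the direction a; below, the instances (w, u) and (u, w) are
   subtracted. *)
have D a c d : J a (J c (J d phi)) x + vd b (J a phi x) (fun z => Gam b g z (J c phi x) (J d phi x)) (phi x)
    + Gam b g (phi x) (J a (J c phi) x) (J d phi x) + Gam b g (phi x) (J c phi x) (J a (J d phi) x)
  = J (J a (fun y => Gam b' h y c d) x) phi x + J a (J (Gam b' h x c d) phi) x.
  have := vd_eq a Wx (fun y Wy => tg c d Wy).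
  rewrite (vd_vd _ sphi (smooth_Gam oW mh (vsmooth_cst oW c) (vsmooth_cst oW d)) Wx) => <-.
  have -> : J a (covphi c (J d phi)) x = J a (J c (J d phi)) x +
      J a (fun y => Gam b g (phi y) (J c phi y) (J d phi y)) x.
    apply/rowP => j; rewrite !mxE.
    rewrite (dd_eq oW _ (g := fun y => J c (J d phi) y 0 j + Gam b g (phi y) (J c phi y) (J d phi y) 0 j) Wx);
      last by move=> y _; rewrite !mxE.
    apply: (ddD oW) => //; first exact: (smooth_vd c (smooth_vd d sphi) j).
    have sC : smooth_on b' W (fun y => bil (\matrix_(p, q) christoffel b g p q j (phi y)) (J c phi y) (J d phi y)).
      apply: (smooth_bil oW); try exact: smooth_vd.
      move=> p q; apply: (smooth_eq oW (f := fun y => christoffel b g p q j (phi y))).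
        by move=> y _; rewrite mxE.
      by apply: (smooth_comp oV oW WV sphi); apply: (smooth_chr oV mg).
    by apply: (smooth_eq oW _ sC) => y _; rewrite GamjE.
  by rewrite (vd_Gam_phi _ (smooth_vd c sphi) (smooth_vd d sphi) Wx) !addrA.
have T a c : J a (J c phi) x = J (Gam b' h x a c) phi x - Gam b g (phi x) (J a phi x) (J c phi x).
  by rewrite -tg // /covphi addrK.
have D1 := D w u v; have D2 := D u w v; have Vx := WV Wx.
rewrite (RmE oW mh) // (RmE oV mg) //.
have C u' := vdC w u' (smooth_vd v sphi) Wx.
move: D1 D2; rewrite {}C !T !(GamDl, GamDr, GamNl, GamNr) !(vdDl, vdNl).
rewrite (GamC oW mh u w) // (GamC oV mg (J u phi x) (J w phi x)) //.
gen_vecs => D1 D2; apply: row_eq_ring => q.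
move/rowP/(_ q): D1; move/rowP/(_ q): D2; rewrite !mxE; lra.
Qed.
End TotallyGeodesic.

End Immersion.

(** * Conformal changes of the metric *)

Section Conformal.
Context {R : realType}.
Variables (b : bool) (n : nat) (V : set 'rV[R]_n).
Variables (g : 'rV[R]_n -> 'M[R]_n) (s : 'rV[R]_n -> R).
Hypotheses (oV : relopen b V) (mg : metric_on b V g) (ss : smooth_on b V s).

Definition conf x := expR (2 * s x) *: g x.

Lemma bil_conf x u v : bil (conf x) u v = expR (2 * s x) * bil (g x) u v.
Proof. by rewrite !bil_def /conf -scalemxAr -scalemxAl mxE. Qed.

Lemma smooth_e2s : smooth_on b V (fun x => expR (2 * s x)).
Proof. by apply: smooth_exp => //; apply: smoothM => //; apply: smooth_cst. Qed.

Lemma metric_conf : metric_on b V conf.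
Proof.
have [sg gs gp] := mg; split.
- move=> i j; apply: (smooth_eq oV (f := fun x => expR (2 * s x) * g x i j)).
    by move=> y _; rewrite mxE.
  by apply: smoothM => //; exact: smooth_e2s.
- by move=> x Vx; rewrite linearZ /= gs.
- by move=> x Vx v v0; rewrite bil_conf mulr_gt0 ?expR_gt0 ?gp.
Qed.

Lemma dd_conf u v w x : V x -> dd b u (fun y => bil (conf y) v w) x =
  expR (2 * s x) * (2 * dd b u s x * bil (g x) v w + dd b u (fun y => bil (g y) v w) x).
Proof.
move=> Vx; rewrite (dd_eq oV u (g := fun y => expR (2 * s y) * bil (g y) v w) Vx);
  last by move=> y _; rewrite bil_conf.
have s2 : smooth_on b V (fun x => 2 * s x) by apply: smoothM => //; apply: smooth_cst.
rewrite (ddM oV) //; [|exact: smooth_e2s|]; last first.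
  by apply: (smooth_bil oV) => //; [case: mg|apply: vsmooth_cst|apply: vsmooth_cst].
rewrite (dd_exp oV) // (ddZ oV) //; gen_atoms; ring.
Qed.

Lemma Gam_conf u v x : V x -> Gam b conf x u v =
  Gam b g x u v + dd b u s x *: v + dd b v s x *: u - bil (g x) u v *: gr b g s x.
Proof.
move=> Vx; apply: (metric_nondeg mg Vx) => w.
apply: (@mulfI _ (expR (2 * s x))); first by rewrite gt_eqF ?expR_gt0.
rewrite -bil_conf (koszul oV metric_conf) // !dd_conf // bilBl !bilDl !bilZl.
rewrite (koszul oV mg) // (gr_inner mg) //.
rewrite (inner_sym mg u w) //; move: (expR _) => e; gen_atoms; lra.
Qed.

(** The conformal transformation law of the curvature on (u, v, v, u), all that a statement on
    sectional curvature requires. It follows by inserting [Gam_conf] into [RmE]; the derivative of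
    the gradient of s that appears is traded for the Hessian of s in [covT]. *)
Lemma conf_curvature u v x : V x ->
  bil (conf x) (Rm b conf x u v v) u = expR (2 * s x) *
  (bil (g x) (Rm b g x u v v) u
   + bil (g x) u v * bil (Hm b g s x) u v *+ 2
   - bil (g x) u u * bil (Hm b g s x) v v - bil (g x) v v * bil (Hm b g s x) u u
   - dd b u s x * dd b v s x * bil (g x) u v *+ 2
   + bil (g x) u u * dd b v s x ^+ 2 + bil (g x) v v * dd b u s x ^+ 2
   + dd b (gr b g s x) s x * (bil (g x) u v ^+ 2 - bil (g x) u u * bil (g x) v v)).
Proof.
move=> Vx; rewrite bil_conf; congr (_ * _).
have sT := smooth_gr oV mg ss.
have DG a c d : vd b a (fun y => Gam b conf y c d) x =
  vd b a (fun y => Gam b g y c d) x + dd b a (dd b c s) x *: d + dd b a (dd b d s) x *: c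
  - dd b a (fun y => bil (g y) c d) x *: gr b g s x - bil (g x) c d *: vd b a (gr b g s) x.
  apply/rowP => j; rewrite !(rowD, rowN, rowZ, vdjE).
  have sG : smooth_on b V (fun y => Gam b g y c d 0 j).
    exact: (smooth_Gam oV mg (vsmooth_cst oV c) (vsmooth_cst oV d) j).
  have sd e : smooth_on b V (dd b e s) by apply: (smooth_dd oV).
  have sde e f : smooth_on b V (fun y => dd b e s y * f).
    by apply: smoothM => //; apply: smooth_cst.
  have sb : smooth_on b V (fun y => bil (g y) c d).
    by apply: (smooth_bil oV) => //; [case: mg|apply: vsmooth_cst|apply: vsmooth_cst].
  have sbT : smooth_on b V (fun y => bil (g y) c d * gr b g s y 0 j) by apply: smoothM.
  have s1 := smoothD oV sG (sde c (d 0 j)).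
  have s2 := smoothD oV s1 (sde d (c 0 j)).
  rewrite (dd_eq oV a (g := fun y => Gam b g y c d 0 j + dd b c s y * d 0 j
     + dd b d s y * c 0 j - bil (g y) c d * gr b g s y 0 j) Vx); last first.
    by move=> y Vy; rewrite Gam_conf // !(rowD, rowN, rowZ).
  rewrite (ddB oV a s2 sbT Vx) (ddD oV a s1 (sde _ _) Vx) (ddD oV a sG (sde _ _) Vx).
  have M f e : dd b a (fun y => dd b f s y * e) x = dd b a (dd b f s) x * e.
    by rewrite (ddM oV a (sd f) (smooth_cst oV e) Vx) (dd_cst oV) // mulr0 addr0.
  rewrite !M (ddM oV a sb (sT j) Vx).
  by rewrite opprD addrA.
have covT a : bil (g x) (vd b a (gr b g s) x) u =
   bil (Hm b g s x) a u - bil (g x) (Gam b g x a (gr b g s x)) u.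
  by rewrite -(gr_cov oV mg) // /cov bilDl addrK.
have RC := RmE oV metric_conf u v v Vx.
have RG := RmE oV mg u v v Vx.
rewrite RC.
rewrite RG.
rewrite (DG u v v).
rewrite (DG v u v).
rewrite (Gam_conf v v Vx) (Gam_conf u v Vx) !(Gam_conf _ _ Vx).
have C : Gam b g x v u = Gam b g x u v by rewrite (GamC oV mg).
have I a : bil (g x) (gr b g s x) a = dd b a s x by rewrite (gr_inner mg).
have I' a : bil (g x) a (gr b g s x) = dd b a s x by rewrite (inner_sym mg) // I.
have E1 : bil (g x) (Gam b g x u v) u = bil (g x) u (Gam b g x u v) by rewrite (inner_sym mg).
have E2 : bil (g x) (Gam b g x u v) v = bil (g x) v (Gam b g x u v) by rewrite (inner_sym mg).
have E3 : bil (g x) (Gam b g x v v) u = bil (g x) u (Gam b g x v v) by rewrite (inner_sym mg).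
have E4 : bil (g x) v u = bil (g x) u v by rewrite (inner_sym mg).
rewrite !(bilBl, bilDl, bilZl, bilNl, bilBr, bilDr, bilZr, bilNr).
rewrite !(GamDr, GamZr, GamNr) !(bilBl, bilDl, bilZl, bilNl).
rewrite !(ddvD, ddvN, ddvZ) !covT C !I !I' ?(E1, E2, E3, E4).
rewrite !(metric_compat oV mg _ _ _ Vx) C ?(E1, E2, E3).
rewrite !(bil_Hm g oV _ _ ss Vx) (ddC oV v u ss Vx) ?C.
gen_atoms; ring.
Qed.

End Conformal.

(** * Laplacians as traces of Hessians *)

Section Trace.
Context {R : realType}.
Variables (b : bool) (n : nat) (V : set 'rV[R]_n) (g : 'rV[R]_n -> 'M[R]_n).
Hypotheses (oV : relopen b V) (mg : metric_on b V g).

Definition df (f : 'rV[R]_n -> R) x : 'rV[R]_n := \row_i pd b i f x.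
Definition tr2 x (A : 'M[R]_n) : R := \tr (invmx (g x) *m A).

Lemma mx_bil_eq p q (A B : 'M[R]_(p, q)) : (forall u w, bil A u w = bil B u w) -> A = B.
Proof. by move=> H; apply/matrixP => i j; rewrite -!bil_delta H. Qed.

Lemma tr2D x A B : tr2 x (A + B) = tr2 x A + tr2 x B.
Proof. by rewrite /tr2 mulmxDr mxtraceD. Qed.
Lemma tr2Z x c A : tr2 x (c *: A) = c * tr2 x A.
Proof. by rewrite /tr2 -scalemxAr mxtraceZ. Qed.
Lemma tr2N x A : tr2 x (- A) = - tr2 x A.
Proof. by rewrite -scaleN1r tr2Z mulN1r. Qed.

Lemma tr2_metric x : V x -> tr2 x (g x) = n%:R.
Proof. by move=> Vx; rewrite /tr2 mulVmx ?(metric_unit mg) // mxtrace1. Qed.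

Lemma df_bil f h u w x : bil ((df f x)^T *m df h x) u w = dd b u f x * dd b w h x.
Proof.
rewrite bil_def mulmxA -mulmxA mxE big_ord_recl big_ord0 addr0 !ddE; congr (_ * _).
  by rewrite mxE; apply: eq_bigr => i _; rewrite !mxE.
by rewrite mxE; apply: eq_bigr => i _; rewrite !mxE mulrC.
Qed.

Lemma tr2_outer f h x : tr2 x ((df f x)^T *m df h x) = dd b (gr b g h x) f x.
Proof.
rewrite /tr2 mulmxA mxtrace_mulC mulmxA /mxtrace big_ord_recl big_ord0 addr0.
by rewrite mxE ddE; apply: eq_bigr => i _; rewrite !mxE.
Qed.

Lemma grC f h x : V x -> dd b (gr b g f x) h x = dd b (gr b g h x) f x.
Proof. by move=> Vx; rewrite -!(gr_inner mg _ _ Vx) (inner_sym mg _ _ Vx). Qed.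

Lemma lap_tr2 f x : V x -> laplacian b g f x = tr2 x (Hm b g f x).
Proof.
move=> Vx; rewrite laplacianE /tr2 /mxtrace exchange_big /=; apply: eq_bigr => i _.
rewrite mxE; apply: eq_bigr => j _.
by rewrite -{1}(invmx_sym mg Vx) mxE.
Qed.

Lemma HmM f h x : smooth_on b V f -> smooth_on b V h -> V x ->
  Hm b g (fun y => f y * h y) x = f x *: Hm b g h x + h x *: Hm b g f x
   + (df f x)^T *m df h x + (df h x)^T *m df f x.
Proof.
move=> sf sh Vx; apply: mx_bil_eq => u w.
have sfh := smoothM oV sf sh.
rewrite !bilMD !bilMZ !df_bil !(bil_Hm g oV _ _ _ Vx) //.
rewrite (dd_eq oV u (g := fun y => dd b w f y * h y + f y * dd b w h y) Vx); last first.
  by move=> y Vy; rewrite (ddM oV).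
have sdf := smooth_dd oV w sf; have sdh := smooth_dd oV w sh.
rewrite (ddD oV u (smoothM oV sdf sh) (smoothM oV sf sdh) Vx).
rewrite (ddM oV u sdf sh Vx) (ddM oV u sf sdh Vx) (ddM oV _ sf sh Vx).
gen_atoms; ring.
Qed.

Lemma lapM f h x : smooth_on b V f -> smooth_on b V h -> V x ->
  laplacian b g (fun y => f y * h y) x =
  f x * laplacian b g h x + h x * laplacian b g f x + 2 * dd b (gr b g f x) h x.
Proof.
move=> sf sh Vx; rewrite !lap_tr2 // HmM // !tr2D !tr2Z !tr2_outer (grC h f) //.
move: (tr2 _ _) (tr2 _ _) => p q; gen_atoms; ring.
Qed.

Lemma Hm_comp1 (a a' a'' : R -> R) f x : smooth_on b V f -> V x ->
  (forall y, V y -> is_derive (f y) (1 : R) a (a' (f y))) ->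
  is_derive (f x) (1 : R) a' (a'' (f x)) ->
  smooth_on b V (fun y => a (f y)) -> smooth_on b V (fun y => a' (f y)) ->
  Hm b g (fun y => a (f y)) x = a' (f x) *: Hm b g f x + a'' (f x) *: ((df f x)^T *m df f x).
Proof.
move=> sf Vx ha ha' sa sa'; apply: mx_bil_eq => u w.
rewrite bilMD !bilMZ df_bil !(bil_Hm g oV _ _ _ Vx) //.
rewrite (dd_eq oV u (g := fun y => a' (f y) * dd b w f y) Vx); last first.
  by move=> y Vy; rewrite (dd_comp1 oV w (ha y Vy) sf Vy).
rewrite (ddM oV u sa' (smooth_dd oV w sf) Vx) (dd_comp1 oV u ha' sf Vx).
rewrite (dd_comp1 oV _ (ha x Vx) sf Vx); gen_atoms; ring.
Qed.

Lemma lap_comp1 (a a' a'' : R -> R) f x : smooth_on b V f -> V x ->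
  (forall y, V y -> is_derive (f y) (1 : R) a (a' (f y))) ->
  is_derive (f x) (1 : R) a' (a'' (f x)) ->
  smooth_on b V (fun y => a (f y)) -> smooth_on b V (fun y => a' (f y)) ->
  laplacian b g (fun y => a (f y)) x =
  a' (f x) * laplacian b g f x + a'' (f x) * dd b (gr b g f x) f x.
Proof.
move=> sf Vx ha ha' sa sa'; rewrite !lap_tr2 // (Hm_comp1 sf Vx ha ha' sa sa').
by rewrite tr2D !tr2Z tr2_outer.
Qed.

Variable s : 'rV[R]_n -> R.
Hypothesis ss : smooth_on b V s.

Lemma lap_conf f x : smooth_on b V f -> V x ->
  laplacian b (conf g s) f x = expR (- (2 * s x)) *
   (laplacian b g f x + (n%:R - 2) * dd b (gr b g s x) f x).
Proof.
move=> sf Vx; rewrite laplacianE.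
have mc := metric_conf oV mg ss.
have -> : Hm b (conf g s) f x = Hm b g f x - (df s x)^T *m df f x - (df f x)^T *m df s x
   + dd b (gr b g s x) f x *: g x.
  apply: mx_bil_eq => u w.
  rewrite !bilMD bilMZ !bilMN !df_bil (bil_Hm _ oV _ _ sf Vx) (bil_Hm _ oV _ _ sf Vx).
  rewrite (Gam_conf oV mg ss _ _ Vx) !(ddvD, ddvN, ddvZ); gen_atoms; ring.
set H := Hm _ _ _ _ - _ - _ + _.
have -> : invmx (conf g s x) = expR (- (2 * s x)) *: invmx (g x).
  have ux := metric_unit mg Vx.
  rewrite /conf invmxZ ?expRN // unitmxZ //.
  by rewrite unitfE gt_eqF ?expR_gt0.
transitivity (expR (- (2 * s x)) * tr2 x H).
  rewrite /tr2 /mxtrace mulr_sumr exchange_big /=; apply: eq_bigr => i _.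
  rewrite mxE mulr_sumr; apply: eq_bigr => j _.
  by rewrite -{1}(invmx_sym mg Vx) !mxE mulrA.
rewrite /H !tr2D !tr2N !tr2Z !tr2_outer tr2_metric // -lap_tr2 // (grC f s) //.
by congr (_ * _); move: (laplacian _ _ _ _) => L; gen_atoms; ring.
Qed.

End Trace.

(** * The GJMS equation for the compactified metric *)

Section ConformalLaplacian.
Context {R : realType}.
Variables (b : bool) (k : nat) (V : set 'rV[R]_k.+1) (g : 'rV[R]_k.+1 -> 'M[R]_k.+1).
Hypotheses (oV : relopen b V) (mg : metric_on b V g).
Variables rho F : 'rV[R]_k.+1 -> R.
Hypotheses (srho : smooth_on b V rho) (rho0 : forall x, V x -> 0 < rho x).
Hypothesis sF : smooth_on b V F.

(** For s = k/2 - l this is the operator Laplacian + (k/2)^2 - l^2 of the metric rho^-2 g,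
    conjugated by rho^s. No division by rho remains, so it makes sense up to the wall. The
    coefficient of F collects the terms that a totally geodesic wall and the eikonal equation make
    small. *)
Definition Qop (l s : R) x := rho x ^+ 2 * laplacian b g F x
  + (1 - 2 * l) * (rho x * dd b (gr b g rho x) F x)
  + F x * (s * rho x * laplacian b g rho x + s * (s - k%:R) * (dd b (gr b g rho x) rho x - 1)).

(** The metric rho^-2 g is the conformal change of g with exponent -ln rho. The zeroth order terms
    combine since (k/2)^2 - l^2 = s (k - s). *)
Lemma lap_model (l : R) x : V x -> let s := k%:R / 2 - l in
  laplacian b (fun y => (rho y ^+ 2)^-1 *: g y) (fun y => rho y `^ s * F y) x
  + ((k%:R / 2) ^+ 2 - l ^+ 2) * (rho x `^ s * F x) = rho x `^ s * Qop l s x.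
Proof.
move=> Vx s.
have sl := smooth_ln oV srho rho0.
pose t y := - ln (rho y).
have st : smooth_on b V t by apply: smoothN.
have r0 := rho0 Vx; have r1 : rho x != 0 by rewrite gt_eqF.
have E1 y : V y -> (rho y ^+ 2)^-1 *: g y = conf g t y.
  move=> /rho0 ry; rewrite /conf; congr (_ *: _).
  by rewrite mulr2n mulrDl !mul1r expRD /t expRN lnK // expr2 invfM.
pose a y : R := expR (s * ln y).
pose a' y := s * y^-1 * a y.
pose a'' y := s * (s - 1) * (y^-1 ^+ 2) * a y.
pose P y := a (rho y).
have E2 y : V y -> rho y `^ s * F y = P y * F y.
  by move=> /rho0 ry; rewrite /powR gt_eqF.
have sP : smooth_on b V P.
  by apply: smooth_exp => //; apply: smoothM => //; apply: smooth_cst.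
have sI : smooth_on b V (fun y => (rho y)^-1).
  by apply: smoothV => // y /rho0 ry; rewrite gt_eqF.
have da (y : R) : 0 < y -> is_derive y (1 : R) a (a' y).
  move=> y0; have d1 := is_deriveZ s (is_derive1_ln y0).
  have := is_derive1_comp (is_derive_expR _) d1.
  by rewrite /a' /GRing.scale /= mulrC.
have da' (y : R) : 0 < y -> is_derive y (1 : R) a' (a'' y).
  move=> y0; have y1 : y != 0 by rewrite gt_eqF.
  have := is_deriveM (is_deriveZ s (is_derive_inv y1)) (da y y0).
  rewrite /a'' /a' /GRing.scale /=; set e := (X in is_derive _ _ _ X).
  suff -> : e = s * (s - 1) * y^-1 ^+ 2 * a y by [].
  rewrite /e (_ : s *: y^-1 = s * y^-1) //; move: (a y) => z; field.
  exact: y1.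
have sP' : smooth_on b V (fun y => a' (rho y)).
  by apply: smoothM => //; apply: smoothM => //; apply: smooth_cst.
have LP := lap_comp1 oV mg srho Vx (fun y Vy => da _ (rho0 Vy)) (da' _ r0) sP sP'.
have GP f : dd b (gr b g f x) P x = a' (rho x) * dd b (gr b g f x) rho x.
  exact: (dd_comp1 oV _ (da _ r0) srho Vx).
have Gt f : dd b (gr b g t x) f x = - (rho x)^-1 * dd b (gr b g rho x) f x.
  rewrite (grC mg _ _ Vx) (ddN oV _ sl Vx) (dd_ln oV _ srho Vx r0) mulNr.
  by rewrite (grC mg f rho Vx).
rewrite (laplacian_eq oV E1 Vx E2) (lap_conf oV mg st (smoothM oV sP sF) Vx).
rewrite (lapM oV mg sP sF Vx) LP (ddM oV _ sP sF Vx) !Gt (grC mg P F Vx) !GP (grC mg F rho Vx).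
have -> : expR (- (2 * t x)) = rho x ^+ 2.
  by rewrite -mulrN /t opprK mulr2n mulrDl !mul1r expRD lnK // expr2.
have -> : rho x `^ s = a (rho x) by rewrite /powR gt_eqF.
rewrite /Qop /a' /a'' /P -natr1 /s.
move: (a (rho x)) (laplacian _ _ _ _) (laplacian _ _ _ _) (rho x) r1 => A L M r r1.
gen_atoms; field.
exact: r1.
Qed.
End ConformalLaplacian.

(** * Vanishing order at the wall *)

Section Van.
Context {R : realType}.
Variables (k : nat) (V : set 'rV[R]_k.+1).
Hypothesis oV : relopen true V.
Implicit Types (f g : 'rV[R]_k.+1 -> R).

Local Notation d0 := (pd true (ord0 : 'I_k.+1)).
Local Notation sm := (smooth_on true V).

Definition wall : set 'rV[R]_k.+1 := [set x | V x /\ x 0 ord0 = 0].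

(* Vanishing to order N at the wall; tc N is the coefficient of x_0^N in the
   Taylor expansion. *)
Definition van N f := forall x, wall x -> forall i, (i < N)%N -> iter i d0 f x = 0.

Definition tc N f x : R := iter N d0 f x / N`!%:R.

Lemma smooth_iter N f : sm f -> sm (iter N d0 f).
Proof. by move=> sf; elim: N => // N IH; apply: smooth_pd. Qed.

Lemma iter_eq N f g : (forall y, V y -> f y = g y) ->
  forall y, V y -> iter N d0 f y = iter N d0 g y.
Proof. by move=> fg; elim: N => // N IH y Vy; apply: (pd_eq _ oV Vy). Qed.

Lemma pd0D f g x : sm f -> sm g -> V x -> d0 (fun y => f y + g y) x = d0 f x + d0 g x.
Proof. by move=> sf sg Vx; rewrite -!dd_delta (ddD oV). Qed.

Lemma pd0M f g x : sm f -> sm g -> V x ->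
  d0 (fun y => f y * g y) x = d0 f x * g x + f x * d0 g x.
Proof. by move=> sf sg Vx; rewrite -!dd_delta (ddM oV). Qed.

Lemma iterD N f g x : sm f -> sm g -> V x ->
  iter N d0 (fun y => f y + g y) x = iter N d0 f x + iter N d0 g x.
Proof.
move=> sf sg; elim: N x => // N IH x Vx; rewrite !iterS.
rewrite (pd_eq _ oV Vx IH) pd0D //; exact: smooth_iter.
Qed.

Lemma van_eq N f g : (forall y, V y -> f y = g y) -> van N f -> van N g.
Proof. by move=> fg vf x [Vx x0] i iN; rewrite -(iter_eq i fg Vx); exact: vf. Qed.

Lemma vanW M N f : (M <= N)%N -> van N f -> van M f.
Proof. by move=> MN vf x wx i iM; apply: vf => //; apply: leq_trans MN. Qed.

Lemma van0 f : van 0 f. Proof. by []. Qed.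

Lemma vanS N f : van N.+1 f <-> (forall x, wall x -> f x = 0) /\ van N (d0 f).
Proof.
split=> [vf|[f0 vf]].
  by split=> [x wx|x wx i iN]; [apply: (vf x wx 0%N)|rewrite -iterSr; apply: vf].
by move=> x wx [|i] iN; [exact: f0|rewrite iterSr; exact: vf].
Qed.

Lemma vanD N f g : sm f -> sm g -> van N f -> van N g -> van N (fun y => f y + g y).
Proof.
move=> sf sg vf vg x wx i iN; have [Vx _] := wx.
by rewrite iterD // vf // vg // addr0.
Qed.

(** By induction on M + N: in each summand of the product rule only one factor loses an order, and a
    factor of order 0 has none to lose. *)
Lemma vanM M N f g : sm f -> sm g -> van M f -> van N g -> van (M + N) (fun y => f y * g y).
Proof.
move En : (M + N)%N => n; elim: n M N En f g => // n IH M N En f g sf sg vf vg.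
have sf' : sm (d0 f) by apply: smooth_pd.
have sg' : sm (d0 g) by apply: smooth_pd.
apply/vanS; split.
  case: M N En vf vg => [|M] [|N] //= En vf vg x wx.
  - by have [-> //] := (vanS N g).1 vg; rewrite mulr0.
  - by have [-> //] := (vanS M f).1 vf; rewrite mul0r.
  - by have [-> //] := (vanS M f).1 vf; rewrite mul0r.
apply: (@van_eq _ (fun y => d0 f y * g y + f y * d0 g y)).
  by move=> y Vy; rewrite pd0M.
apply: vanD; try by apply: smoothM.
  case: M En vf => [|M] En vf.
    by apply: (IH 0%N n) => //; apply: vanW vg; rewrite -[N]add0n En.
  by apply: (IH M N) => //; [case: En|case: ((vanS M f).1 vf)].
case: N En vg => [|N] En vg.
  by apply: (IH n 0%N) => //; rewrite ?addn0 //; apply: vanW vf; rewrite -[M]addn0 En.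
by apply: (IH M N) => //; [move: En; rewrite addnS => -[]|case: ((vanS N g).1 vg)].
Qed.

Lemma vanMl N f g : sm f -> sm g -> van N g -> van N (fun y => f y * g y).
Proof. by move=> sf sg vg; rewrite -[N]add0n; apply: vanM. Qed.

Lemma vanMr N f g : sm f -> sm g -> van N f -> van N (fun y => f y * g y).
Proof. by move=> sf sg vf; rewrite -[N]addn0; apply: vanM. Qed.

Lemma van_cst0 N : van N (fun=> 0).
Proof.
have s0 : sm (fun=> 0) by apply: smooth_cst.
elim: N => // N IH; apply/vanS; split => //.
apply: (@van_eq _ (fun=> 0)) => // y Vy; apply/esym; apply: is_pdE; [exact: oV.1|exact: is_pd_cst].
Qed.

Lemma vanN N f : sm f -> van N f -> van N (fun y => - f y).
Proof.
move=> sf vf; apply: (@van_eq _ (fun y => -1 * f y)); first by move=> y _; rewrite mulN1r.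
by apply: vanMl => //; apply: smooth_cst.
Qed.

Lemma vanB N f g : sm f -> sm g -> van N f -> van N g -> van N (fun y => f y - g y).
Proof. by move=> sf sg vf vg; apply: vanD => //; [apply: smoothN|apply: vanN]. Qed.

Lemma van_sum N (I : Type) (r : seq I) (F : I -> 'rV[R]_k.+1 -> R) :
  (forall i, sm (F i)) -> (forall i, van N (F i)) -> van N (fun x => \sum_(i <- r) F i x).
Proof.
move=> sF vF; elim: r => [|a r IH].
  by apply: (@van_eq _ (fun=> 0)); [move=> y _; rewrite big_nil|exact: van_cst0].
apply: (@van_eq _ (fun y => F a y + \sum_(i <- r) F i y)).
  by move=> y _; rewrite big_cons.
by apply: vanD => //; apply: smooth_sum.
Qed.

Lemma wall_pd f i x : (forall y, wall y -> f y = 0) -> i != ord0 -> wall x ->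
  pd true i f x = 0.
Proof.
move=> f0 i0 wx; have [Vx x0] := wx.
apply: is_pdE; first exact: oV.1.
rewrite /is_pd (@fmap_near_eq _ _ _ _ _ (cst 0)); first exact: cvg_cst.
apply: filterS (relopen_near i oV Vx) => t Vt.
rewrite /diff_quot !f0 ?subrr ?mulr0 //; split=> //.
by rewrite stepE x0 (eq_sym ord0) (negbTE i0) mulr0 addr0.
Qed.

Lemma iter_pdC N f i y : sm f -> V y -> iter N d0 (pd true i f) y = pd true i (iter N d0 f) y.
Proof.
move=> sf; elim: N y => // N IH y Vy.
rewrite !iterS (pd_eq _ oV Vy IH) (pdC oV) //; exact: smooth_iter.
Qed.

Lemma van_pd N f i : sm f -> i != ord0 -> van N f -> van N (pd true i f).
Proof.
move=> sf i0 vf x wx j jN; have [Vx _] := wx; rewrite iter_pdC //.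
by apply: wall_pd => // y wy; apply: vf.
Qed.

Lemma van_dd N f v : sm f -> van N.+1 f -> van N (dd true v f).
Proof.
move=> sf vf; apply: (@van_eq _ (fun y => \sum_i v 0 i * pd true i f y)).
  by move=> y _; rewrite ddE.
apply: van_sum => i; first by apply: smoothM; [exact: oV|apply: smooth_cst|apply: smooth_pd].
apply: vanMl; [apply: smooth_cst => //|apply: smooth_pd => //|].
have [->|i0] := eqVneq i ord0; first by case: ((vanS N f).1 vf).
by apply: van_pd => //; apply: vanW vf.
Qed.

Lemma tcS N f x : (N.+1)%:R * tc N.+1 f x = tc N (d0 f) x.
Proof.
by rewrite /tc iterSr factS natrM invfM mulrCA mulVKf ?pnatr_eq0.
Qed.

Lemma tc0 f x : tc 0 f x = f x.
Proof. by rewrite /tc fact0 divr1. Qed.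

Lemma tcD N f g x : sm f -> sm g -> V x -> tc N (fun y => f y + g y) x = tc N f x + tc N g x.
Proof. by move=> sf sg Vx; rewrite /tc iterD // mulrDl. Qed.

Lemma tc_eq N f g x : (forall y, V y -> f y = g y) -> V x -> tc N f x = tc N g x.
Proof. by move=> fg Vx; rewrite /tc (iter_eq N fg Vx). Qed.

Lemma van_tc N M f x : van N f -> (M < N)%N -> wall x -> tc M f x = 0.
Proof. by move=> vf MN wx; rewrite /tc vf // mul0r. Qed.

(** By [tcS], differentiation multiplies a leading coefficient by its order. The two summands of the
    product rule therefore contribute M and N times the product, and M + N cancels. *)
Lemma tc_lead M N f g x : sm f -> sm g -> van M f -> van N g -> wall x ->
  tc (M + N) (fun y => f y * g y) x = tc M f x * tc N g x.
Proof.
move En : (M + N)%N => n; elim: n M N En f g => [|n IH] M N En f g sf sg vf vg wx.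
  by case: M N En vf vg => [|M] [|N] //= En vf vg; rewrite !tc0.
have [Vx _] := wx.
have sf' : sm (d0 f) by apply: smooth_pd.
have sg' : sm (d0 g) by apply: smooth_pd.
have n0 : (n.+1)%:R != 0 :> R by rewrite pnatr_eq0.
apply: (mulfI n0); rewrite tcS.
rewrite (@tc_eq _ _ (fun y => d0 f y * g y + f y * d0 g y)) //; last first.
  by move=> y Vy; rewrite pd0M.
rewrite tcD //; try by apply: smoothM.
have -> : tc n (fun y => d0 f y * g y) x = M%:R * tc M f x * tc N g x.
  case: M En vf => [|M] En vf.
    rewrite !mul0r (van_tc (N := N)) //; last by rewrite -En.
    by apply: vanMl.
  by rewrite tcS; apply: (IH M N) => //; [case: En|case: ((vanS M f).1 vf)].
have -> : tc n (fun y => f y * d0 g y) x = tc M f x * (N%:R * tc N g x).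
  case: N En vg => [|N] En vg.
    rewrite mul0r mulr0 (van_tc (N := M)) //; last by rewrite -En addn0.
    by apply: vanMr.
  by rewrite tcS; apply: (IH M N) => //; [move: En; rewrite addnS => -[]|case: ((vanS N g).1 vg)].
rewrite -En natrD; ring.
Qed.

Lemma van_tcS N f : van N f -> (forall x, wall x -> tc N f x = 0) -> van N.+1 f.
Proof.
move=> vf tf x wx i; rewrite ltnS leq_eqVlt => /orP[/eqP->|]; last exact: vf.
have := tf x wx; rewrite /tc => /eqP; rewrite mulf_eq0 invr_eq0 pnatr_eq0.
by rewrite -leqn0 leqNgt fact_gt0 orbF => /eqP.
Qed.

Lemma van_ddZ m f (Z : 'rV[R]_k.+1 -> 'rV[R]_k.+1) : sm f -> vsmooth true V Z ->
  van m.+1 f -> van m (fun y => dd true (Z y) f y).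
Proof.
move=> sf sZ vf; apply: (@van_eq _ (fun y => \sum_i Z y 0 i * pd true i f y)).
  by move=> y _; rewrite ddE.
apply: van_sum => i; first by apply: smoothM => //; apply: smooth_pd.
apply: vanMl => //; first exact: smooth_pd.
by have := van_dd (delta_mx 0 i) sf vf; apply: van_eq => y _; rewrite dd_delta.
Qed.

(** Tangential derivatives keep the order m + 1, so only the normal component of Z reaches the
    coefficient of order m. *)
Lemma tc_ddZ m f (Z : 'rV[R]_k.+1 -> 'rV[R]_k.+1) x : sm f -> vsmooth true V Z ->
  van m.+1 f -> wall x ->
  tc m (fun y => dd true (Z y) f y) x = Z x 0 ord0 * (m.+1%:R * tc m.+1 f x).
Proof.
move=> sf sZ vf wx; have [Vx _] := wx.
have sp i : sm (pd true i f) by apply: smooth_pd.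
have sM i : sm (fun y => Z y 0 i * pd true i f y) by apply: smoothM.
rewrite (@tc_eq _ _ (fun y => Z y 0 ord0 * pd true ord0 f y +
   \sum_(i < k) Z y 0 (lift ord0 i) * pd true (lift ord0 i) f y)) //; last first.
  by move=> y _; rewrite ddE big_ord_recl.
rewrite tcD //; last exact: smooth_sum.
rewrite [X in _ + X](van_tc (N := m.+1)) //; last first.
  apply: van_sum => i //; apply: vanMl => //.
  by apply: van_pd => //; apply: vanW vf.
rewrite addr0 -[m in LHS]add0n tc_lead //; last by case: ((vanS m f).1 vf).
by rewrite tc0 tcS.
Qed.

Lemma van_dd_wall f x : sm f -> van 1 f -> wall x -> forall v, dd true v f x = v 0 ord0 * pd true ord0 f x.
Proof.
move=> sf vf wx v; rewrite ddE big_ord_recl big1 ?addr0 // => i _.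
by rewrite wall_pd ?mulr0 // => y wy; apply: (vf y wy 0%N).
Qed.

Definition up (x : 'rV[R]_k.+1) (t : R) : 'rV[R]_k.+1 := x + t *: delta_mx 0 ord0.

Lemma up_near x : wall x -> exists2 e : R, 0 < e & forall t, 0 <= t <= e -> V (up x t).
Proof.
move=> [Vx x0]; have [Vm /(_ x Vx)[e e0 He]] := oV.
exists (e / 2); first by rewrite divr_gt0.
move=> t /andP[t0 te]; apply: He; split.
  by apply: model_step => //; apply: Vm.
move=> j; rewrite stepE addrAC subrr add0r.
have tle : t < e by apply: le_lt_trans te _; rewrite ltr_pdivrMr // ltr_pMr // ltr1n.
by case: eqP; rewrite ?mulr1 ?mulr0 ?normr0 ?ger0_norm.
Qed.

Lemma cont_up f x : sm f -> wall x -> f (up x t) @[t --> 0^'+] --> f x.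
Proof.
move=> sf wx; have [e e0 He] := up_near wx.
apply/cvgrPdist_lt => eps eps0.
have /cont_boxP/(_ _ wx.1 _ eps0)[d d0 Hd] := smooth_cont sf.
near=> t.
have t0 : 0 < t by near: t; apply: nbhs_right_gt.
apply: Hd; first by apply: He; rewrite ltW //=; near: t; exact: nbhs_right_le.
move=> j; rewrite stepE addrAC subrr add0r.
have td : t < d by near: t; exact: nbhs_right_lt.
by case: eqP; rewrite ?mulr1 ?mulr0 ?normr0 ?gtr0_norm.
Unshelve. all: by end_near.
Qed.

(** By L'Hopital's rule, once for each order. *)
Lemma taylor_lim N f x : sm f -> wall x -> (forall i, (i < N)%N -> tc i f x = 0) ->
  f (up x t) / t ^+ N @[t --> 0^'+] --> tc N f x.
Proof.
elim: N f => [|N IH] f sf wx hf.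
  rewrite tc0 (_ : (fun t => _) = fun t => f (up x t)); first exact: cont_up.
  by apply/funext => t; rewrite expr0 divr1.
have [e e0 He] := up_near wx.
have sf' : sm (d0 f) by apply: smooth_pd.
have hf' i : (i < N)%N -> tc i (d0 f) x = 0.
  by move=> iN; rewrite -tcS hf ?mulr0.
have N0 : (N.+1)%:R != 0 :> R by rewrite pnatr_eq0.
apply: (@lhopital_at_right _ _ (fun t => d0 f (up x t)) _ (fun t => N.+1%:R * t ^+ N) 0 e) => //.
- move=> t ht; apply: (line_derive oV.1 (fun i y => @smooth_is_pd _ _ _ _ i f y sf) He ht).
- move=> t _; have := is_deriveX N.+1 (is_derive_id t (1 : R)).
  by rewrite exprfctE /GRing.scale /= mulr1.
- by have := cont_up sf wx; rewrite -[f x]tc0 (hf 0%N).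
- have : (fun t : R => t ^+ N.+1) @ (0 : R) --> (0 : R) ^+ N.+1 by apply: exprn_continuous.
  by rewrite expr0n /=; apply: cvg_at_right_filter.
- move=> t; rewrite in_itv /= => /andP[t0 _].
  by rewrite mulf_neq0 // expf_neq0 // gt_eqF.
- have -> : tc N.+1 f x = (N.+1%:R)^-1 * tc N (d0 f) x by rewrite -tcS mulKf.
  rewrite (_ : (fun t => _) = fun t => (N.+1%:R)^-1 * (d0 f (up x t) / t ^+ N)).
    by apply: cvgM; [exact: cvg_cst|apply: IH].
  by apply/funext => t; rewrite invfM mulrCA.
Qed.

(** The metric h_+ is controlled only where x_0 > 0; this carries identities derived there to the
    wall, by continuity. *)
Lemma zero_extend f x : sm f -> (forall y, V y -> 0 < y 0 ord0 -> f y = 0) -> V x -> f x = 0.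
Proof.
move=> sf f0 Vx; have [x0|x0] := eqVneq (x 0 ord0) 0; last first.
  by apply: f0 => //; rewrite lt0r x0; apply: (oV.1 _ Vx).
have wx : wall x by [].
have H := cont_up sf wx; have [e e0 He] := up_near wx.
apply: (cvg_unique _ H) => //.
rewrite (@fmap_near_eq _ _ _ _ _ (cst 0)); first exact: cvg_cst.
near=> t; have t0 : 0 < t by near: t; apply: nbhs_right_gt.
apply: f0; first by apply: He; rewrite ltW //=; near: t; exact: nbhs_right_le.
by rewrite stepE x0 add0r eqxx mulr1.
Unshelve. all: by end_near.
Qed.

(** Turns the growth condition of the GJMS construction into vanishing Taylor coefficients: if those
    below i vanish, f / t^i tends to the coefficient i, while the bound makes it tend to 0. *)
Lemma tc_bound N f x (C : R) : sm f -> wall x ->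
  (\forall t \near 0^'+, `|f (up x t)| <= C * t ^+ N) -> forall i, (i < N)%N -> tc i f x = 0.
Proof.
move=> sf wx hC; elim/ltn_ind => i IH iN.
have H := taylor_lim sf wx (fun j ji => IH j ji (ltn_trans ji iN)).
apply: (cvg_unique _ H) => //.
have C0 : (fun t : R => C * t ^+ (N - i)) @ 0^'+ --> (0 : R).
  have : (fun t : R => C * t ^+ (N - i)) @ (0 : R) --> C * 0 ^+ (N - i).
    by apply: cvgM; [exact: cvg_cst|apply: exprn_continuous].
  rewrite expr0n subn_eq0 leqNgt iN mulr0; exact: cvg_at_right_filter.
apply/cvgr0Pnorm_le => eps eps0.
have /cvgr0Pnorm_le/(_ _ eps0) := C0.
move: hC; apply: filter_app2; near=> t => h1 h2.
have t0 : 0 < t by near: t; apply: nbhs_right_gt.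
apply: le_trans h2; rewrite normrM normfV (gtr0_norm (exprn_gt0 _ t0)).
rewrite ler_pdivrMr ?exprn_gt0 //; apply: le_trans h1 _.
apply: le_trans (ler_norm _) _; rewrite normrM (normrM C) -mulrA.
apply: ler_wpM2l => //.
have tN m : `|t ^+ m| = t ^+ m by rewrite ger0_norm // exprn_ge0 // ltW.
by rewrite !tN -exprD (subnK (ltnW iN)).
Unshelve. all: by end_near.
Qed.

End Van.

(** * Compactified hyperbolic metrics *)

Section HyperbolicDefining.
Context {R : realType}.
Variables (k : nat) (V : set 'rV[R]_k.+1) (g : 'rV[R]_k.+1 -> 'M[R]_k.+1).
Variable rho : 'rV[R]_k.+1 -> R.
Hypotheses (oV : relopen true V) (mg : metric_on true V g).
Hypotheses (srho : smooth_on true V rho) (rho0 : forall x, wall V x -> rho x = 0).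
Hypothesis rhop : forall x, V x -> 0 < x 0 ord0 -> 0 < rho x.
Variable hp : 'rV[R]_k.+1 -> 'M[R]_k.+1.
Hypothesis hpE : forall x, V x -> 0 < x 0 ord0 -> hp x = (rho x ^+ 2)^-1 *: g x.
Hypothesis hyp : forall x, V x -> 0 < x 0 ord0 -> sectional_curvature_eq true hp (-1) x.

Local Notation X := (gr true g rho).
Local Notation A := (Hm true g rho).
Local Notation Gm := (Gam true g).
Local Notation sm := (smooth_on true V).
Local Notation d := (dd true).

(** As X is the gradient of rho, this is |d rho|^2 - 1, the defect in the eikonal equation. *)
Definition eik x := d (X x) rho x - 1.

Definition inside := V `&` [set x | 0 < x 0 ord0].

Lemma relopen_inside : relopen true inside.
Proof. exact: (relopen_pos oV (smooth_coord oV ord0)). Qed.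

Lemma smooth_X : vsmooth true V X. Proof. exact: (smooth_gr oV mg srho). Qed.

Lemma smooth_A : msmooth true V A. Proof. exact: (smooth_Hm oV mg srho). Qed.

Lemma smooth_bilA Z W : vsmooth true V Z -> vsmooth true V W ->
  sm (fun y => bil (A y) (Z y) (W y)).
Proof. by apply: smooth_bil => //; exact: smooth_A. Qed.

Lemma smooth_bilg Z W : vsmooth true V Z -> vsmooth true V W ->
  sm (fun y => bil (g y) (Z y) (W y)).
Proof. by apply: smooth_bil => //; case: mg. Qed.

Lemma smooth_eik : sm eik.
Proof.
apply: smoothB => //; last exact: smooth_cst.
exact: (smooth_ddZ oV srho smooth_X).
Qed.

Lemma A_sym x u v : V x -> bil (A x) u v = bil (A x) v u.
Proof. by move=> Vx; apply: bilC; exact: (Hm_sym oV mg srho Vx). Qed.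

(** A(X, .) is half the differential of |X|^2, so the normal components of A are governed by the
    eikonal defect alone. *)
Lemma A_X x z : V x -> bil (A x) (X x) z = 2^-1 * d z eik x.
Proof.
move=> Vx; have sN : sm (fun y => d (X y) rho y) by exact: (smooth_ddZ oV srho smooth_X).
rewrite (ddB oV z sN (smooth_cst oV 1) Vx) (dd_cst oV) // subr0.
rewrite (dd_eq oV z (g := fun y => bil (g y) (X y) (X y)) Vx); last first.
  by move=> y Vy; rewrite (gr_inner mg).
rewrite (dd_inner oV mg z smooth_X smooth_X Vx) (inner_sym mg (X x) _ Vx).
by rewrite (gr_cov oV mg z _ srho Vx) (A_sym z _ Vx); gen_atoms; lra.
Qed.

Definition K x u v := bil (g x) (Rm true g x u v v) u.

Lemma vsmoothN p (Z : 'rV[R]_k.+1 -> 'rV[R]_p) :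
  vsmooth true V Z -> vsmooth true V (fun y => - Z y).
Proof.
move=> sZ j; apply: (smooth_eq oV (f := fun y => - Z y 0 j)).
  by move=> y _; rewrite mxE.
exact: smoothN.
Qed.

Lemma smooth_K u v : sm (fun x => K x u v).
Proof.
have sG c e : vsmooth true V (fun y => Gm y c e) by apply: smooth_Gam => //; apply: vsmooth_cst.
have sGG a c e : vsmooth true V (fun y => Gm y a (Gm y c e)).
  by apply: smooth_Gam => //; apply: vsmooth_cst.
pose Z a c e := fun y => vd true a (fun z => Gm z c e) y + Gm y a (Gm y c e).
have sZ a c e : vsmooth true V (Z a c e) by apply: (vsmoothD oV) => //; apply: (smooth_vd oV).
apply: (smooth_eq oV (f := fun x => bil (g x) (Z u v v x + - Z v u v x) u)).
  by move=> y Vy; rewrite /K (RmE oV mg).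
by apply: smooth_bilg; [apply: (vsmoothD oV) => //; apply: vsmoothN|apply: vsmooth_cst].
Qed.

(** In [conf_curvature] with exponent -ln rho the curvature of h_+ is -1, which cancels the term |d
    rho|^2 up to [eik]. The factor rho^2 clears denominators, so that both sides are smooth at the
    wall. *)
Lemma curvature_inside u v x : V x -> 0 < x 0 ord0 ->
  rho x ^+ 2 * K x u v = - rho x * (bil (A x) u u * bil (g x) v v + bil (A x) v v * bil (g x) u u
     - 2 * bil (A x) u v * bil (g x) u v)
  + eik x * (bil (g x) u u * bil (g x) v v - bil (g x) u v ^+ 2).
Proof.
move=> Vx x0.
have oI := relopen_inside; have Ix : inside x by [].
have IV : inside `<=` V by move=> y [].
have mgI := metric_on_sub IV mg.
have sr : smooth_on true inside rho := smooth_sub IV srho.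
have rI y : inside y -> 0 < rho y by case=> ? ?; exact: rhop.
have sl := smooth_ln oI sr rI.
pose t y := - ln (rho y).
have st : smooth_on true inside t by apply: smoothN.
have E y : inside y -> hp y = conf g t y.
  move=> Iy; have ry := rI y Iy; case: (Iy) => Vy y0.
  rewrite hpE // /conf; congr (_ *: _).
  by rewrite mulr2n mulrDl !mul1r expRD /t expRN lnK // expr2 invfM.
have r0 := rI x Ix; have r1 : rho x != 0 by rewrite gt_eqF.
have HH : sectional_curvature_eq true (conf g t) (-1) x.
  move=> a c; have := hyp Vx x0 a c.
  have -> : riemann_uvv true hp x a c = riemann_uvv true (conf g t) x a c.
    apply/rowP => m; rewrite !mxE; do 3 (apply: eq_bigr => ? _).
    by congr (_ * _); apply: (riemann_eq oI E).
  by rewrite /inner E.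
have := HH u v; rewrite Rm_uvv.
have -> : inner (conf g t) x (Rm true (conf g t) x u v v) u =
  bil (conf g t x) (Rm true (conf g t) x u v v) u by rewrite bil_def.
have In a c : inner (conf g t) x a c = bil (conf g t x) a c by rewrite bil_def.
rewrite !In (conf_curvature oI mgI st u v Ix) !bil_conf.
have e2 : expR (2 * t x) = (rho x)^-1 ^+ 2.
  by rewrite mulr2n mulrDl !mul1r expRD /t expRN lnK.
have dt w : d w t x = - (rho x)^-1 * d w rho x.
  by rewrite (ddN oI _ sl Ix) (dd_ln oI _ sr Ix r0) mulNr.
have sV : smooth_on true inside (fun y => - (rho y)^-1).
  by apply: smoothN => //; apply: smoothV => // y Iy; rewrite gt_eqF ?rI.
have dl (y : R) : 0 < y -> is_derive y (1 : R) (fun z => - ln z) (- y^-1).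
  by move=> y0; have := is_deriveN (is_derive1_ln y0).
have di (y : R) : 0 < y -> is_derive y (1 : R) (fun z => - z^-1) (y^-1 ^+ 2).
  move=> y0; have y1 : y != 0 by rewrite gt_eqF.
  by have := is_deriveN (is_derive_inv y1); rewrite opprK expr2.
have Ht a c : bil (Hm true g t x) a c =
    - (rho x)^-1 * bil (A x) a c + (rho x)^-1 ^+ 2 * (d a rho x * d c rho x).
  rewrite (Hm_comp1 g oI (a := fun z => - ln z) (a' := fun z => - z^-1) (a'' := fun z => z^-1 ^+ 2)
    sr Ix (fun y Iy => dl _ (rI y Iy)) (di _ r0) st sV).
  by rewrite bilMD !bilMZ df_bil.
have Nt : d (gr true g t x) t x = (rho x)^-1 ^+ 2 * (eik x + 1).
  rewrite dt (grC mgI t rho Ix) dt /eik subrK; gen_atoms; ring.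
rewrite e2 !Ht Nt !dt /K.
move: (eik x) (rho x) r1 => e r r1.
move: (bil (g x) (Rm _ _ _ _ _ _) u) => KK.
move: (bil (A x) u u) (bil (A x) v v) (bil (A x) u v) (bil (g x) u u) (bil (g x) v v) (bil (g x) u v)
  (d u rho x) (d v rho x) => a1 a2 a3 g1 g2 g3 p q H.
have r2 : r^-1 ^+ 2 != 0 by rewrite expf_neq0 // invr_eq0.
have H' := congr1 (fun z => r ^+ 4 * z) H.
move: H' => /=; rewrite !mulr2n => H'.
apply: (subr0_eq _); move/eqP: H'; rewrite -subr_eq0 => /eqP H'.
rewrite -[RHS]H'; field; exact: r1.
Qed.

Lemma curvature_identity u v x : V x ->
  rho x ^+ 2 * K x u v = - rho x * (bil (A x) u u * bil (g x) v v + bil (A x) v v * bil (g x) u u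
     - 2 * bil (A x) u v * bil (g x) u v)
  + eik x * (bil (g x) u u * bil (g x) v v - bil (g x) u v ^+ 2).
Proof.
move=> Vx; apply/eqP; rewrite -subr_eq0; apply/eqP.
have sg a c : sm (fun y => bil (g y) a c) by apply: smooth_bilg; apply: vsmooth_cst.
have sa a c : sm (fun y => bil (A y) a c) by apply: smooth_bilA; apply: vsmooth_cst.
have se := smooth_eik; have sK := smooth_K u v.
apply: (@zero_extend _ _ V oV (fun x => rho x ^+ 2 * K x u v - (- rho x * (bil (A x) u u * bil (g x) v v
  + bil (A x) v v * bil (g x) u u - 2 * bil (A x) u v * bil (g x) u v)
  + eik x * (bil (g x) u u * bil (g x) v v - bil (g x) u v ^+ 2))) x) => //.
  apply: smoothB => //; first by apply: smoothM => //; apply: smoothX.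
  apply: smoothD => //; apply: smoothM => //; first exact: smoothN.
    apply: smoothB => //; last by do 2 (apply: smoothM => //); apply: smooth_cst.
    by apply: smoothD => //; apply: smoothM.
  by apply: smoothB => //; [apply: smoothM|apply: smoothX].
by move=> y Vy y0; rewrite curvature_inside // subrr.
Qed.

(** The Ricci identity for rho with u = X expresses X(A(v, v)) through K(X, v), and
    [curvature_identity] turns rho^2 K(X, v) into -rho A(v, v) up to the defect. The second line of
    the result is rho^2 times terms that vanish with A, since the covariant derivative of X is A
    itself; all that follows contains [eik] or its derivatives. *)
Lemma riccati v x : V x ->
  rho x ^+ 2 * d (X x) (fun y => bil (A y) v v) x = rho x * bil (A x) v v
  + rho x ^+ 2 * (2 * bil (A x) (Gm x (X x) v) v - bil (A x) (cov true g v X x) v)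
  + (rho x ^+ 2 * (2^-1 * d v (d v eik) x - 2^-1 * d (Gm x v v) eik x)
     + rho x * (2^-1 * d (X x) eik x * bil (g x) v v + eik x * bil (A x) v v - d v eik x * d v rho x)
     - eik x * ((1 + eik x) * bil (g x) v v - d v rho x ^+ 2)).
Proof.
move=> Vx; have := ricci_identity oV mg (X x) v srho Vx.
have -> : d (Rm true g x (X x) v v) rho x = K x (X x) v.
  by rewrite -(gr_inner mg rho _ Vx) /K (inner_sym mg _ _ Vx).
have -> : d v (fun y => bil (A y) (X x) v) x = 2^-1 * d v (d v eik) x - bil (A x) (vd true v X x) v.
  have := dd_lin oV (L := fun z y => bil (A y) z v) v (x := x) _ _ smooth_X Vx.
  move=> /(_ _ _)/esym/(canRL (addKr _)) ->; last first.
  - by move=> i; apply: smooth_bilA; apply: vsmooth_cst.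
  - by move=> z y Vy; exact: bil_suml.
  rewrite addrC; congr (_ - _).
  rewrite (dd_eq oV v (g := fun y => 2^-1 * d v eik y) Vx); last by move=> y Vy; rewrite A_X.
  by rewrite (ddZ oV _ _ (smooth_dd oV v smooth_eik) Vx).
have -> : bil (A x) (X x) (Gm x v v) = 2^-1 * d (Gm x v v) eik x by rewrite A_X.
have -> : vd true v X x = cov true g v X x - Gm x v (X x) by rewrite /cov addrK.
have C : Gm x v (X x) = Gm x (X x) v by rewrite (GamC oV mg _ _ Vx).
rewrite bilBl !C (A_sym v _ Vx) => H.
have R1 := curvature_identity (X x) v Vx.
rewrite !(gr_inner mg _ _ Vx) !A_X // in R1.
have e1 : d (X x) rho x = 1 + eik x by rewrite /eik addrC subrK.
rewrite e1 in R1.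
have -> : d (X x) (fun y => bil (A y) v v) x = - K x (X x) v + 2 * bil (A x) (Gm x (X x) v) v
  + 2^-1 * d v (d v eik) x - bil (A x) (cov true g v X x) v - 2^-1 * d (Gm x v v) eik x.
  move: H; move: (K x _ _) => KK; gen_atoms => H; lra.
have -> : rho x ^+ 2 * (- K x (X x) v + 2 * bil (A x) (Gm x (X x) v) v
  + 2^-1 * d v (d v eik) x - bil (A x) (cov true g v X x) v - 2^-1 * d (Gm x v v) eik x) =
  - (rho x ^+ 2 * K x (X x) v) + rho x ^+ 2 * (2 * bil (A x) (Gm x (X x) v) v
  + 2^-1 * d v (d v eik) x - bil (A x) (cov true g v X x) v - 2^-1 * d (Gm x v v) eik x).
  move: (K x _ _) (rho x) => KK r; gen_atoms; ring.
rewrite R1; move: (rho x) (eik x) => r e; gen_atoms; by field.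
Qed.

Variable N : nat.
Hypothesis ve : van V N eik.

Lemma van_rho : van V 1 rho.
Proof. by move=> x wx [|i] // _; apply: rho0. Qed.

Lemma rho_X x : (0 < N)%N -> wall V x -> X x 0 ord0 * pd true ord0 rho x = 1.
Proof.
move=> N0 wx; have := ve wx N0; rewrite /= /eik => /eqP; rewrite subr_eq0 => /eqP <-.
by rewrite (van_dd_wall oV srho van_rho wx).
Qed.

Lemma rho_d0 x : (0 < N)%N -> wall V x -> pd true ord0 rho x != 0.
Proof.
move=> N0 wx; apply/eqP => r0; have := rho_X N0 wx.
by rewrite r0 mulr0 => /eqP; rewrite eq_sym oner_eq0.
Qed.

Definition vanA m := forall u v, van V m (fun y => bil (A y) u v).

Lemma vanA_diag m : (forall v, van V m (fun y => bil (A y) v v)) -> vanA m.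
Proof.
move=> H u v; have sA a c : sm (fun y => bil (A y) a c) by apply: smooth_bilA; apply: vsmooth_cst.
apply: (van_eq oV (f := fun y => 2^-1 * (bil (A y) (u + v) (u + v) - bil (A y) u u - bil (A y) v v))).
  by move=> y Vy; rewrite !bilDl !bilDr (A_sym v u Vy); gen_atoms; lra.
apply: vanMl => //; first exact: smooth_cst.
  by apply: smoothB => //; apply: smoothB.
by apply: vanB => //; [apply: smoothB|apply: vanB].
Qed.

Lemma vanA_bil m Z W : vanA m -> vsmooth true V Z -> vsmooth true V W ->
  van V m (fun y => bil (A y) (Z y) (W y)).
Proof.
move=> vA sZ sW.
have sA := smooth_A.
apply: (van_eq oV (f := fun y => \sum_i \sum_j Z y 0 i * A y i j * W y 0 j)).
  by move=> y _; rewrite bilE.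
apply: van_sum => // i; first by apply: smooth_sum => // j; do 2 (apply: smoothM => //).
apply: van_sum => // j; first by do 2 (apply: smoothM => //).
apply: vanMr => //; first exact: smoothM.
apply: vanMl => //.
by apply: (van_eq oV _ (vA (delta_mx 0 i) (delta_mx 0 j))) => y _; rewrite bil_delta.
Qed.

Lemma van_rho2 : van V 2 (fun y => rho y ^+ 2).
Proof. by have := vanM oV srho srho van_rho van_rho. Qed.

(** The right side of [riccati] reads rho A(v, v) + rho^2 [ricc_rem] + [ricc_err]. *)
Definition ricc_rem v y := 2 * bil (A y) (Gm y (X y) v) v - bil (A y) (cov true g v X y) v.
Definition ricc_err v x := (rho x ^+ 2 * (2^-1 * d v (d v eik) x - 2^-1 * d (Gm x v v) eik x)
     + rho x * (2^-1 * d (X x) eik x * bil (g x) v v + eik x * bil (A x) v v - d v eik x * d v rho x)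
     - eik x * ((1 + eik x) * bil (g x) v v - d v rho x ^+ 2)).

Lemma smooth_cov v : vsmooth true V (cov true g v X).
Proof.
apply: (vsmoothD oV); first by apply: (smooth_vd oV); exact: smooth_X.
by apply: smooth_Gam => //; [apply: vsmooth_cst|exact: smooth_X].
Qed.

Lemma smooth_GamX v : vsmooth true V (fun y => Gm y (X y) v).
Proof. by apply: smooth_Gam => //; [exact: smooth_X|apply: vsmooth_cst]. Qed.

Lemma ricc_remP v : sm (ricc_rem v) /\ (forall m, vanA m -> van V m (ricc_rem v)).
Proof.
have sv := vsmooth_cst oV v; have sc := smooth_cov v; have sG := smooth_GamX v.
have s1 : sm (fun y => bil (A y) (Gm y (X y) v) v) by apply: smooth_bilA.
have s2 : sm (fun y => bil (A y) (cov true g v X y) v) by apply: smooth_bilA.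
have c2 : sm (fun=> 2) by apply: smooth_cst.
split; first by apply: smoothB => //; apply: smoothM.
move=> m vA; apply: vanB => //; first exact: smoothM.
  by apply: vanMl => //; apply: vanA_bil.
exact: vanA_bil.
Qed.

(** The full order N survives because every derivative that falls on [eik] is paid for by a factor
    rho. *)
Lemma ricc_errP v : sm (ricc_err v) /\ ((2 <= N)%N -> van V N (ricc_err v)).
Proof.
have se := smooth_eik; have sv := vsmooth_cst oV v; have sX := smooth_X.
have sde : sm (d v eik) by apply: (smooth_dd oV).
have sdde : sm (d v (d v eik)) by apply: (smooth_dd oV).
have sdr : sm (d v rho) by apply: (smooth_dd oV).
have sGe : sm (fun x => d (Gm x v v) eik x) by apply: (smooth_ddZ oV se); apply: smooth_Gam.
have sXe : sm (fun x => d (X x) eik x) by apply: (smooth_ddZ oV se).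
have sg : sm (fun x => bil (g x) v v) by apply: smooth_bilg.
have sA : sm (fun x => bil (A x) v v) by apply: smooth_bilA.
have sc c : sm (fun=> c) by apply: smooth_cst.
have s1 : sm (fun x => 2^-1 * d v (d v eik) x) by apply: smoothM.
have s2 : sm (fun x => 2^-1 * d (Gm x v v) eik x) by apply: smoothM.
have s3 : sm (fun x => 2^-1 * d (X x) eik x) by apply: smoothM.
have s4 : sm (fun x => 2^-1 * d (X x) eik x * bil (g x) v v) by apply: smoothM.
have s5 : sm (fun x => eik x * bil (A x) v v) by apply: smoothM.
have s6 : sm (fun x => d v eik x * d v rho x) by apply: smoothM.
have sr2 : sm (fun x => rho x ^+ 2) by apply: smoothX.
have s7 : sm (fun x => 2^-1 * d v (d v eik) x - 2^-1 * d (Gm x v v) eik x) by apply: smoothB.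
have s45 : sm (fun x => 2^-1 * d (X x) eik x * bil (g x) v v + eik x * bil (A x) v v) by apply: smoothD.
have s8 : sm (fun x => 2^-1 * d (X x) eik x * bil (g x) v v + eik x * bil (A x) v v
   - d v eik x * d v rho x) by apply: smoothB.
have s9 : sm (fun x => (1 + eik x) * bil (g x) v v - d v rho x ^+ 2).
  by apply: smoothB => //; [apply: smoothM => //; apply: smoothD|apply: smoothX].
have t1 := smoothM oV sr2 s7; have t2 := smoothM oV srho s8; have t3 := smoothM oV se s9.
have t12 := smoothD oV t1 t2.
split; first exact: (smoothB oV t12 t3).
case: N ve => [|[|n]] // ve' _.
apply: vanB => //; last exact: vanMr.
have v1 : van V n.+1 (d v eik) by apply: van_dd.
have v2 : van V n (d v (d v eik)) by apply: van_dd.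
have v3 : van V n.+1 (fun x => d (Gm x v v) eik x) by apply: van_ddZ => //; apply: smooth_Gam.
have v4 : van V n.+1 (fun x => d (X x) eik x) by apply: van_ddZ.
have ve1 : van V n.+1 eik by apply: vanW ve'.
apply: vanD => //.
  rewrite -[n.+2]/(2 + n)%N; apply: vanM => //; first exact: van_rho2.
  apply: vanB => //; first by apply: vanMl.
  by apply: vanMl => //; apply: vanW v3.
rewrite -[n.+2]/(1 + n.+1)%N; apply: vanM => //; first exact: van_rho.
apply: vanB => //; last by apply: vanMr.
apply: vanD => //; last by apply: vanMr.
by apply: vanMr => //; apply: vanMl.
Qed.

(** Compare the coefficients of order m + 1 in [riccati]. If a is the coefficient of order m of A(v,
    v), the left side gives m a and the right side a, up to the common factor d_0 rho, because X^0
    d_0 rho = 1 on the wall. Hence (m - 1) a = 0. The error terms have order at least m + 2. *)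
Lemma vanA_step m : vanA m -> m != 1%N -> (m + 2 <= N)%N -> vanA m.+1.
Proof.
move=> vA m1 mN; apply: vanA_diag => v; apply: (van_tcS (V := V)) => // x wx; have [Vx _] := wx.
have N2 : (2 <= N)%N by apply: leq_trans mN; rewrite leq_addl.
have N0 : (0 < N)%N by apply: ltn_trans N2.
have [srem vrem] := ricc_remP v; have [serr verr] := ricc_errP v.
have sv := vsmooth_cst oV v; have sX := smooth_X.
have sA : sm (fun x => bil (A x) v v) by apply: smooth_bilA.
have sD : sm (fun x => d (X x) (fun y => bil (A y) v v) x) by apply: (smooth_ddZ oV sA).
have sr2 : sm (fun x => rho x ^+ 2) by apply: smoothX.
have tr : tc 1 rho x = pd true ord0 rho x by have := tcS 0 rho x; rewrite mul1r tc0.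
have tr2 : tc 2 (fun y => rho y ^+ 2) x = pd true ord0 rho x ^+ 2.
  by have := tc_lead oV srho srho van_rho van_rho wx; rewrite tr -expr2.
have r0 := rho_d0 N0 wx.
have E := riccati v.
have L : tc m.+1 (fun x => rho x ^+ 2 * d (X x) (fun y => bil (A y) v v) x) x =
   pd true ord0 rho x * tc m (fun x => bil (A x) v v) x.
  rewrite (tc_eq oV m.+1 (g := fun x => (rho x * bil (A x) v v + rho x ^+ 2 * ricc_rem v x) + ricc_err v x) E Vx).
  have s1 := smoothM oV srho sA; have s2 := smoothM oV sr2 srem.
  rewrite (tcD oV m.+1 (smoothD oV s1 s2) serr Vx) (tcD oV m.+1 s1 s2 Vx).
  rewrite [X in _ + X](van_tc (verr N2)) //; last by rewrite -addn2.
  rewrite [X in _ + X + _](van_tc (V := V) (N := m.+2)) //; last first.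
    rewrite -[m.+2]/(2 + m)%N; apply: vanM => //; [exact: van_rho2|exact: vrem].
  rewrite !addr0 -[m.+1]/(1 + m)%N (tc_lead oV) //; first by rewrite tr.
  exact: van_rho.
(* At m = 0 the left side vanishes to order 2 because of rho^2, which leaves d_0 rho times the value
   of A equal to 0. *)
case: m vA m1 mN L => [|m] vA m1 mN L.
  move: L; rewrite (van_tc (vanMr oV sr2 sD van_rho2)) // => /esym/eqP.
  by rewrite mulf_eq0 (negbTE r0) => /eqP.
have vm := vA v v.
move: L; rewrite -[m.+2]/(2 + m)%N (tc_lead oV) //; [|exact: van_rho2|exact: (van_ddZ oV)].
rewrite tr2 (tc_ddZ oV) // expr2 -mulrA => /(mulfI r0).
rewrite mulrA (mulrC _ (X x 0 ord0)) rho_X // mul1r => /eqP.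
rewrite -subr_eq0 -[X in _ - X]mul1r -mulrBl mulf_eq0 => /orP[|/eqP//].
by rewrite -natr1 addrK pnatr_eq0 => /eqP m0; rewrite m0 in m1.
Qed.

End HyperbolicDefining.

(** * Kulkarni-Nomizu products with a metric *)

Section LinearAlgebra.
Context {R : realType}.

Lemma sym_form_eq0 p (M : 'M[R]_p) : M^T = M -> (forall v, bil M v v = 0) -> M = 0.
Proof.
move=> Ms H; apply/matrixP => i j; rewrite -bil_delta !mxE.
set u := delta_mx 0 i; set w := delta_mx 0 j.
have := H (u + w); rewrite !(bilDl, bilDr) !H (bilC w u Ms) add0r addr0.
by rewrite -mulr2n => /eqP; rewrite mulrn_eq0 => /eqP.
Qed.

Lemma row_gram_trace p (h : 'M[R]_p) (a c : 'rV[R]_p) :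
  \tr (invmx h *m (a^T *m c)) = (c *m invmx h *m a^T) 0 0.
Proof.
by rewrite mulmxA mxtrace_mulC mulmxA /mxtrace big_ord_recl big_ord0 addr0.
Qed.

(** The hypothesis says that the Kulkarni-Nomizu product of S and h vanishes on (u, v, v, u). Its
    trace in v is (p - 2) S + tau h, with tau the trace of S; a second trace gives (2p - 2) tau = 0,
    and then p > 2 gives S = 0. *)
Lemma kulkarni_nomizu_inj p (h S : 'M[R]_p) : h^T = h -> S^T = S -> h \in unitmx -> (3 <= p)%N ->
  (forall u v, bil S u u * bil h v v + bil S v v * bil h u u - 2 * bil S u v * bil h u v = 0) ->
  S = 0.
Proof.
move=> hs Ss hu p3 H; pose tau := \tr (invmx h *m S).
have H1 u : (p%:R - 2) * bil S u u + tau * bil h u u = 0.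
  (* The symmetric form in v whose quadratic values are the hypothesis for the fixed u; polarization
     allows its trace to be taken. *)
  pose M := bil S u u *: h + bil h u u *: S - ((u *m S)^T *m (u *m h) + (u *m h)^T *m (u *m S)).
  have B (a c : 'rV[R]_p) v : bil (a^T *m c) v v = (a *m v^T) 0 0 * (c *m v^T) 0 0.
    rewrite bil_def mulmxA -mulmxA [LHS]mxE big_ord_recl big_ord0 addr0; congr (_ * _).
    by rewrite -[v *m a^T]trmxK mxE trmx_mul trmxK.
  have M0 : M = 0.
    apply: sym_form_eq0.
      have tD (P Q : 'M[R]_p) : (P + Q)^T = P^T + Q^T by rewrite linearD.
      have tN (P : 'M[R]_p) : (- P)^T = - P^T by rewrite linearN.
      have tZ c (P : 'M[R]_p) : (c *: P)^T = c *: P^T by rewrite linearZ.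
      rewrite /M !(tD, tN, tZ) hs Ss [((u *m S)^T *m _)^T]trmx_mul.
      by rewrite [((u *m h)^T *m _)^T]trmx_mul !trmxK [X in _ + _ - X]addrC.
    move=> v; rewrite /M !bilMD !bilMN !bilMD !bilMZ !B -!bil_def.
    by rewrite -[RHS](H u v); gen_atoms; ring.
  have : \tr (invmx h *m M) = 0 by rewrite M0 mulmx0 mxtrace0.
  rewrite /M mulmxBr !mulmxDr -!scalemxAr mulVmx // raddfB /= !mxtraceD !mxtraceZ mxtrace1.
  rewrite !row_gram_trace -/tau.
  have -> : (u *m h *m invmx h *m (u *m S)^T) 0 0 = bil S u u.
    by rewrite mulmxK // trmx_mul Ss mulmxA -bil_def.
  have -> : (u *m S *m invmx h *m (u *m h)^T) 0 0 = bil S u u.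
    by rewrite trmx_mul hs mulmxA mulmxKV // -bil_def.
  by move=> E; rewrite -[RHS]E; gen_atoms; ring.
have M0 : (p%:R - 2) *: S + tau *: h = 0.
  apply: sym_form_eq0; first by rewrite linearD /= !linearZ /= hs Ss.
  by move=> v; rewrite bilMD !bilMZ.
have p2 : p%:R - 2 != 0 :> R.
  by rewrite subr_eq0 eqr_nat; apply: contraTneq p3 => ->.
have t0 : tau = 0.
  have : \tr (invmx h *m ((p%:R - 2) *: S + tau *: h)) = 0 by rewrite M0 mulmx0 mxtrace0.
  rewrite mulmxDr -!scalemxAr mulVmx // mxtraceD !mxtraceZ mxtrace1 -/tau => E.
  have : (p%:R - 1) * tau = 0 by lra.
  move/eqP; rewrite mulf_eq0 subr_eq0 (eqr_nat _ p 1) => /orP[/eqP p1|/eqP//].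
  by rewrite p1 in p3.
move/eqP: M0; rewrite t0 scale0r addr0 scaler_eq0 (negbTE p2) => /eqP //.
Qed.

End LinearAlgebra.

(** * Geometry of the wall: second fundamental form, curvature, Laplacian *)

Section Boundary.
Context {R : realType}.
Variables (k : nat) (V : set 'rV[R]_k.+1) (g : 'rV[R]_k.+1 -> 'M[R]_k.+1).
Variable rho : 'rV[R]_k.+1 -> R.
Hypotheses (oV : relopen true V) (mg : metric_on true V g).
Hypotheses (srho : smooth_on true V rho) (rho0 : forall x, wall V x -> rho x = 0).
Hypothesis rhop : forall x, V x -> 0 < x 0 ord0 -> 0 < rho x.
Variable hp : 'rV[R]_k.+1 -> 'M[R]_k.+1.
Hypothesis hpE : forall x, V x -> 0 < x 0 ord0 -> hp x = (rho x ^+ 2)^-1 *: g x.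
Hypothesis hyp : forall x, V x -> 0 < x 0 ord0 -> sectional_curvature_eq true hp (-1) x.
Variable N : nat.
Hypotheses (N3 : (3 <= N)%N) (ve : van V N (eik g rho)).

Variables (W : set 'rV[R]_k) (h : 'rV[R]_k -> 'M[R]_k) (j : 'rV[R]_k -> 'rV[R]_k.+1).
Hypotheses (oW : relopen false W) (mh : metric_on false W h) (sj : vsmooth false W j).
Hypotheses (jW : forall y, W y -> wall V (j y)) (jsurj : forall x, wall V x -> exists2 y, W y & j y = x).
Hypothesis iso : forall y a c, W y ->
  bil (h y) a c = bil (g (j y)) (vd false a j y) (vd false c j y).
Hypothesis flat : forall y u v w, W y -> Rm false h y u v w = 0.
Hypothesis k3 : (3 <= k)%N.

Local Notation X := (gr true g rho).
Local Notation A := (Hm true g rho).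
Local Notation d := (dd true).
Local Notation J := (vd false).

Let WV y : W y -> V (j y). Proof. by move=> /jW[]. Qed.
Let N0 : (0 < N)%N. Proof. exact: leq_trans N3. Qed.

Lemma vd_j0 u y : W y -> (J u j y) 0 ord0 = 0.
Proof.
move=> Wy; rewrite vdjE (dd_eq oW u (g := fun=> 0) Wy) ?(dd_cst oW) //.
by move=> z /jW[].
Qed.

Lemma rho_j u y : W y -> d (J u j y) rho (j y) = 0.
Proof.
move=> Wy; rewrite -(dd_comp oV oW WV sj u srho Wy).
rewrite (dd_eq oW u (g := fun=> 0) Wy) ?(dd_cst oW) //.
by move=> z /jW; exact: rho0.
Qed.

Lemma jac_free u y : W y -> J u j y = 0 -> u = 0.
Proof.
move=> Wy ju; apply/eqP; apply: contraTT isT => u0.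
have [_ _ /(_ y Wy u u0)] := mh.
by rewrite iso // ju bil0l ltxx.
Qed.

Definition frame y : 'M[R]_(1 + k, 1 + k) := col_mx (X (j y)) (jac false j y).

(** X is transversal to the wall, since X^0 d_0 rho = 1, and the differential of j is injective
    because h is positive. *)
Lemma frame_unit y : W y -> frame y \in unitmx.
Proof.
move=> Wy; rewrite -row_free_unit; apply: inj_row_free => w.
rewrite -[w]hsubmxK /frame mul_row_col; set a := lsubmx w; set u := rsubmx w.
rewrite -vd_jac [a]mx11_scalar mul_scalar_mx => E.
have a0 : a 0 0 = 0.
  move/rowP/(_ ord0): (E); rewrite rowD rowZ vd_j0 // addr0 [RHS]mxE => /eqP.
  rewrite mulf_eq0 => /orP[/eqP//|/eqP x0].
  have := rho_X oV srho rho0 ve N0 (jW Wy).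
  by rewrite x0 mul0r => /eqP; rewrite eq_sym oner_eq0.
move: E; rewrite a0 scale0r add0r => /(jac_free Wy) ->.
by rewrite raddf0 row_mx0.
Qed.

Lemma frame_span y z : W y -> exists a u, z = a *: X (j y) + J u j y.
Proof.
move=> Wy; pose w := z *m invmx (frame y) : 'rV[R]_(1 + k).
exists (lsubmx w 0 0), (rsubmx w).
rewrite vd_jac -mul_scalar_mx -mx11_scalar -mul_row_col hsubmxK.
by rewrite /w mulmxKV // frame_unit.
Qed.

Lemma A_wall x u v : wall V x -> bil (A x) u v = 0.
Proof.
move=> wx; have [Vx _] := wx.
have vA : vanA V g rho 1.
  by apply: (vanA_step oV mg srho rho0 rhop hpE hyp ve) => //; apply: leq_trans N3.
exact: (vA u v x wx 0%N).
Qed.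

(** Tested on the frame: against tangent vectors this is the Gauss formula; against X both sides
    vanish, because rho is 0 along j and its Hessian A is 0 on the wall. *)
Lemma boundary_tg u v y : W y ->
  covphi true false g j u (J v j) y = J (Gam false h y u v) j y.
Proof.
move=> Wy; have Vy := WV Wy; apply: (metric_nondeg mg Vy) => w.
have [a [c ->]] := frame_span w Wy.
rewrite !bilDr !bilZr (gauss_formula oV oW WV sj mg mh u v c iso Wy).
rewrite -(iso (Gam false h y u v) c Wy); congr (_ * _ + _).
rewrite !(inner_sym mg _ (X _) Vy) !(gr_inner mg _ _ Vy) rho_j //.
have := hess_comp g oV oW WV sj u v srho Wy; rewrite (A_wall _ _ (jW Wy)) add0r => <-.
have z y' : W y' -> dd false v (fun y => rho (j y)) y' = 0.
  by move=> Wy'; rewrite (dd_comp oV oW WV sj v srho Wy') rho_j.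
by rewrite (dd_eq oW u (g := fun=> 0) Wy z) (dd_cst oW).
Qed.

Lemma K_tangent u v y : W y -> K g (j y) (J u j y) (J v j y) = 0.
Proof.
move=> Wy; rewrite /K.
have <- := gauss_totally_geodesic oV oW WV sj mg mh boundary_tg u v v Wy.
by rewrite flat // vd_jac mul0mx bil0l.
Qed.

(** The coefficient of x_0 in A, which [vanA_step] leaves undetermined. *)
Let T x : 'M[R]_k.+1 := \matrix_(a, c) tc 1 (fun y => A y a c) x.

Let vA1 : vanA V g rho 1.
Proof. by move=> u v x wx [|i] // _; apply: A_wall. Qed.

(** The arguments may vary with the point: their derivatives are multiplied by A, which is 0 on the
    wall. *)
Lemma bil_tcA x (Z Y : 'rV[R]_k.+1 -> 'rV[R]_k.+1) : wall V x -> vsmooth true V Z -> vsmooth true V Y ->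
  tc 1 (fun y => bil (A y) (Z y) (Y y)) x = bil (T x) (Z x) (Y x).
Proof.
move=> wx sZ sY; have [Vx _] := wx.
have sA := smooth_A oV mg srho.
have tE f : tc 1 f x = pd true ord0 f x.
  by have := @tcS R k 0 f x; rewrite mul1r tc0.
rewrite tE -dd_delta (dd_bil oV _ sA sZ sY Vx).
rewrite (A_wall (vd true _ Z x) (Y x) wx) (A_wall (Z x) (vd true _ Y x) wx) !addr0.
by congr (bil _ _ _); apply/matrixP => a c; rewrite mdE mxE tE dd_delta.
Qed.

(** Components along X vanish by [A_X], as [eik] has order at least 3. For tangent vectors, compare
    the coefficients of x_0^2 in [curvature_identity]: the left one is the sectional numerator of
    the wall, 0 by the Gauss equation, and the right one is a nonzero multiple of the
    Kulkarni-Nomizu product of T with h. *)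
Lemma T_zero y : W y -> T (j y) = 0.
Proof.
move=> Wy; have wx := jW Wy; have [Vx _] := wx.
have sX := smooth_X oV mg srho; have sc u := vsmooth_cst oV (u : 'rV[R]_k.+1).
have sA u v : smooth_on true V (fun y => bil (A y) u v).
  by apply: (smooth_bilA oV mg srho).
have sg u v : smooth_on true V (fun y => bil (g y) u v).
  by apply: (smooth_bilg oV mg).
have se := smooth_eik oV mg srho.
have Ts : (T (j y))^T = T (j y).
  apply/matrixP => a c; rewrite !mxE; apply: (tc_eq oV) => // z Vz.
  by rewrite -!bil_delta (A_sym oV mg srho).
have TX z : bil (T (j y)) (X (j y)) z = 0.
  rewrite -(bil_tcA wx sX (sc z)) (tc_eq oV 1 (g := fun y => 2^-1 * d z (eik g rho) y)) //; last first.
    by move=> y' Vy'; rewrite (A_X oV mg srho).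
  have v2 : van V 2 (d z (eik g rho)).
    by apply: (van_dd oV) => //; apply: vanW ve.
  apply: (van_tc (V := V) (N := 2)) => //; apply: (vanMl oV) => //; first exact: smooth_cst.
  exact: (smooth_dd oV).
have TJ u v : bil (T (j y)) (J u j y) (J v j y) = 0.
  pose JJ := jac false j y.
  have hE : h y = JJ *m g (j y) *m JJ^T.
    by apply: mx_bil_eq => a c; rewrite iso // bil_mulmx !vd_jac.
  suff S0 : JJ *m T (j y) *m JJ^T = 0.
    by rewrite !vd_jac -bil_mulmx S0 bil_def mulmx0 mul0mx mxE.
  have [_ hs _] := mh.
  apply: (kulkarni_nomizu_inj (h := h y) (hs y Wy)) => //.
  - by rewrite !trmx_mul trmxK Ts mulmxA.
  - exact: (metric_unit mh).
  move=> a c; rewrite !hE !bil_mulmx -!vd_jac.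
  set u' := J a j y; set v' := J c j y.
  have KE := curvature_identity oV mg srho rhop hpE hyp u' v'.
  have sK : smooth_on true V (fun x => K g x u' v') by apply: (smooth_K oV mg).
  have t2 := tc_eq oV 2 KE Vx; move: t2.
  have vr := van_rho rho0.
  have sr2 : smooth_on true V (fun x => rho x ^+ 2) by apply: smoothX.
  have s1 := smoothD oV (smoothM oV (sA u' u') (sg v' v')) (smoothM oV (sA v' v') (sg u' u')).
  have s2 : smooth_on true V (fun x => 2 * bil (A x) u' v' * bil (g x) u' v').
    by apply: smoothM => //; apply: smoothM => //; apply: smooth_cst.
  have s3 := smoothB oV s1 s2; have sn := smoothN oV srho.
  have s4 : smooth_on true V (fun x => bil (g x) u' u' * bil (g x) v' v' - bil (g x) u' v' ^+ 2).
    by apply: smoothB => //; [apply: smoothM|apply: smoothX].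
  rewrite (tcD oV 2 (smoothM oV sn s3) (smoothM oV se s4) Vx).
  (* Order 2 lies below the order of [eik]; this is where N >= 3 enters. *)
  rewrite [X in _ = _ + X](van_tc (vanMr oV se s4 ve)) // addr0.
  have -> : tc 2 (fun x => rho x ^+ 2 * K g x u' v') (j y) = 0.
    have := tc_lead oV (M := 2) (N := 0) sr2 sK (van_rho2 oV srho rho0) (@van0 _ _ _ _) wx.
    by rewrite addn0 => ->; rewrite tc0 K_tangent // mulr0.
  have v3 : van V 1 (fun x => bil (A x) u' u' * bil (g x) v' v' + bil (A x) v' v' * bil (g x) u' u'
      - 2 * bil (A x) u' v' * bil (g x) u' v').
    move=> x wx' [|i] // _ /=; rewrite !A_wall //; gen_atoms; ring.
  rewrite -[2%N]/(1 + 1)%N (tc_lead oV sn s3 _ v3 wx); last exact: vanN.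
  have tn : tc 1 (fun x => - rho x) (j y) != 0.
    have := @tcS R k 0 (fun x => - rho x) (j y); rewrite mul1r tc0 => ->.
    rewrite -dd_delta (ddN oV _ srho Vx) dd_delta oppr_eq0.
    exact: (rho_d0 oV srho rho0 ve N0 wx).
  move/esym/eqP; rewrite mulf_eq0 (negbTE tn) /= => /eqP.
  rewrite (tcD oV 1 s1 (smoothN oV s2) Vx) (tcD oV 1 (smoothM oV (sA u' u') (sg v' v'))
     (smoothM oV (sA v' v') (sg u' u')) Vx).
  have tA a' c' e f : tc 1 (fun x => bil (A x) a' c' * bil (g x) e f) (j y) =
      bil (T (j y)) a' c' * bil (g (j y)) e f.
    have := tc_lead oV (M := 1) (N := 0) (sA a' c') (sg e f) (vA1 a' c') (@van0 _ _ _ _) wx.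
    by rewrite addn0 => ->; rewrite tc0 (bil_tcA wx (sc a') (sc c')).
  rewrite !tA.
  have -> : tc 1 (fun y0 => - (2 * bil (A y0) u' v' * bil (g y0) u' v')) (j y) =
     - (2 * bil (T (j y)) u' v' * bil (g (j y)) u' v').
    rewrite (tc_eq oV 1 (g := fun y0 => -2 * (bil (A y0) u' v' * bil (g y0) u' v'))) //; last first.
      by move=> y' _; gen_atoms; ring.
    have := tc_lead oV (M := 0) (N := 1) (smooth_cst oV (-2)) (smoothM oV (sA u' v') (sg u' v'))
      (@van0 _ _ _ _) (vanMr oV (sA u' v') (sg u' v') (vA1 u' v')) wx.
    by rewrite add0n => ->; rewrite tc0 tA; gen_atoms; ring.
  by [].
apply: mx_bil_eq => u v; rewrite [RHS]bil_def mulmx0 mul0mx mxE.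
have [a [c ->]] := frame_span u Wy; have [a' [c' ->]] := frame_span v Wy.
rewrite !(bilDl, bilDr, bilZl, bilZr) !TX TJ (bilC _ (X (j y)) Ts) TX.
by rewrite !(mulr0, addr0).
Qed.

Lemma vanA2 : vanA V g rho 2.
Proof.
move=> u v; apply: (van_tcS (vA1 u v)) => x wx.
have [y Wy <-] := jsurj wx.
rewrite (bil_tcA (jW Wy) (vsmooth_cst oV u) (vsmooth_cst oV v)) T_zero //.
by rewrite bil_def mulmx0 mul0mx mxE.
Qed.

(** [vanA_step] gives each order from the preceding one, except the passage from 1 to 2, which is
    [vanA2]. *)
Lemma vanA_all m : (m <= N.-1)%N -> vanA V g rho m.
Proof.
elim: m => [|m IH] mN; first by move=> u v x wx.
have [->|m1] := eqVneq m 1%N; first exact: vanA2.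
apply: (vanA_step oV mg srho rho0 rhop hpE hyp ve) => //.
  by apply: IH; apply: ltnW.
by move: mN N0; case: N => // n /=; rewrite addn2.
Qed.

(** Along the wall X is a unit normal, so in the frame made of X and the differential of j the
    metric is block diagonal with blocks 1 and h. *)
Lemma inv_metric_wall y : W y -> invmx (g (j y)) =
  (X (j y))^T *m X (j y) + (jac false j y)^T *m invmx (h y) *m jac false j y.
Proof.
move=> Wy; have wx := jW Wy; have [Vx _] := wx.
set Q := (X in _ = X); pose JJ := jac false j y; set G := g (j y).
have Gu : G \in unitmx by exact: (metric_unit mg).
have [_ gs _] := mg; have [_ hs _] := mh.
have hE : h y = JJ *m G *m JJ^T.
  by apply: mx_bil_eq => a c; rewrite iso // bil_mulmx !vd_jac.
have XX : X (j y) *m G *m (X (j y))^T = 1%:M.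
  rewrite [LHS]mx11_scalar -bil_def (gr_inner mg _ _ Vx).
  have := ve wx N0; rewrite /= /eik => /eqP; rewrite subr_eq0 => /eqP ->.
  by [].
have JX : JJ *m G *m (X (j y))^T = 0.
  apply/colP => i; rewrite [RHS]mxE.
  have := rho_j (delta_mx 0 i) Wy; rewrite -(gr_inner mg _ _ Vx) (inner_sym mg _ _ Vx).
  by rewrite vd_jac bil_def -!mulmxA -rowE mxE mulmxA => <-.
have XJ : X (j y) *m G *m JJ^T = 0.
  have Gs : G^T = G by exact: gs.
  by have := congr1 trmx JX; rewrite trmx0 trmx_mul trmxK trmx_mul Gs mulmxA.
have PQ : frame y *m (G *m Q) = frame y.
  rewrite /frame mul_col_mx !mulmxA; congr col_mx.
    rewrite mulmxDr !mulmxA XX mul1mx.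
    by rewrite -/JJ XJ !mul0mx addr0.
  rewrite mulmxDr !mulmxA -/JJ JX.
  rewrite !mul0mx add0r -hE.
  by rewrite mulmxV ?mul1mx // (metric_unit mh).
have GQ : G *m Q = 1%:M.
  have fu := frame_unit Wy.
  by rewrite -[LHS](mulKmx fu) PQ mulVmx.
by rewrite -[LHS]mulmx1 -GQ mulKmx.
Qed.

(** The trace splits along [inv_metric_wall]. No mean curvature appears because the wall is totally
    geodesic, and the normal part is X(X f) because nabla_X X = A X vanishes there. *)
Lemma laplacian_wall f y : smooth_on true V f -> W y ->
  laplacian true g f (j y) =
  d (X (j y)) (fun z => d (X z) f z) (j y) + laplacian false h (fun z => f (j z)) y.
Proof.
move=> sf Wy; have wx := jW Wy; have [Vx _] := wx.
have sX := smooth_X oV mg srho.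
rewrite (lap_tr2 mg f Vx) (lap_tr2 mh _ Wy) /tr2 inv_metric_wall //.
set H := Hm true g f (j y); pose JJ := jac false j y.
rewrite mulmxDl mxtraceD; congr (_ + _).
  rewrite -mulmxA mxtrace_mulC /mxtrace big_ord_recl big_ord0 addr0 -bil_def.
  rewrite (dd_ddZ oV _ sf sX Vx) /H (bil_Hm g oV _ _ sf Vx).
  have -> : vd true (X (j y)) X (j y) = - Gam true g (j y) (X (j y)) (X (j y)).
    apply/eqP; rewrite -addr_eq0 -/(cov true g (X (j y)) X (j y)); apply/eqP.
    apply: (metric_nondeg mg Vx) => w.
    by rewrite (gr_cov oV mg _ _ srho Vx) A_wall // bil0l.
  by rewrite ddvN addrC.
rewrite -!mulmxA mxtrace_mulC -!mulmxA; congr (\tr (_ *m _)).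
apply: mx_bil_eq => u v; rewrite mulmxA bil_mulmx -!vd_jac.
have sfj := smooth_comp oV oW WV sj sf.
rewrite (bil_Hm h oW _ _ sfj Wy) (hess_comp g oV oW WV sj u v sf Wy) -/H boundary_tg //.
by rewrite (dd_comp oV oW WV sj _ sf Wy) addrK.
Qed.

End Boundary.

(** * Commutator of the normal derivative and the Laplacian *)

Section LieDerivative.
Context {R : realType}.
Variables (b : bool) (n : nat) (V : set 'rV[R]_n) (g : 'rV[R]_n -> 'M[R]_n).
Variable X : 'rV[R]_n -> 'rV[R]_n.
Hypotheses (oV : relopen b V) (mg : metric_on b V g) (sX : vsmooth b V X).

Local Notation d := (dd b).
Local Notation J := (vd b).
Local Notation Gm := (Gam b g).

(** The Lie derivative of g along X, evaluated on constant vectors. *)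
Definition lieg v w y := bil (g y) (cov b g v X y) w + bil (g y) v (cov b g w X y).

(* The Lie derivative of the Christoffel symbols along X. *)
Definition lieGam (u v : 'rV[R]_n) x : 'rV[R]_n :=
  J (X x) (fun y => Gm y u v) x - J (Gm x u v) X x
  + Gm x (J u X x) v + Gm x u (J v X x) + J u (J v X) x.

Let sg : msmooth b V g. Proof. by case: mg. Qed.
Let sc (v : 'rV[R]_n) : vsmooth b V (fun=> v). Proof. exact: vsmooth_cst. Qed.
Let sbg Z W : vsmooth b V Z -> vsmooth b V W -> smooth_on b V (fun y => bil (g y) (Z y) (W y)).
Proof. exact: smooth_bil. Qed.
Let sJ u : vsmooth b V (J u X).
Proof. by move=> j; rewrite vdE; apply: (smooth_dd oV). Qed.

Lemma smooth_covX v : vsmooth b V (cov b g v X).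
Proof.
move=> j; apply: (smooth_eq oV (f := fun y => J v X y 0 j + Gm y v (X y) 0 j)).
  by move=> y _; rewrite /cov rowD.
by apply: smoothD => //; [exact: sJ|apply: (smooth_Gam oV mg)].
Qed.

Lemma smooth_lieg v w : smooth_on b V (lieg v w).
Proof. by apply: smoothD => //; apply: sbg => //; exact: smooth_covX. Qed.

Lemma dd_X_dd u f x : smooth_on b V f -> V x ->
  d (X x) (d u f) x = d u (fun y => d (X y) f y) x - d (J u X x) f x.
Proof.
move=> sf Vx; rewrite (dd_ddZ oV u sf sX Vx) (ddC oV u (X x) sf Vx); gen_atoms; ring.
Qed.

Lemma lie_bil v w y : V y ->
  d (X y) (fun z => bil (g z) v w) y = lieg v w y - bil (g y) (J v X y) w - bil (g y) v (J w X y).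
Proof.
move=> Vy; rewrite (metric_compat oV mg _ _ _ Vy) /lieg /cov bilDl bilDr.
rewrite (GamC oV mg v (X y) Vy) (GamC oV mg w (X y) Vy); gen_atoms; ring.
Qed.

Lemma vdCX u v x : V x -> J u (J v X) x = J v (J u X) x.
Proof.
move=> Vx; apply/rowP => j; rewrite !vdjE !vdE; exact: (ddC oV u v (sX j) Vx).
Qed.

Lemma dXdg u v w x : V x ->
  d (X x) (d u (fun z => bil (g z) v w)) x = d u (lieg v w) x
   - (bil (g x) (J u (J v X) x + Gm x u (J v X x)) w + bil (g x) (J v X x) (Gm x u w))
   - (bil (g x) (Gm x u v) (J w X x) + bil (g x) v (J u (J w X) x + Gm x u (J w X x)))
   - (bil (g x) (Gm x (J u X x) v) w + bil (g x) v (Gm x (J u X x) w)).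
Proof.
move=> Vx; have s1 := sbg (sc v) (sc w).
rewrite (dd_X_dd _ s1 Vx) (metric_compat oV mg (J u X x) v w Vx).
rewrite (dd_eq oV u (g := fun y => (lieg v w y - bil (g y) (J v X y) w) - bil (g y) v (J w X y)) Vx);
  last by move=> y Vy; rewrite lie_bil.
have s2 := sbg (sJ v) (sc w); have s3 := sbg (sc v) (sJ w).
rewrite (ddB oV u (smoothB oV (smooth_lieg v w) s2) s3 Vx) (ddB oV u (smooth_lieg v w) s2 Vx).
rewrite (dd_inner oV mg u (sJ v) (sc w) Vx) (dd_inner oV mg u (sc v) (sJ w) Vx) /cov.
by rewrite !(vd_cst oV) // !add0r.
Qed.

(** The Lie derivative along X of Koszul's formula: the variation of the connection is a first order
    expression in the Lie derivative of g. *)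
Lemma lie_christoffel u v w x : V x ->
  bil (g x) (lieGam u v x) w =
  2^-1 * (d u (lieg v w) x + d v (lieg u w) x - d w (lieg u v) x) - lieg (Gm x u v) w x.
Proof.
move=> Vx; have sG := smooth_Gam oV mg (sc u) (sc v).
have sd a c e : smooth_on b V (d a (fun z => bil (g z) c e)) by apply: (smooth_dd oV); apply: sbg.
have E : d (X x) (fun y => bil (g y) (Gm y u v) w) x = 2^-1 * (d (X x) (d u (fun z => bil (g z) v w)) x
   + d (X x) (d v (fun z => bil (g z) u w)) x - d (X x) (d w (fun z => bil (g z) u v)) x).
  rewrite (dd_eq oV _ (g := fun y => 2^-1 * (d u (fun z => bil (g z) v w) y
   + d v (fun z => bil (g z) u w) y - d w (fun z => bil (g z) u v) y)) Vx);
   last by move=> y Vy; rewrite (koszul oV mg).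
  have s1 := smoothD oV (sd u v w) (sd v u w).
  rewrite (ddZ oV _ _ (smoothB oV s1 (sd w u v)) Vx) (ddB oV _ s1 (sd w u v) Vx).
  by rewrite (ddD oV _ (sd u v w) (sd v u w) Vx).
move: E; rewrite (dd_inner oV mg _ sG (sc w) Vx) !dXdg // /cov (vd_cst oV) // add0r.
rewrite (vdCX v u) // (vdCX w u) // (vdCX w v) //.
rewrite /lieGam /lieg /cov.
rewrite (GamC oV mg (Gm x u v) (X x) Vx) (GamC oV mg w (X x) Vx).
rewrite (GamC oV mg v u Vx) (GamC oV mg w u Vx) (GamC oV mg w v Vx).
rewrite (GamC oV mg v (J u X x) Vx) (GamC oV mg (J v X x) u Vx) (GamC oV mg w (J u X x) Vx).
rewrite (GamC oV mg (J w X x) u Vx) (GamC oV mg (J w X x) v Vx) (GamC oV mg w (J v X x) Vx).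
rewrite !(bilDl, bilNl, bilDr).
rewrite (inner_sym mg v (J u _ x) Vx) (inner_sym mg u (J v _ x) Vx).
rewrite (inner_sym mg (J v X x) _ Vx) (inner_sym mg (J u X x) (Gm x v w) Vx).
rewrite (inner_sym mg v (Gm x u (J w X x)) Vx) (inner_sym mg u (Gm x v (J w X x)) Vx).
rewrite (inner_sym mg v (Gm x (J u X x) w) Vx) (inner_sym mg u (Gm x (J v X x) w) Vx).
gen_atoms => E; lra.
Qed.

Lemma smooth_lieGam u v : vsmooth b V (lieGam u v).
Proof.
have sG := smooth_Gam oV mg (sc u) (sc v).
have sJX u' (Z : 'rV[R]_n -> 'rV[R]_n) : vsmooth b V Z -> vsmooth b V (J u' Z).
  by move=> sZ j; rewrite vdE; apply: (smooth_dd oV).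
have sJZ (Y Z : 'rV[R]_n -> 'rV[R]_n) : vsmooth b V Z -> vsmooth b V Y -> vsmooth b V (fun y => J (Y y) Z y).
  move=> sZ sY j; apply: (smooth_eq oV (f := fun y => d (Y y) (fun z => Z z 0 j) y)).
    by move=> y _; rewrite vdjE.
  exact: (smooth_ddZ oV (sZ j) sY).
have s1 := sJZ _ _ sG sX; have s2 := sJZ _ _ sX sG.
have s3 := smooth_Gam oV mg (sJ u) (sc v); have s4 := smooth_Gam oV mg (sc u) (sJ v).
have s5 := sJX u _ (sJ v).
move=> j; apply: (smooth_eq oV (f := fun x => J (X x) (fun y => Gm y u v) x 0 j
  - J (Gm x u v) X x 0 j + Gm x (J u X x) v 0 j + Gm x u (J v X x) 0 j + J u (J v X) x 0 j)).
  by move=> y _; rewrite /lieGam !(rowD, rowN).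
by do 3 (apply: smoothD => //); apply: smoothB.
Qed.

Definition Dop f x := d (X x) f x.

Lemma smooth_Dop f : smooth_on b V f -> smooth_on b V (Dop f).
Proof. by move=> sf; apply: (smooth_ddZ oV sf sX). Qed.

(** Invariantly, L_X (Hess f) = Hess (X f) - df(L_X Gamma). The last two terms come from the
    brackets of X with the constant vectors u and v. *)
Lemma dXHm f u v x : smooth_on b V f -> V x ->
  d (X x) (fun y => bil (Hm b g f y) u v) x = bil (Hm b g (Dop f) x) u v
  - d (lieGam u v x) f x - bil (Hm b g f x) (J u X x) v - bil (Hm b g f x) u (J v X x).
Proof.
move=> sf Vx; have sD := smooth_Dop sf.
have sdd a := smooth_dd oV a sf.
rewrite (dd_Hm oV mg _ _ _ sf Vx) !(bil_Hm g oV _ _ _ Vx) //.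
have E a y : V y -> d a (Dop f) y = d (J a X y) f y + d (X y) (d a f) y.
  by move=> Vy; rewrite (dd_ddZ oV a sf sX Vy) (ddC oV a _ sf Vy).
rewrite (E (Gm x u v) x Vx).
have s1 := smooth_ddZ oV sf (sJ v); have s2 := smooth_ddZ oV (sdd v) sX.
rewrite (dd_eq oV u (g := fun y => d (J v X y) f y + d (X y) (d v f) y) Vx); last exact: E.
rewrite (ddD oV u s1 s2 Vx) (dd_ddZ oV u sf (sJ v) Vx) (dd_ddZ oV u (sdd v) sX Vx).
rewrite /lieGam !(ddvD, ddvN).
rewrite (ddC oV u (X x) (sdd v) Vx); gen_atoms; ring.
Qed.

Lemma mdM p q r u (P : 'rV[R]_n -> 'M[R]_(p, q)) (Q : 'rV[R]_n -> 'M[R]_(q, r)) x :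
  msmooth b V P -> msmooth b V Q -> V x ->
  md b u (fun y => P y *m Q y) x = md b u P x *m Q x + P x *m md b u Q x.
Proof.
move=> sP sQ Vx; apply/matrixP => i j; rewrite mdE !mxE.
rewrite (dd_eq oV u (g := fun y => \sum_l P y i l * Q y l j) Vx); last by move=> y _; rewrite mxE.
rewrite (dd_sum oV) //; last by move=> l; apply: smoothM.
by rewrite -big_split; apply: eq_bigr => l _; rewrite (ddM oV) // !mdE.
Qed.

Lemma dd_trace p u (P : 'rV[R]_n -> 'M[R]_p) x : msmooth b V P -> V x ->
  d u (fun y => \tr (P y)) x = \tr (md b u P x).
Proof.
by move=> sP Vx; rewrite /mxtrace (dd_sum oV) //; apply: eq_bigr => i _; rewrite mdE.
Qed.

Lemma smooth_mulmx p q r (P : 'rV[R]_n -> 'M[R]_(p, q)) (Q : 'rV[R]_n -> 'M[R]_(q, r)) :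
  msmooth b V P -> msmooth b V Q -> msmooth b V (fun y => P y *m Q y).
Proof.
move=> sP sQ i j; apply: (smooth_eq oV (f := fun y => \sum_l P y i l * Q y l j)).
  by move=> y _; rewrite mxE.
by apply: smooth_sum => // l; apply: smoothM.
Qed.

Definition Lmx y : 'M[R]_n := \matrix_(i, j) lieg (delta_mx 0 i) (delta_mx 0 j) y.
Definition smx f y : 'M[R]_n := \matrix_(i, j) d (lieGam (delta_mx 0 i) (delta_mx 0 j) y) f y.

(** Differentiates the trace of g^-1 Hess f along X. The Lie derivative of g enters through g^-1,
    that of the connection through [dXHm]. *)
Lemma commutator f x : smooth_on b V f -> V x ->
  Dop (laplacian b g f) x - laplacian b g (Dop f) x =
  - \tr (invmx (g x) *m Lmx x *m invmx (g x) *m Hm b g f x) - \tr (invmx (g x) *m smx f x).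
Proof.
move=> sf Vx; pose Gi y := invmx (g y); pose H := Hm b g f; pose P := jac b X x.
have sGi : msmooth b V Gi by exact: (smooth_ginv oV mg).
have sH : msmooth b V H by exact: (smooth_Hm oV mg sf).
have gu := metric_unit mg Vx.
have sP : msmooth b V (jac b X).
  by move=> i j; apply: (smooth_eq oV (f := pd b i (fun y => X y 0 j))) => [y _|]; [rewrite mxE|apply: smooth_pd].
have ent p (A B C : 'M[R]_p) i j : (A - B - C) i j = A i j - B i j - C i j.
  by rewrite !mxE.
have dg : md b (X x) g x = Lmx x - P *m g x - g x *m P^T.
  apply/matrixP => i j; rewrite ent -bil_delta (md_bil oV) // lie_bil // !vd_jac.
  rewrite -[(P *m g x) i j]bil_delta bil_mulmxl -[(g x *m P^T) i j]bil_delta bil_mulmxr.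
  by rewrite [Lmx x i j]mxE.
have dH : md b (X x) H x = Hm b g (Dop f) x - smx f x - P *m H x - H x *m P^T.
  have ent4 p (A B C D : 'M[R]_p) i j : (A - B - C - D) i j = A i j - B i j - C i j - D i j.
    by rewrite !mxE.
  apply/matrixP => i j; rewrite ent4 -bil_delta (md_bil oV) // dXHm // !vd_jac.
  rewrite -[(P *m H x) i j]bil_delta bil_mulmxl -[(H x *m P^T) i j]bil_delta bil_mulmxr.
  by rewrite bil_delta [smx f x i j]mxE.
have dGi : md b (X x) Gi x = - (Gi x *m md b (X x) g x *m Gi x).
  have := mdM (X x) sGi sg Vx.
  have -> : md b (X x) (fun y => Gi y *m g y) x = 0.
    apply/matrixP => i j; rewrite mdE [RHS]mxE.
    rewrite (dd_eq oV _ (g := fun=> (1%:M : 'M[R]_n) i j) Vx) ?(dd_cst oV) // => y Vy.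
    by rewrite mulVmx // (metric_unit mg).
  move=> /esym/eqP; rewrite addr_eq0 => /eqP E.
  by rewrite -mulNmx -E mulmxK.
rewrite {1}/Dop (dd_eq oV _ (g := fun y => \tr (Gi y *m H y)) Vx); last first.
  by move=> y Vy; rewrite (lap_tr2 mg).
rewrite (dd_trace _ (smooth_mulmx sGi sH) Vx) (mdM _ sGi sH Vx) dGi dH dg (lap_tr2 mg _ Vx) /tr2.
rewrite mxtraceD mulNmx raddfN /= !(mulmxBr, mulmxBl) !raddfB /= -/(Gi x) -/(H x).
(* The terms in the Jacobian P of X depend on the coordinates and must cancel: those from g^-1 match
   those from the Hessian under the trace. *)
have E1 : \tr (Gi x *m (P *m g x) *m Gi x *m H x) = \tr (Gi x *m (P *m H x)).
  by rewrite -!mulmxA (mulmxA (g x)) mulmxV // mul1mx.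
have E2 : \tr (Gi x *m (g x *m P^T) *m Gi x *m H x) = \tr (Gi x *m (H x *m P^T)).
  by rewrite mulmxA mulVmx // mul1mx -mulmxA mxtrace_mulC mulmxA.
rewrite E1 E2.
move: (\tr _) (\tr _) (\tr _) (\tr _) (\tr _) => t1 t2 t3 t4 t5; ring.
Qed.

End LieDerivative.

Section CommutatorOrder.
Context {R : realType}.
Variables (k : nat) (V : set 'rV[R]_k.+1) (g : 'rV[R]_k.+1 -> 'M[R]_k.+1).
Variable rho : 'rV[R]_k.+1 -> R.
Hypotheses (oV : relopen true V) (mg : metric_on true V g) (srho : smooth_on true V rho).
Variable m : nat.
Hypothesis vA : vanA V g rho m.+1.

Local Notation X := (gr true g rho).
Let sX : vsmooth true V X. Proof. exact: smooth_X. Qed.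

Definition mvan M p q (B : 'rV[R]_k.+1 -> 'M[R]_(p, q)) := forall i j, van V M (fun y => B y i j).

Lemma mvanMl M p q r (P : 'rV[R]_k.+1 -> 'M[R]_(p, q)) (Q : 'rV[R]_k.+1 -> 'M[R]_(q, r)) :
  msmooth true V P -> msmooth true V Q -> mvan M Q -> mvan M (fun y => P y *m Q y).
Proof.
move=> sP sQ vQ i j; apply: (van_eq oV (f := fun y => \sum_l P y i l * Q y l j)).
  by move=> y _; rewrite mxE.
by apply: van_sum => // l; [apply: smoothM|apply: vanMl].
Qed.

Lemma mvanMr M p q r (P : 'rV[R]_k.+1 -> 'M[R]_(p, q)) (Q : 'rV[R]_k.+1 -> 'M[R]_(q, r)) :
  msmooth true V P -> msmooth true V Q -> mvan M P -> mvan M (fun y => P y *m Q y).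
Proof.
move=> sP sQ vQ i j; apply: (van_eq oV (f := fun y => \sum_l P y i l * Q y l j)).
  by move=> y _; rewrite mxE.
by apply: van_sum => // l; [apply: smoothM|apply: vanMr].
Qed.

(** X is a gradient, so its Lie derivative of the metric is twice the Hessian of rho. *)
Lemma lieg_A u v y : V y -> lieg true g X u v y = 2 * bil (Hm true g rho y) u v.
Proof.
move=> Vy; rewrite /lieg (inner_sym mg u _ Vy) !(gr_cov oV mg _ _ srho Vy).
by rewrite (A_sym oV mg srho v u Vy); gen_atoms; ring.
Qed.

Lemma van_lieg u v : van V m.+1 (lieg true g X u v).
Proof.
apply: (van_eq oV (f := fun y => 2 * bil (Hm true g rho y) u v)) => [y Vy|].
  by rewrite lieg_A.
apply: (vanMl oV) => //; first exact: smooth_cst.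
by apply: (smooth_bilA oV mg srho); apply: vsmooth_cst.
Qed.

(** By [lie_christoffel] one order is lost with respect to A; this is the loss in
    [van_commutator]. *)
Lemma van_lieGam u v : forall j, van V m (fun y => lieGam true g X u v y 0 j).
Proof.
move=> j; have sc (a : 'rV[R]_k.+1) := vsmooth_cst oV a.
have sL := smooth_lieg oV mg sX; have sS := smooth_lieGam oV mg sX u v.
have sd a c e : smooth_on true V (dd true a (lieg true g X c e)) by apply: (smooth_dd oV).
have vd' a c e : van V m (dd true a (lieg true g X c e)) by apply: (van_dd oV) => //; exact: van_lieg.
have sG := smooth_Gam oV mg (sc u) (sc v).
have sA w : smooth_on true V (fun y => bil (Hm true g rho y) (Gam true g y u v) w).
  exact: (smooth_bilA oV mg srho).
have s1 w : smooth_on true V (fun x => dd true u (lieg true g X v w) x + dd true v (lieg true g X u w) x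
   - dd true w (lieg true g X u v) x) by apply: smoothB => //; apply: smoothD.
have vS w : van V m (fun y => bil (g y) (lieGam true g X u v y) w).
  apply: (van_eq oV (f := fun x => 2^-1 * (dd true u (lieg true g X v w) x + dd true v (lieg true g X u w) x
   - dd true w (lieg true g X u v) x) - 2 * bil (Hm true g rho x) (Gam true g x u v) w)) => [y Vy|].
    by rewrite (lie_christoffel oV mg sX) // lieg_A.
  apply: (vanB oV).
  - by apply: smoothM => //; apply: smooth_cst.
  - by apply: smoothM => //; apply: smooth_cst.
  - apply: (vanMl oV) => //; first exact: smooth_cst.
    by apply: (vanB oV) => //; [apply: smoothD|apply: (vanD oV)].
  - apply: (vanMl oV) => //; first exact: smooth_cst.
    by apply: (vanA_bil oV mg srho) => // a c; apply: vanW (vA a c).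
have sGi := smooth_ginv oV mg.
apply: (van_eq oV (f := fun y => \sum_i bil (g y) (lieGam true g X u v y) (delta_mx 0 i) * invmx (g y) i j)).
  move=> y Vy; rewrite -[in RHS](mulmxK (metric_unit mg Vy) (lieGam true g X u v y)) mxE.
  apply: eq_bigr => i _; congr (_ * _).
  by rewrite bil_def trmx_delta -colE mxE.
have sb i : smooth_on true V (fun y => bil (g y) (lieGam true g X u v y) (delta_mx 0 i)).
  exact: (smooth_bilg oV mg).
by apply: van_sum => // i; [apply: smoothM|apply: (vanMr oV)].
Qed.

Lemma van_commutator f : smooth_on true V f ->
  van V m (fun x => Dop true X (laplacian true g f) x - laplacian true g (Dop true X f) x).
Proof.
move=> sf.
have sGi := smooth_ginv oV mg; have sH := smooth_Hm oV mg sf.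
have sL : msmooth true V (Lmx true g X).
  move=> i j; apply: (smooth_eq oV (f := lieg true g X (delta_mx 0 i) (delta_mx 0 j))).
    by move=> y _; rewrite mxE.
  exact: (smooth_lieg oV mg sX).
have vL : mvan m (Lmx true g X).
  move=> i j; apply: (van_eq oV (f := lieg true g X (delta_mx 0 i) (delta_mx 0 j))).
    by move=> y _; rewrite mxE.
  by apply: vanW (van_lieg _ _).
have ss i j : smooth_on true V (fun y => dd true (lieGam true g X (delta_mx 0 i) (delta_mx 0 j) y) f y).
  by apply: (smooth_ddZ oV sf); apply: (smooth_lieGam oV mg sX).
have sS : msmooth true V (smx true g X f).
  by move=> i j; apply: (smooth_eq oV _ (ss i j)) => y _; rewrite mxE.
have vS : mvan m (smx true g X f).
  move=> i j; apply: (van_eq oV (f := fun y => dd true (lieGam true g X (delta_mx 0 i) (delta_mx 0 j) y) f y)).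
    by move=> y _; rewrite mxE.
  apply: (van_eq oV (f := fun y => \sum_l lieGam true g X (delta_mx 0 i) (delta_mx 0 j) y 0 l * pd true l f y)).
    by move=> y _; rewrite ddE.
  have sl l := smooth_lieGam oV mg sX (delta_mx 0 i) (delta_mx 0 j) l.
  have sp l := smooth_pd l sf.
  by apply: van_sum => // l; [apply: smoothM|apply: (vanMr oV) => //; apply: van_lieGam].
have t1 := mvanMr (smooth_mulmx oV (smooth_mulmx oV sGi sL) sGi) sH
  (mvanMr (smooth_mulmx oV sGi sL) sGi (mvanMl sGi sL vL)).
have t2 := mvanMl sGi sS vS.
have u1 := smooth_mulmx oV (smooth_mulmx oV (smooth_mulmx oV sGi sL) sGi) sH.
have u2 := smooth_mulmx oV sGi sS.
apply: (van_eq oV (f := fun x => - (\sum_i (invmx (g x) *m Lmx true g X x *m invmx (g x) *m Hm true g f x) i i)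
   - \sum_i (invmx (g x) *m smx true g X f x) i i)) => [y Vy|].
  by rewrite (commutator oV mg sX sf Vy).
have w1 := smooth_sum oV (index_enum _) (fun i => u1 i i).
have w2 := smooth_sum oV (index_enum _) (fun i => u2 i i).
apply: (vanB oV) => //; first exact: smoothN.
  by apply: (vanN oV) => //; apply: van_sum.
by apply: van_sum.
Qed.

End CommutatorOrder.

(** * The GJMS recursion *)

Section LaplacianIterates.
Context {R : realType}.
Variables (b : bool) (n : nat) (V : set 'rV[R]_n) (g : 'rV[R]_n -> 'M[R]_n).
Hypotheses (oV : relopen b V) (mg : metric_on b V g).

Definition nlap f (x : 'rV[R]_n) : R := - laplacian b g f x.

Lemma smooth_nlap m f : smooth_on b V f -> smooth_on b V (iter m nlap f).
Proof.
by move=> sf; elim: m => // m IH; apply: smoothN => //; apply: (smooth_laplacian oV mg).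
Qed.

Lemma laplacianZ c f x : smooth_on b V f -> V x ->
  laplacian b g (fun y => c * f y) x = c * laplacian b g f x.
Proof.
move=> sf Vx; have sc := smoothM oV (smooth_cst oV c) sf.
rewrite !(lap_tr2 mg _ Vx) -tr2Z; congr (tr2 _ _ _); apply: mx_bil_eq => u v.
rewrite bilMZ !(bil_Hm g oV _ _ _ Vx) //.
rewrite (dd_eq oV u (g := fun y => c * dd b v f y) Vx); last first.
  by move=> y Vy; rewrite (ddZ oV).
by rewrite (ddZ oV _ _ (smooth_dd oV v sf) Vx) (ddZ oV _ _ sf Vx) mulrBr.
Qed.

End LaplacianIterates.

Section Kappa.
Context {R : realType}.
Variable l : nat.

(* The coefficients of the solution F = sum_m kappa_m rho^(2m)/(2m)! (-Lap)^m f. *)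
Definition kappa m : R :=
  (-1) ^+ m * (2 * m)`!%:R / (m`!%:R * 4 ^+ m) * (l - 1 - m)`!%:R / (l - 1)`!%:R.

Lemma fact_neq0 m : m`!%:R != 0 :> R.
Proof. by rewrite pnatr_eq0 -lt0n fact_gt0. Qed.

Lemma kappa0 : kappa 0 = 1.
Proof.
rewrite /kappa muln0 subn0 fact0 !expr0; have := fact_neq0 (l - 1).
by move: ((l - 1)`!%:R) => a f; field.
Qed.

(** The recursion that [iterD_Q] imposes at i = 2(m + 1) when its left side is 0. *)
Lemma kappaS m : (m.+1 < l)%N ->
  2 * (l%:R - m.+1%:R) * kappa m.+1 = - (2 * m + 1)%:R * kappa m.
Proof.
move=> ml; have [p lE] : exists p, l = (m + p + 2)%N.
  by exists (l - (m + 2))%N; lia.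
rewrite /kappa lE.
have -> : (m + p + 2 - 1 - m = p.+1)%N by lia.
have -> : (m + p + 2 - 1 - m.+1 = p)%N by lia.
have -> : (2 * m.+1 = (2 * m).+2)%N by rewrite mulnS add2n.
rewrite !factS !natrM !exprS.
have f1 := fact_neq0 m; have f2 := fact_neq0 (m + p + 2 - 1).
have f3 : 4 ^+ m != 0 :> R by rewrite expf_neq0 // pnatr_eq0.
have f4 : m.+1%:R != 0 :> R by rewrite pnatr_eq0.
have f5 : (m + p + 2)%:R - m.+1%:R = p.+1%:R :> R.
  by rewrite -natrB; [congr (_%:R); lia|lia].
have f6 : (2 * m).+2%:R = 2 * m.+1%:R :> R by rewrite -natrM mulnS add2n.
have f7 : (2 * m).+1%:R = (2 * m + 1)%:R :> R by rewrite addn1.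
rewrite f5 f6 f7.
move: f1 f2 f3 f4.
move: (m`!%:R) ((m + p + 2 - 1)`!%:R) (4 ^+ m) (m.+1%:R) (p.+1%:R) ((2 * m + 1)%:R) (p`!%:R) ((2 * m)`!%:R) ((-1) ^+ m).
move=> a1 a2 a3 a4 a5 a6 a7 a8 a9 n1 n2 n3 n4.
field; rewrite ?n1 ?n2 ?n3 ?n4 //.
Qed.

(** The normalizing constant is made for this: at i = 2l the obstruction is -(2l)(2l - 1)
    kappa_(l-1) times the l-th power of the negative Laplacian, and (2l)! converts this derivative
    into a Taylor coefficient. *)
Lemma kappa_last : (1 <= l)%N ->
  gjms_const l * (- ((2 * l)%:R * (2 * l - 1)%:R) * kappa (l - 1)) = (2 * l)`!%:R.
Proof.
rewrite /kappa /gjms_const; case: l => // p _.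
have -> : (p.+1 - 1 - (p.+1 - 1) = 0)%N by lia.
have -> : (p.+1 - 1 = p)%N by lia.
have -> : (2 * p.+1 - 1 = (2 * p).+1)%N by lia.
have -> : (2 * p.+1 = (2 * p).+2)%N by lia.
rewrite fact0 !factS !natrM exprM -natrX (_ : (2 ^ 2)%:R = 4) //.
have f1 := fact_neq0 p.
have f3 : 4 ^+ p != 0 :> R by rewrite expf_neq0 // pnatr_eq0.
have f4 : (-1) ^+ p * (-1) ^+ p = 1 :> R by rewrite -exprMn mulrNN mulr1 expr1n.
rewrite exprS.
move: f1 f3 f4; move: (p`!%:R) (4 ^+ p) ((2 * p).+2%:R) ((2 * p).+1%:R) ((2 * p)`!%:R) ((-1) ^+ p).
move=> a1 a2 a3 a4 a5 a6 n1 n2 E.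
transitivity ((a6 * a6) * (a3 * (a4 * a5))); last by rewrite E mul1r.
by field; rewrite n1 n2.
Qed.

End Kappa.

Section Recursion.
Context {R : realType}.
Variables (k : nat) (V : set 'rV[R]_k.+1) (g : 'rV[R]_k.+1 -> 'M[R]_k.+1).
Variable rho : 'rV[R]_k.+1 -> R.
Hypotheses (oV : relopen true V) (mg : metric_on true V g).
Hypotheses (srho : smooth_on true V rho) (rho0 : forall x, wall V x -> rho x = 0).
Hypothesis rhop : forall x, V x -> 0 < x 0 ord0 -> 0 < rho x.
Variable hp : 'rV[R]_k.+1 -> 'M[R]_k.+1.
Hypothesis hpE : forall x, V x -> 0 < x 0 ord0 -> hp x = (rho x ^+ 2)^-1 *: g x.
Hypothesis hyp : forall x, V x -> 0 < x 0 ord0 -> sectional_curvature_eq true hp (-1) x.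
Variables N l : nat.
Hypotheses (l1 : (1 <= l)%N) (Nl : (2 * l + 2 <= N)%N) (ve : van V N (eik g rho)).
Variables (W : set 'rV[R]_k) (h : 'rV[R]_k -> 'M[R]_k) (j : 'rV[R]_k -> 'rV[R]_k.+1).
Hypotheses (oW : relopen false W) (mh : metric_on false W h) (sj : vsmooth false W j).
Hypotheses (jW : forall y, W y -> wall V (j y)) (jsurj : forall x, wall V x -> exists2 y, W y & j y = x).
Hypothesis iso : forall y a c, W y ->
  bil (h y) a c = bil (g (j y)) (vd false a j y) (vd false c j y).
Hypothesis flat : forall y u v w, W y -> Rm false h y u v w = 0.
Hypothesis k3 : (3 <= k)%N.
Variable F : 'rV[R]_k.+1 -> R.
Hypothesis sF : smooth_on true V F.

Local Notation X := (gr true g rho).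
Local Notation D := (Dop true X).
Local Notation sm := (smooth_on true V).
Local Notation L := (laplacian true g).
Local Notation Lh := (laplacian false h).

Let N3 : (3 <= N)%N.
Proof. lia. Qed.
Let N0 : (0 < N)%N. Proof. exact: leq_trans N3. Qed.
Let sX : vsmooth true V X. Proof. exact: smooth_X. Qed.
Let WV y : W y -> V (j y). Proof. by move=> /jW[]. Qed.
Let se : sm (eik g rho). Proof. exact: smooth_eik. Qed.

Lemma smooth_iterD i f : sm f -> sm (iter i D f).
Proof. by move=> sf; elim: i => // i IH; apply: smooth_Dop. Qed.

Lemma van_iterD i n f : sm f -> van V (n + i) f -> van V n (iter i D f).
Proof.
move=> sf; elim: i n => [|i IH] n vf; first by rewrite addn0 in vf.
by apply: (van_ddZ oV) => //; [exact: smooth_iterD|apply: IH; rewrite addSn -addnS].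
Qed.

(** On the leading coefficient D acts as X^0 times the normal derivative, by [tc_ddZ]. *)
Lemma iterD_wall n f x : sm f -> van V n f -> wall V x ->
  iter n D f x = X x 0 ord0 ^+ n * iter n (pd true ord0) f x.
Proof.
move=> sf; elim: n f sf => [|n IH] f sf vf wx; first by rewrite mul1r.
have sD : sm (D f) by apply: smooth_Dop.
rewrite iterSr IH //; last exact: (van_ddZ oV).
have tE i f' : iter i (pd true ord0) f' x = tc i f' x * i`!%:R by rewrite /tc divfK // fact_neq0.
rewrite !tE (tc_ddZ oV) // factS natrM exprS; move: (tc _ _ _) => t; ring.
Qed.

Lemma D_eq f f' x : V x -> (forall y, V y -> f y = f' y) -> D f x = D f' x.
Proof. by move=> Vx ff; apply: (dd_eq oV). Qed.

Lemma DD f f' x : sm f -> sm f' -> V x -> D (fun y => f y + f' y) x = D f x + D f' x.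
Proof. by move=> sf sf' Vx; apply: (ddD oV). Qed.

Lemma DM f f' x : sm f -> sm f' -> V x -> D (fun y => f y * f' y) x = D f x * f' x + f x * D f' x.
Proof. by move=> sf sf' Vx; apply: (ddM oV). Qed.

Lemma D_rho x : D rho x = 1 + eik g rho x.
Proof. by rewrite /eik /Dop addrC subrK. Qed.

Lemma iterD_D i f f' x : sm f -> sm f' -> V x ->
  iter i D (fun y => f y + f' y) x = iter i D f x + iter i D f' x.
Proof.
move=> sf sf'; elim: i x => // i IH x Vx; rewrite !iterS (D_eq Vx IH).
by rewrite DD //; apply: smooth_iterD.
Qed.

Lemma iterD_Z i c f x : sm f -> V x -> iter i D (fun y => c * f y) x = c * iter i D f x.
Proof.
move=> sf; elim: i x => // i IH x Vx; rewrite !iterS (D_eq Vx IH).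
by rewrite /Dop (ddZ oV) //; apply: smooth_iterD.
Qed.

(** D rho = 1 + [eik], so D and multiplication by rho commute like d/dt and t, up to an error that
    loses one order with each D. *)
Lemma iterD_rhoM i f : sm f -> (i <= N)%N -> exists2 r, sm r /\ van V (N - i) r &
  forall x, V x -> iter i D (fun y => rho y * f y) x =
    i%:R * iter i.-1 D f x + rho x * iter i D f x + r x.
Proof.
move=> sf; elim: i => [|i IH] iN.
  exists (fun=> 0); first by split; [apply: smooth_cst|apply: (van_cst0 oV)].
  by move=> x Vx; rewrite mul0r add0r addr0.
have [r [sr vr] E] := IH (ltnW iN).
have s1 := smooth_iterD i.-1 sf; have s2 := smooth_iterD i sf.
exists (fun x => eik g rho x * iter i D f x + D r x).
  split; first by apply: smoothD => //; [apply: smoothM|apply: smooth_Dop].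
  apply: (vanD oV); [by apply: smoothM|by apply: smooth_Dop| |].
    by apply: (vanMr oV) => //; apply: vanW ve; rewrite leq_subr.
  by apply: (van_ddZ oV) => //; rewrite subnSK.
move=> x Vx; rewrite iterS (D_eq Vx E).
have s3 := smoothM oV (smooth_cst oV (i%:R : R)) s1; have s4 := smoothM oV srho s2.
rewrite (DD (smoothD oV s3 s4) sr Vx) (DD s3 s4 Vx) (DM srho s2 Vx) D_rho.
have -> : D (fun y => i%:R * iter i.-1 D f y) x = i%:R * iter i D f x.
  by rewrite /Dop (ddZ oV _ _ s1 Vx); case: i {IH iN r sr vr E s1 s2 s3 s4} => [|i]; rewrite ?mul0r.
rewrite -[iter i.+1 D f x]/(D (iter i D f) x) -natr1.
move: (D _ _) (D _ _) (iter i D f x) (eik _ _ _) => a1 a2 a3 a4; ring.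
Qed.

Lemma iterD_rho_wall i f x : sm f -> (i < N)%N -> wall V x ->
  iter i D (fun y => rho y * f y) x = i%:R * iter i.-1 D f x.
Proof.
move=> sf iN wx; have [r [sr vr] E] := iterD_rhoM sf (ltnW iN).
have r0 : r x = 0 by apply: (vr x wx 0%N); rewrite subn_gt0.
by rewrite (E x wx.1) rho0 // mul0r r0 !addr0.
Qed.

(** A vanishes to order N - 1, hence the commutator of D and the Laplacian to order N - 2, and each
    further D costs one order. *)
Lemma iterD_lap i : (i + 2 <= N)%N -> exists2 r, sm r /\ van V (N - 2 - i) r &
  forall x, V x -> iter i D (L F) x = L (iter i D F) x + r x.
Proof.
elim: i => [|i IH] iN.
  exists (fun=> 0); first by split; [apply: smooth_cst|apply: (van_cst0 oV)].
  by move=> x Vx; rewrite addr0.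
have [r [sr vr] E] := IH (ltnW iN).
have sG := smooth_iterD i sF; have sL f : sm f -> sm (L f) by exact: (smooth_laplacian oV mg).
have vA : vanA V g rho (N - 2).+1.
  have -> : ((N - 2).+1 = N.-1)%N by case: N N3 => [|[|n]] //= _; rewrite subn2.
  exact: (vanA_all oV mg srho rho0 rhop hpE hyp N3 ve oW mh sj jW jsurj iso flat k3 (leqnn _)).
have vC := van_commutator oV mg srho vA sG.
exists (fun x => (D (L (iter i D F)) x - L (D (iter i D F)) x) + D r x).
  have s1 : sm (fun x => D (L (iter i D F)) x - L (D (iter i D F)) x).
    by apply: smoothB => //; [apply: smooth_Dop => //; apply: sL|apply/sL/smooth_Dop].
  split; first by apply: smoothD => //; apply: smooth_Dop.
  apply: (vanD oV) => //; [by apply: smooth_Dop| |].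
    by apply: vanW vC; rewrite leq_subr.
  apply: (van_ddZ oV) => //; apply: vanW vr.
  by rewrite subnSK // ltn_subRL addnC.
move=> x Vx; rewrite iterS (D_eq Vx E) (DD (sL _ sG) sr Vx) iterS.
move: (D _ _) (D _ _) (L _ _) => a1 a2 a3; ring.
Qed.

Local Notation s := (k%:R / 2 - l%:R : R).
Local Notation Q := (Qop true g rho F l%:R s).

Lemma van_lap_rho : van V N.-1 (L rho).
Proof.
have vA := vanA_all oV mg srho rho0 rhop hpE hyp N3 ve oW mh sj jW jsurj iso flat k3 (leqnn N.-1).
apply: (van_eq oV (f := fun x => \sum_i \sum_j invmx (g x) i j * Hm true g rho x i j)).
  by move=> y _; rewrite laplacianE.
have sGi := smooth_ginv oV mg; have sH := smooth_Hm oV mg srho.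
have sM i i' : sm (fun x => invmx (g x) i i' * Hm true g rho x i i') by apply: smoothM.
apply: (van_sum oV) => i; first exact: smooth_sum.
apply: (van_sum oV) => // i'; apply: (vanMl oV) => //.
by apply: (van_eq oV _ (vA (delta_mx 0 i) (delta_mx 0 i'))) => y _; rewrite bil_delta.
Qed.

Lemma smooth_Q : sm Q.
Proof.
have sL := smooth_laplacian oV mg sF; have sLr := smooth_laplacian oV mg srho.
have sD : sm (D F) by apply: smooth_Dop.
have sc c : sm (fun=> c) by apply: smooth_cst.
have sr2 : sm (fun x => rho x ^+ 2) by apply: smoothX.
have h1 := smoothM oV sr2 sL; have h2 := smoothM oV srho sD.
have h3 := smoothM oV (sc (1 - 2 * l%:R)) h2.
have h4 := smoothM oV (smoothM oV (sc s) srho) sLr.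
have h5 := smoothM oV (sc (s * (s - k%:R))) se.
exact: (smoothD oV (smoothD oV h1 h3) (smoothM oV sF (smoothD oV h4 h5))).
Qed.

(** On the wall, rho^2 L F contributes i (i - 1) D^(i-2) L F, where [laplacian_wall] splits L into
    D^2 and the Laplacian of h. The first order term contributes (1 - 2l) i D^i F, and i (i - 1) +
    (1 - 2l) i = i (i - 2l). The coefficient of F in Q vanishes to order N, since both rho L rho and
    [eik] do. *)
Lemma iterD_Q i y : (2 <= i)%N -> (i <= 2 * l)%N -> W y ->
  iter i D Q (j y) = (i%:R * (i%:R - 2 * l%:R)) * iter i D F (j y)
   + (i%:R * (i%:R - 1)) * Lh (fun z => iter (i - 2) D F (j z)) y.
Proof.
move=> i2 il Wy; have wx := jW Wy; have [Vx _] := wx.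
have iN : (i + 2 <= N)%N by apply: leq_trans Nl; rewrite leq_add2r.
have iN' : (i < N)%N by apply: leq_trans iN; rewrite addn2 ltnS.
have sL := smooth_laplacian oV mg sF; have sLr := smooth_laplacian oV mg srho.
have sD : sm (D F) by apply: smooth_Dop.
have sc c : sm (fun=> c) by apply: smooth_cst.
have h1 := smoothM oV srho (smoothM oV srho sL); have h2 := smoothM oV srho sD.
have h3 := smoothM oV (sc (1 - 2 * l%:R)) h2.
pose E x := F x * (s * (rho x * L rho x) + s * (s - k%:R) * eik g rho x).
have h4 := smoothM oV (sc s) (smoothM oV srho sLr).
have h5 := smoothM oV (sc (s * (s - k%:R))) se.
have sE : sm E by exact: (smoothM oV sF (smoothD oV h4 h5)).
have vE : van V N E.
  apply: (vanMl oV) => //; first exact: smoothD.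
  apply: (vanD oV) => //; last exact: (vanMl oV).
  apply: (vanMl oV) => //; first exact: smoothM.
  have := vanM oV srho sLr (van_rho rho0) van_lap_rho.
  by rewrite add1n prednK.
have QE x : V x -> Q x = (rho x * (rho x * L F x) + (1 - 2 * l%:R) * (rho x * D F x)) + E x.
  by move=> _; rewrite /Qop /E /eik /Dop expr2; gen_atoms; ring.
have -> : iter i D Q (j y) = iter i D (fun x => (rho x * (rho x * L F x) + (1 - 2 * l%:R) * (rho x * D F x)) + E x) (j y).
  have HE n x : V x -> iter n D Q x = iter n D (fun x => (rho x * (rho x * L F x) + (1 - 2 * l%:R) * (rho x * D F x)) + E x) x.
    by elim: n x => [|n IH] x Vx'; [exact: QE|rewrite !iterS; apply: D_eq].
  exact: HE.
rewrite (iterD_D _ (smoothD oV h1 h3) sE Vx) (iterD_D _ h1 h3 Vx) (iterD_Z _ _ h2 Vx).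
have -> : iter i D E (j y) = 0.
  have vi : van V 1 (iter i D E) by apply: van_iterD => //; apply: vanW vE; rewrite add1n.
  exact: (vi _ wx 0%N).
rewrite addr0 (iterD_rho_wall (smoothM oV srho sL) iN' wx) (iterD_rho_wall sD iN' wx).
rewrite (iterD_rho_wall sL _ wx); last by apply: leq_ltn_trans iN'; exact: leq_pred.
have -> : iter i.-1 D (D F) (j y) = iter i D F (j y).
  by rewrite -iterSr prednK // ltnW.
have i2N : (i - 2 + 2 <= N)%N by rewrite subnK // ltnW.
have -> : (i.-1.-1 = i - 2)%N by rewrite subn2.
have [r [sr vr] E'] := iterD_lap i2N.
have r0 : r (j y) = 0 by apply: (vr _ wx 0%N); lia.
rewrite (E' _ Vx) r0 addr0.
rewrite (laplacian_wall oV mg srho rho0 rhop hpE hyp N3 ve oW mh sj jW iso (smooth_iterD (i - 2) sF) Wy).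
have -> : dd true (X (j y)) (fun z => dd true (X z) (iter (i - 2) D F) z) (j y) = iter i D F (j y).
  by rewrite -[in RHS](subnK i2) addn2 !iterS.
have -> : i.-1%:R = i%:R - 1 :> R by rewrite -subn1 natrB // ltnW.
move: (laplacian _ _ _ _) (iter _ _ _ _) => a1 a2; ring.
Qed.

Hypothesis vQ : van V (2 * l) Q.

(** The left side of [iterD_Q] is 0 for i < 2l. The recursion moves by steps of 2 from the boundary
    values of F, so odd derivatives never enter, and the factor i - 2l is nonzero below the
    obstruction. *)
Lemma iterD_F m y : (m < l)%N -> W y ->
  iter (2 * m) D F (j y) = kappa l m * iter m (nlap false h) (fun z => F (j z)) y.
Proof.
have sFj := smooth_comp oV oW WV sj sF.
elim: m y => [|m IH] y ml Wy; first by rewrite muln0 kappa0 mul1r.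
have ml' := ltnW ml.
have i2 : (2 <= 2 * m.+1)%N by rewrite mulnS leq_addr.
have il : (2 * m.+1 < 2 * l)%N by rewrite ltn_mul2l.
have := iterD_Q i2 (ltnW il) Wy.
have -> : iter (2 * m.+1) D Q (j y) = 0.
  have v1 : van V 1 (iter (2 * m.+1) D Q).
    by apply: van_iterD; [exact: smooth_Q|apply: vanW vQ; rewrite add1n].
  exact: (v1 _ (jW Wy) 0%N).
have -> : (2 * m.+1 - 2 = 2 * m)%N by rewrite mulnS addKn.
have -> : Lh (fun z => iter (2 * m) D F (j z)) y = kappa l m * - iter m.+1 (nlap false h) (fun z => F (j z)) y.
  rewrite (laplacian_eq oW (g' := h) (fun _ _ => erefl) (f' := fun z => kappa l m * iter m (nlap false h) (fun z => F (j z)) z) Wy).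
    by rewrite (laplacianZ oW mh _ (smooth_nlap oW mh m sFj) Wy) iterS {2}/nlap opprK.
  by move=> z Wz; apply: IH.
have K := kappaS (R := R) ml.
have n1 : m.+1%:R = m%:R + 1 :> R by rewrite natr1.
have n2 : (2 * m + 1)%:R = 2 * m%:R + 1 :> R by rewrite natrD natrM.
have n3 : (2 * m.+1)%:R = 2 * (m%:R + 1) :> R by rewrite natrM n1.
have m0 : m%:R + 1 != 0 :> R by rewrite natr1 pnatr_eq0.
have lm : l%:R - (m%:R + 1) != 0 :> R by rewrite natr1 subr_eq0 eqr_nat gtn_eqF.
move: K; rewrite n1 n2 n3.
move: (iter (2 * m.+1) D F (j y)) (iter m.+1 _ _ _) (kappa l m.+1) (kappa l m) => a u k1 k2.
move: (m%:R) (l%:R) m0 lm => M LL m0 lm K E.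
(* The coefficient i (i - 2l) at i = 2(m + 1), up to sign; multiplying by it avoids division. *)
have c0 : 4 * (M + 1) * (LL - (M + 1)) != 0 by rewrite !mulf_neq0 // pnatr_eq0.
apply: (mulfI c0); apply/eqP; rewrite -subr_eq0; apply/eqP.
have -> : 4 * (M + 1) * (LL - (M + 1)) * a - 4 * (M + 1) * (LL - (M + 1)) * (k1 * u) =
   4 * (M + 1) * (LL - (M + 1)) * a - 2 * (M + 1) * u * (2 * (LL - (M + 1)) * k1) by ring.
rewrite K; apply: oppr_inj; rewrite oppr0 E; ring.
Qed.

(** At i = 2l the coefficient of D^(2l) F vanishes, so only the Laplacian of the preceding even
    derivative remains. The power of d_0 rho converts D into the normal derivative. *)
Lemma tc_Q y : W y ->
  gjms_const l * tc (2 * l) Q (j y) =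
  pd true ord0 rho (j y) ^+ (2 * l) * iter l (nlap false h) (fun z => F (j z)) y.
Proof.
move=> Wy; have wx := jW Wy; have [Vx _] := wx.
have sFj := smooth_comp oV oW WV sj sF.
have i2 : (2 <= 2 * l)%N by case: l l1 => // p _; rewrite mulnS leq_addr.
have := iterD_Q i2 (leqnn _) Wy.
have l1' : (l - 1 < l)%N by rewrite subn1 prednK.
have -> : (2 * l - 2 = 2 * (l - 1))%N by rewrite mulnBr.
rewrite (laplacian_eq oW (g' := h) (fun _ _ => erefl) (f' := fun z => kappa l (l - 1) * iter (l - 1) (nlap false h) (fun z => F (j z)) z) Wy); last first.
  by move=> z Wz; apply: iterD_F.
rewrite (laplacianZ oW mh _ (smooth_nlap oW mh _ sFj) Wy).
have -> : Lh (iter (l - 1) (nlap false h) (fun z => F (j z))) y = - iter l (nlap false h) (fun z => F (j z)) y.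
  by rewrite -[in RHS](prednK l1) iterS /nlap opprK subn1.
rewrite iterD_wall //; last exact: smooth_Q.
have -> : iter (2 * l) (pd true ord0) Q (j y) = tc (2 * l) Q (j y) * (2 * l)`!%:R.
  by rewrite /tc divfK // fact_neq0.
have rX := rho_X oV srho rho0 ve N0 wx.
move=> E.
have K := kappa_last (R := R) l1.
have f0 := fact_neq0 (R := R) (2 * l).
have rX2 : X (j y) 0 ord0 ^+ (2 * l) * pd true ord0 rho (j y) ^+ (2 * l) = 1.
  by rewrite -exprMn rX expr1n.
apply: (mulfI f0).
have l2 : (2 * l - 1)%:R = (2 * l)%:R - 1 :> R by rewrite natrB // ltnW.
move: E; rewrite -natrM subrr mulr0 mul0r add0r -l2 => E.
move: E K rX2 {f0 rX l2}.
move: (tc (2 * l) Q (j y)) (gjms_const l) (X (j y) 0 ord0 ^+ (2 * l)) (pd true ord0 rho (j y) ^+ (2 * l)).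
move: (iter l _ _ y) (kappa l (l - 1)) ((2 * l)`!%:R) ((2 * l)%:R) ((2 * l - 1)%:R).
move=> u kk ff n1 n2 t G a c E K ac.
transitivity (c * G * (a * (t * ff))); last by rewrite E -K; ring.
transitivity ((a * c) * (ff * (G * t))); last by ring.
by rewrite ac mul1r.
Qed.

End Recursion.

(** * The eikonal equation to finite order *)

Section Eikonal.
Context {R : realType}.
Variables (k : nat) (V : set 'rV[R]_k.+1) (g : 'rV[R]_k.+1 -> 'M[R]_k.+1).
Variables r a0 : 'rV[R]_k.+1 -> R.
Hypotheses (oV : relopen true V) (mg : metric_on true V g).
Hypotheses (sr : smooth_on true V r) (r0 : forall x, wall V x -> r x = 0).
Hypothesis dr1 : forall x, wall V x -> dd true (gr true g r x) r x = 1.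
Hypothesis sa0 : smooth_on true V a0.

(** Composition with this map extends a coefficient known on the wall independently of x_0. *)
Definition wall_proj (x : 'rV[R]_k.+1) : 'rV[R]_k.+1 := \row_i (if i == ord0 then 0 else x 0 i).
Hypothesis Vproj : forall x, V x -> V (wall_proj x).

Local Notation G := (gr true g).
Local Notation d := (dd true).
Local Notation sm := (smooth_on true V).

Lemma smooth_proj : vsmooth true V wall_proj.
Proof.
move=> i; have [i0|i0] := eqVneq i ord0.
  by apply: (smooth_eq oV (f := fun=> 0)) => [y _|]; [rewrite mxE i0 eqxx|apply: smooth_cst].
apply: (smooth_eq oV (f := fun y => y 0 i)) => [y _|]; last exact: smooth_coord.
by rewrite mxE (negbTE i0).
Qed.

Lemma proj_wall x : wall V x -> wall_proj x = x.
Proof. by move=> [_ x0]; apply/rowP => i; rewrite mxE; case: eqP => // ->. Qed.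

(* |d(r e^a)|^2 for the metric e^(2a) g. *)
Definition eikE a x := d (G r x) r x + 2 * (r x * d (G r x) a x) + r x ^+ 2 * d (G a x) a x.

Let sG f : sm f -> vsmooth true V (G f). Proof. exact: (smooth_gr oV mg). Qed.
Let sGG f f' : sm f -> sm f' -> sm (fun x => d (G f x) f' x).
Proof. by move=> sf sf'; apply: (smooth_ddZ oV sf' (sG sf)). Qed.
Let sc c : sm (fun=> c). Proof. exact: smooth_cst. Qed.

Lemma smooth_eikE a : sm a -> sm (eikE a).
Proof.
move=> sa; apply: smoothD => //; last by apply: smoothM => //; [apply: smoothX|apply: sGG].
apply: smoothD => //; first exact: sGG.
by apply: smoothM => //; apply: smoothM => //; apply: sGG.
Qed.

Lemma eikED a p x : sm a -> sm p -> V x -> eikE (fun y => a y + p y) x =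
  eikE a x + (2 * (r x * d (G r x) p x) + r x ^+ 2 * (2 * d (G a x) p x + d (G p x) p x)).
Proof.
move=> sa sp Vx; rewrite /eikE.
have D u : d u (fun y => a y + p y) x = d u a x + d u p x by rewrite (ddD oV).
have GD f : d (G (fun y => a y + p y) x) f x = d (G a x) f x + d (G p x) f x.
  by rewrite !(grC mg _ f Vx) D.
rewrite !D !GD (grC mg p a Vx); move: (r x) => z; gen_atoms; ring.
Qed.

Definition xn N (x : 'rV[R]_k.+1) : R := x 0 ord0 ^+ N.

Lemma smooth_xn N : sm (xn N).
Proof. by apply: smoothX => //; apply: smooth_coord. Qed.

Lemma xnP N : van V N (xn N) /\ forall x, wall V x -> tc N (xn N) x = 1.
Proof.
have s1 : sm (fun x => x 0 ord0) by apply: smooth_coord.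
have v1 : van V 1 (fun x => x 0 ord0) by move=> x [_ x0] [|i] // _.
elim: N => [|N [vN tN]]; first by split=> // x _; rewrite tc0 /xn expr0.
have E y : V y -> y 0 ord0 * xn N y = xn N.+1 y by move=> _; rewrite /xn exprS.
split; first by apply: (van_eq oV E); rewrite -add1n; apply: vanM => //; exact: smooth_xn.
move=> x wx; rewrite -(tc_eq oV N.+1 E wx.1) -add1n (tc_lead oV s1 (smooth_xn N) v1 vN wx) tN // mulr1.
have := @tcS R k 0 (fun x => x 0 ord0) x; rewrite mul1r tc0 => ->.
by rewrite -dd_delta (dd_coord oV _ _ wx.1) mxE !eqxx.
Qed.

Lemma vr : van V 1 r. Proof. by move=> x wx [|i] // _; apply: r0. Qed.

(** By induction on the order. Adding p = x_0^N c to a changes the defect by 2 r <dr, dp>, up to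
    order N + 1. Its leading coefficient is 2 N c, because |dr| = 1 on the wall, so c can be solved
    for when N > 0, and p then does not affect the boundary values. At N = 0 the defect already
    vanishes on the wall. *)
Lemma eikonal_solution N : exists2 a, sm a /\ (forall x, wall V x -> a x = a0 x) &
  van V N (fun x => eikE a x - 1).
Proof.
elim: N => [|N [a [sa aw] va]]; first by exists a0.
have se : sm (fun x => eikE a x - 1) by apply: smoothB => //; apply: smooth_eikE.
have [N0|N0] := posnP N.
  exists a => //; rewrite N0 => x wx [|i] // _ /=.
  by rewrite /eikE r0 // mul0r mulr0 expr0n mul0r !addr0 dr1 // subrr.
have sw := smooth_proj.
pose t x := tc N (fun x => eikE a x - 1) x.
have st : sm t by apply: smoothM => //; apply: smooth_iter.
(* The solution of 2 N c + t = 0 on the wall. *)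
pose c x := - (2 * N%:R)^-1 * t (wall_proj x).
have sc' : sm c.
  by apply: smoothM => //; apply: (smooth_comp oV oV Vproj sw st).
have sxN := smooth_xn N; have [vx tx] := xnP N.
pose p x := xn N x * c x.
have sp : sm p by apply: smoothM.
have vp : van V N p by apply: (vanMr oV).
exists (fun x => a x + p x).
  split; first exact: smoothD.
  move=> x wx; rewrite aw // /p /xn wx.2 expr0n; move: N0; case: (N) => // n _.
  by rewrite mul0r addr0.
have N1 : (N = N.-1.+1)%N by rewrite prednK.
have vp' : van V N.-1.+1 p by rewrite -N1.
pose P1 x := r x * d (G r x) p x.
pose P2 x := r x ^+ 2 * (2 * d (G a x) p x + d (G p x) p x).
have sP1 : sm P1 by apply: smoothM => //; apply: sGG.
have s22 : sm (fun x => 2 * d (G a x) p x) by apply: smoothM => //; apply: sGG.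
have s23 : sm (fun x => 2 * d (G a x) p x + d (G p x) p x) by apply: smoothD => //; apply: sGG.
have sr2 : sm (fun x => r x ^+ 2) by apply: smoothX.
have sP2 : sm P2 by apply: smoothM.
have vG f : sm f -> van V N.-1 (fun x => d (G f x) p x).
  by move=> sf; apply: (van_ddZ oV) => //; apply: sG.
have vP1 : van V N P1 by rewrite N1 -add1n; apply: (vanM oV) => //; [apply: sGG|exact: vr|apply: vG].
have vP2 : van V N.+1 P2.
  have -> : (N.+1 = 2 + N.-1)%N by rewrite {1}N1.
  apply: (vanM oV) => //; first by have := vanM oV sr sr vr vr.
  by apply: (vanD oV) => //; [apply: sGG|apply: (vanMl oV) => //; [apply: sGG|apply: vG]|apply: vG].
have E x : V x -> ((eikE a x - 1) + 2 * P1 x) + P2 x = eikE (fun y => a y + p y) x - 1.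
  by move=> Vx; rewrite eikED // /P1 /P2; move: (eikE _ _) (r x) => e z; gen_atoms; ring.
apply: (van_eq oV E).
have s21 : sm (fun x => 2 * P1 x) by apply: smoothM.
apply: (vanD oV) => //; first exact: smoothD.
apply: (van_tcS (V := V)).
  by apply: (vanD oV) => //; apply: (vanMl oV).
move=> x wx; have [Vx _] := wx.
rewrite (tcD oV N se s21 Vx) -/(t x).
have -> : tc N (fun x => 2 * P1 x) x = 2 * tc N P1 x.
  have := tc_lead oV (M := 0) (N := N) (sc 2) sP1 (@van0 _ _ _ _) vP1 wx.
  by rewrite add0n tc0.
have -> : tc N P1 x = N%:R * c x.
  rewrite {1}N1 -add1n (tc_lead oV sr (sGG sr sp) vr (vG r sr) wx).
  rewrite (tc_ddZ oV sp (sG sr) vp' wx).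
  have := @tcS R k 0 r x; rewrite mul1r tc0 => ->.
  have -> : tc N.-1.+1 p x = c x.
    rewrite -N1 -[N in LHS]addn0 (tc_lead oV (M := N) (N := 0) sxN sc' vx (@van0 _ _ _ _) wx).
    by rewrite tx // mul1r tc0.
  have := dr1 wx; rewrite (van_dd_wall oV sr vr wx) mulrC => rX.
  by rewrite mulrA rX mul1r -N1.
rewrite /c proj_wall //.
have n0 : N%:R != 0 :> R by rewrite pnatr_eq0 -lt0n.
by move: (t x) (N%:R) n0 => T n n0; field.
Qed.

Variable a : 'rV[R]_k.+1 -> R.
Hypothesis sa : sm a.

Lemma eik_conf x : V x -> eik (conf g a) (fun y => r y * expR (a y)) x = eikE a x - 1.
Proof.
move=> Vx; have mc := metric_conf oV mg sa.
have sx : sm (fun y => expR (a y)) by apply: smooth_exp.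
have srho : sm (fun y => r y * expR (a y)) by apply: smoothM.
have D u : d u (fun y => r y * expR (a y)) x = expR (a x) * (d u r x + r x * d u a x).
  by rewrite (ddM oV _ sr sx Vx) (dd_exp oV _ sa Vx); move: (expR _) (r x) => e z; gen_atoms; ring.
have GE f : gr true (conf g a) f x = expR (- (2 * a x)) *: G f x.
  apply: (metric_nondeg mc Vx) => w; rewrite (gr_inner mc _ _ Vx).
  rewrite bil_conf bilZl (gr_inner mg _ _ Vx) mulrA -expRD subrr expR0 mul1r //.
rewrite /eik GE ddvZ D.
have -> : d (G (fun y => r y * expR (a y)) x) r x = expR (a x) * (d (G r x) r x + r x * d (G r x) a x).
  by rewrite (grC mg _ r Vx) D.
have -> : d (G (fun y => r y * expR (a y)) x) a x = expR (a x) * (d (G a x) r x + r x * d (G a x) a x).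
  by rewrite (grC mg _ a Vx) D.
rewrite /eikE (grC mg a r Vx).
have e1 : expR (- (2 * a x)) * expR (a x) * expR (a x) = 1.
  have e0 : - (2 * a x) + a x + a x = 0 by ring.
  by rewrite -!expRD e0 expR0.
move: (d (G r x) r x) (d (G r x) a x) (d (G a x) a x) => p q t.
move: (expR (- (2 * a x))) (expR (a x)) e1 (r x) => e2 e e1 z.
transitivity (e2 * e * e * (p + z * q + z * (q + z * t)) - 1); first by ring.
by rewrite e1; ring.
Qed.

End Eikonal.

(** * Flat conformal representatives of umbilic submanifolds *)

Section Euclidean.
Context {R : realType}.

Definition dot n (u v : 'rV[R]_n) : R := bil 1%:M u v.

Lemma dotE n (u v : 'rV[R]_n) : dot u v = \sum_i u 0 i * v 0 i.
Proof. by rewrite /dot bil_def mulmx1 mxE; apply: eq_bigr => i _; rewrite mxE. Qed.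

Lemma dotC n (u v : 'rV[R]_n) : dot u v = dot v u.
Proof. by rewrite !dotE; apply: eq_bigr => i _; rewrite mulrC. Qed.

Lemma dot_ge0 n (u : 'rV[R]_n) : 0 <= dot u u.
Proof. by rewrite dotE sumr_ge0 // => i _; rewrite -expr2 sqr_ge0. Qed.

Lemma dot_eq0 n (u : 'rV[R]_n) : dot u u = 0 -> u = 0.
Proof.
rewrite dotE => /eqP; rewrite psumr_eq0 => [/allP H|i _]; last by rewrite -expr2 sqr_ge0.
apply/rowP => i; rewrite mxE; apply/eqP.
by have := H i (mem_index_enum i); rewrite mulf_eq0 orbb.
Qed.

Lemma dot_gt0 n (u : 'rV[R]_n) : u != 0 -> 0 < dot u u.
Proof. by move=> u0; rewrite lt0r dot_ge0 andbT; apply: contraNneq u0 => /dot_eq0 ->. Qed.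

Definition euc n : 'rV[R]_n -> 'M[R]_n := fun=> 1%:M.

Lemma relopenT n : relopen false (setT : set 'rV[R]_n).
Proof. by split=> // x _; exists 1. Qed.

Lemma metric_euc n : metric_on false setT (@euc n).
Proof.
split=> [i j|x _|x _ v v0]; first by apply: smooth_cst; exact: relopenT.
  by rewrite /euc trmx1.
exact: dot_gt0.
Qed.

Lemma Gam_euc n (x u v : 'rV[R]_n) : Gam false (@euc n) x u v = 0.
Proof.
apply: (metric_nondeg (metric_euc n) (x := x)) => // w.
have E a c e : dd false a (fun y : 'rV[R]_n => bil (euc y) c e) x = 0.
  exact: (dd_cst (@relopenT n) a (bil 1%:M c e) (I : setT x)).
by rewrite (koszul (@relopenT n) (metric_euc n)) // bil0l !E addr0 subrr mulr0.
Qed.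

Lemma Rm_euc n (x u v w : 'rV[R]_n) : Rm false (@euc n) x u v w = 0.
Proof.
rewrite (RmE (@relopenT n) (metric_euc n)) // !Gam_euc !addr0.
have E a c e : vd false a (fun y => Gam false (@euc n) y c e) x = 0.
  rewrite (_ : (fun y => _) = fun=> 0); last by apply/funext => y; rewrite Gam_euc.
  by rewrite (vd_cst (@relopenT n)).
by rewrite !E subrr.
Qed.

Lemma covphi_euc b' m n (phi : 'rV[R]_m -> 'rV[R]_n) u Z x :
  covphi false b' (@euc n) phi u Z x = vd b' u Z x.
Proof. by rewrite /covphi Gam_euc addr0. Qed.

Section DotRules.
Variables (b : bool) (m n : nat) (W : set 'rV[R]_m).
Hypothesis oW : relopen b W.

Lemma smooth_dot (Z Y : 'rV[R]_m -> 'rV[R]_n) : vsmooth b W Z -> vsmooth b W Y ->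
  smooth_on b W (fun y => dot (Z y) (Y y)).
Proof. by move=> sZ sY; apply: (smooth_bil oW (B := fun=> 1%:M)) => // i j; apply: smooth_cst. Qed.

Lemma dd_dot (Z Y : 'rV[R]_m -> 'rV[R]_n) u x : vsmooth b W Z -> vsmooth b W Y -> W x ->
  dd b u (fun y => dot (Z y) (Y y)) x = dot (vd b u Z x) (Y x) + dot (Z x) (vd b u Y x).
Proof.
move=> sZ sY Wx; have s1 : msmooth b W (fun=> 1%:M : 'M[R]_n) by move=> i j; apply: smooth_cst.
rewrite (dd_bil oW u s1 sZ sY Wx) (_ : md b u (fun=> 1%:M) x = 0).
  by rewrite bil_def mulmx0 mul0mx mxE add0r.
by apply/matrixP => i j; rewrite mdE (dd_cst oW) // mxE.
Qed.
End DotRules.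

Lemma relopen_box n (x : 'rV[R]_n) e : relopen false (box x e).
Proof.
split=> // z hz; pose D i := e - `|z 0 i - x 0 i|.
have D0 i : 0 < D i by rewrite subr_gt0.
exists (\big[Num.min/1]_i D i).
  by elim/big_ind: _ => // a c a0 c0; rewrite lt_min a0 c0.
move=> w [_ hw] i; have hD : \big[Num.min/1]_i D i <= D i by apply: bigmin_le_cond.
have := lt_le_trans (hw i) hD; rewrite ltrBrDr; apply: le_lt_trans.
exact: ler_distD.
Qed.

(** A box contains the coordinate path from its centre to each of its points. *)
Lemma const_box n (x : 'rV[R]_n) e f : smooth_on false (box x e) f -> 0 < e ->
  (forall u y, box x e y -> dd false u f y = 0) -> forall y, box x e y -> f y = f x.
Proof.
move=> sf e0 df0 y hy.
have ob := relopen_box x e.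
pose v := y - x; pose p m : 'rV[R]_n := x + \row_j (if (j < m)%N then v 0 j else 0).
have pb m (i : 'I_n) t : i = m :> nat -> 0 <= t <= 1 -> box x e (p m + (t * v 0 i) *: delta_mx 0 i).
  move=> im /andP[t0 t1] j.
  have -> : (p m + (t * v 0 i) *: delta_mx 0 i) 0 j - x 0 j =
      if (j < m)%N then v 0 j else if j == i then t * v 0 i else 0.
    rewrite stepE !mxE addrC addrA addrA (addrC (- _)) subrr add0r.
    case: (ltnP j m) => [jm|jm]; last by case: eqP; rewrite ?mulr1 ?mulr0 add0r.
    by rewrite -val_eqE /= im ltn_eqF // mulr0 addr0.
  have hv l : `|v 0 l| < e by rewrite !mxE; exact: hy.
  case: ifP => _ //; case: ifP => _; last by rewrite normr0.
  by rewrite normrM ger0_norm //; apply: le_lt_trans (hv i); rewrite ler_piMl.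
have step m : (m <= n)%N -> f (p m) = f x.
  elim: m => [|m IH] mn; first by congr f; apply/rowP => i; rewrite !mxE addr0.
  rewrite -(IH (ltnW mn)); pose i := Ordinal mn.
  have pi : p m.+1 = p m + v 0 i *: delta_mx 0 i.
    apply/rowP => l; rewrite stepE !mxE -addrA; congr (_ + _).
    rewrite ltnS leq_eqVlt -val_eqE /=; case: (ltngtP l m) => [ji|ji|ji] /=.
    - by rewrite mulr0 addr0.
    - by rewrite mulr0 addr0.
    - by rewrite add0r mulr1; congr (y 0 _ - x 0 _); apply: val_inj.
  have [t ht E] := mvt_line (x := p m) (s := v 0 i) ob.1 (smooth_cont sf)
    (fun i x => @smooth_is_pd _ _ _ _ i f x sf) (fun t ht => pb m i t erefl ht).
  apply/eqP; rewrite -subr_eq0 pi E -dd_delta df0 ?mulr0 //; exact: pb.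
rewrite -(step n (leqnn _)); congr f; apply/rowP => i.
by rewrite !mxE ltn_ord subrKC.
Qed.

End Euclidean.

(** * Umbilic submanifolds of Euclidean space *)

Section Spherical.
Context {R : realType}.

Variables (k n : nat) (W : set 'rV[R]_k) (h : 'rV[R]_k -> 'M[R]_k) (phi : 'rV[R]_k -> 'rV[R]_n).
Hypotheses (oW : relopen false W) (mh : metric_on false W h) (sphi : vsmooth false W phi).
Hypothesis iso : forall y a c, W y ->
  bil (h y) a c = dot (vd false a phi y) (vd false c phi y).

Local Notation J := (vd false).

Lemma dot_hess u v w y : W y ->
  dot (J u (J v phi) y) (J w phi y) = dot (J (Gam false h y u v) phi y) (J w phi y).
Proof.
move=> Wy; rewrite -iso //.
rewrite -(@gauss_formula R false false k n setT W (@euc R n) h phi (@relopenT R n) oW (fun _ _ => I) sphi (@metric_euc R n) mh u v w y iso Wy).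
by rewrite covphi_euc.
Qed.

Hypothesis umb : forall y, W y -> exists H, forall u v,
  J u (J v phi) y = J (Gam false h y u v) phi y + bil (h y) u v *: H.
Hypothesis k2 : (1 < k)%N.

Let i0 : 'I_k := Ordinal (ltnW k2).
Let i1 : 'I_k := Ordinal k2.
Let e0 : 'rV[R]_k := delta_mx 0 i0.

Lemma delta_neq0 (i : 'I_k) : delta_mx 0 i != 0 :> 'rV[R]_k.
Proof.
by apply/negP => /eqP/rowP/(_ i); rewrite !mxE !eqxx => /eqP; rewrite oner_eq0.
Qed.

Lemma h00 y : W y -> bil (h y) e0 e0 != 0.
Proof. by case: mh => _ _ hp Wy; rewrite gt_eqF // hp // delta_neq0. Qed.

(** The vector H of [umb] is given pointwise only; reading it off from one basis vector shows that
    it is smooth. *)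
Definition mcv y : 'rV[R]_n :=
  (bil (h y) e0 e0)^-1 *: (J e0 (J e0 phi) y - J (Gam false h y e0 e0) phi y).

Lemma mcvE u v y : W y ->
  J u (J v phi) y = J (Gam false h y u v) phi y + bil (h y) u v *: mcv y.
Proof.
move=> Wy; have [H EH] := umb Wy; rewrite EH; congr (_ + _ *: _).
by rewrite /mcv EH addrC addKr scalerA mulVf ?scale1r // h00.
Qed.

Let sv (u : 'rV[R]_k) : vsmooth false W (fun=> u) := vsmooth_cst (b := false) oW u.
Let sGam u v : vsmooth false W (fun y => Gam false h y u v) := smooth_Gam oW mh (sv u) (sv v).
Let sh u v : smooth_on false W (fun y => bil (h y) u v).
Proof. by apply: (smooth_bil oW) => //; case: mh. Qed.
Let sJ u : vsmooth false W (J u phi) := smooth_vd oW u sphi.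

Lemma smooth_mcv : vsmooth false W mcv.
Proof.
move=> j; apply: (smooth_eq oW (f := fun y => (bil (h y) e0 e0)^-1 *
    (dd false e0 (dd false e0 (fun z => phi z 0 j)) y
     - dd false (Gam false h y e0 e0) (fun z => phi z 0 j) y))).
  by move=> y _; rewrite !mxE vdE.
apply: smoothM => //; first by apply: smoothV => // y; apply: h00.
apply: smoothB => //; first by do 2 apply: (smooth_dd oW).
exact: (smooth_ddZ oW (sphi j) (@sGam e0 e0)).
Qed.

Lemma dot_mcv w y : W y -> dot (mcv y) (J w phi y) = 0.
Proof.
move=> Wy; have := dot_hess e0 e0 w Wy; rewrite (mcvE e0 e0 Wy) /dot bilDl bilZl => /eqP.
by rewrite addrC -subr_eq0 addrK mulf_eq0 (negPf (h00 Wy)) => /eqP.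
Qed.

Let N y := dot (mcv y) (mcv y).

Lemma dot_hess_mcv u v y : W y -> dot (J u (J v phi) y) (mcv y) = bil (h y) u v * N y.
Proof. by move=> Wy; rewrite (mcvE u v Wy) /dot bilDl bilZl -/(dot _ _) dotC dot_mcv // add0r. Qed.

(** The third derivatives of phi are symmetric. Paired with [mcv] they give an expression symmetric
    in all arguments plus h(a, c) times half the derivative of N in the remaining direction ([E]),
    so the latter term must be symmetric too. *)
Lemma codazzi u v w y : W y ->
  bil (h y) u v * dd false w N y = bil (h y) w v * dd false u N y.
Proof.
move=> Wy; have sm := smooth_mcv.
have sN : smooth_on false W N by apply: (smooth_dot oW).
have dN a : dd false a N y = 2 * dot (mcv y) (J a mcv y).
  by rewrite (dd_dot oW a sm sm Wy) (dotC (J a mcv y)) mulr_natl.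
have dJ a c : dot (J a phi y) (J c mcv y) = - (bil (h y) c a * N y).
  have := dd_dot oW c (@sJ a) sm Wy.
  rewrite (dd_eq oW c (g := fun=> 0) Wy); last by move=> z Wz; rewrite dotC dot_mcv.
  rewrite (dd_cst oW _ _ Wy) dot_hess_mcv // => /esym/eqP.
  by rewrite addrC addr_eq0 => /eqP.
have E a c d : dot (J d (J a (J c phi)) y) (mcv y) =
    (bil (h y) (Gam false h y d a) c + bil (h y) a (Gam false h y d c)
     + bil (h y) (Gam false h y a c) d) * N y + bil (h y) a c * (2^-1 * dd false d N y).
  have := dd_dot oW d (smooth_vd oW a (@sJ c)) sm Wy.
  rewrite (dd_eq oW d (g := fun z => bil (h z) a c * N z) Wy); last first.
    by move=> z Wz; rewrite dot_hess_mcv.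
  rewrite (ddM oW d (@sh a c) sN Wy) (metric_compat oW mh d a c Wy).
  rewrite (mcvE a c Wy) /dot bilDl bilZl -!/(dot _ _) dJ.
  rewrite (bilC d (Gam false h y a c)); last by case: mh => _ hs _; rewrite hs.
  rewrite dN; move: (dot (J d _ y) _) => T.
  move: (N y) (dot (mcv y) _) => r s; gen_atoms => EE.
  move: EE; lra.
have := E u v w; rewrite (vdC oW w u (@sJ v) Wy) E.
rewrite (bilC w (Gam false h y u v)) ?(bilC u (Gam false h y w v));
  try by case: mh => _ hs _; rewrite hs.
rewrite (GamC oW mh u w Wy).
move: (N y) => r; gen_atoms; lra.
Qed.

(** Removing v from [codazzi] gives w(N) w' = w'(N) w, and two independent vectors exist as k >=
    2. *)
Lemma dN0 u y : W y -> dd false u N y = 0.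
Proof.
move=> Wy; have E w w' : dd false w N y *: w' = dd false w' N y *: w.
  apply: (metric_nondeg mh Wy) => v.
  by rewrite !bilZl mulrC codazzi // mulrC.
have D i : dd false (delta_mx 0 i) N y = 0.
  have [j ji] : exists j, j != i.
    by case: (eqVneq i i0) => [->|ii]; [exists i1|exists i0; rewrite eq_sym].
  have /rowP/(_ j) := E (delta_mx 0 i) (delta_mx 0 j).
  by rewrite !mxE !eqxx (negPf ji) mulr0 mulr1.
have /rowP/(_ i0) := E u (delta_mx 0 i0).
by rewrite D !mxE !eqxx mulr1 mul0r.
Qed.

(** On a box, constancy of |mcv|^2 carries its vanishing from p to all points; the Gauss equation
    for a totally geodesic immersion into Euclidean space then gives flatness. *)
Lemma umbilic_flat p : W p -> (forall u v, J u (J v phi) p = J (Gam false h p u v) phi p) ->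
  exists2 e, 0 < e & box p e `<=` W /\
    forall y u v w, box p e y -> Rm false h y u v w = 0.
Proof.
move=> Wp tp; have [e e_gt0 eW] := oW.2 _ Wp.
have bW : box p e `<=` W by move=> y hy; apply: eW.
exists e => //; split=> // y u v w hy; have ob := @relopen_box R k p e.
have Np : N p = 0 by rewrite /N /mcv tp subrr scaler0 /dot bil0l.
have sN : smooth_on false (box p e) N.
  by apply: (smooth_sub bW); apply: (smooth_dot oW); exact: smooth_mcv.
have N0 z : box p e z -> mcv z = 0.
  move=> hz; apply: dot_eq0; rewrite -/(N z) -Np.
  by apply: (const_box sN e_gt0 _ hz) => a c /bW; apply: dN0.
have tg a c z : box p e z -> covphi false false (@euc R n) phi a (J c phi) z =
    J (Gam false h z a c) phi z.
  by move=> hz; rewrite covphi_euc mcvE ?N0 ?scaler0 ?addr0 //; apply: bW.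
have sb : vsmooth false (box p e) phi by move=> j; apply: (smooth_sub bW).
have := gauss_totally_geodesic (@relopenT R n) ob (fun _ _ => I) sb (@metric_euc R n)
  (metric_on_sub bW mh) tg u v w hy.
rewrite Rm_euc => R0; apply: (metric_nondeg mh (bW _ hy)) => z.
by rewrite iso ?R0 ?/dot ?bil0l //; apply: bW.
Qed.

End Spherical.

(** * Passing to Euclidean space through a conformally flat chart *)

Section ConformallyFlat.
Context {R : realType}.
Variables (k n : nat) (V : set 'rV[R]_n) (W : set 'rV[R]_k).
Variables (g : 'rV[R]_n -> 'M[R]_n) (h : 'rV[R]_k -> 'M[R]_k).
Variables (f : 'rV[R]_k -> 'rV[R]_n) (psi : 'rV[R]_n -> 'rV[R]_n) (om : 'rV[R]_n -> R).
Hypotheses (oV : relopen false V) (oW : relopen false W) (WV : forall y, W y -> V (f y)).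
Hypotheses (mg : metric_on false V g) (mh : metric_on false W h).
Hypotheses (sf : vsmooth false W f) (spsi : vsmooth false V psi) (som : smooth_on false V om).
Local Notation J := (vd false).
Hypothesis iso : forall y a c, W y -> bil (h y) a c = bil (g (f y)) (J a f y) (J c f y).
Hypothesis umb : forall y, W y -> exists H, forall u v,
  covphi false false g f u (J v f) y = J (Gam false h y u v) f y + bil (h y) u v *: H.
Hypothesis cf : forall x a c, V x ->
  bil (g x) a c = expR (2 * om x) * dot (J a psi x) (J c psi x).

Let so x := - om x.
Let g0 := conf g so.
Let h0 := conf h (fun y => so (f y)).
Let phi y := psi (f y).

Let sso : smooth_on false V so. Proof. exact: smoothN. Qed.
Let mg0 : metric_on false V g0. Proof. exact: metric_conf. Qed.
Let ssof : smooth_on false W (fun y => so (f y)).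
Proof. exact: (smooth_comp oV oW WV sf sso). Qed.

Lemma metric_flatten : metric_on false W h0.
Proof. exact: (metric_conf oW mh ssof). Qed.

Lemma smooth_flatten : vsmooth false W phi.
Proof. by move=> j; apply: (smooth_comp oV oW WV sf (spsi j)). Qed.

Let cf0 x a c : V x -> bil (g0 x) a c = dot (J a psi x) (J c psi x).
Proof.
move=> Vx; rewrite bil_conf cf // mulrA -expRD /so.
by rewrite (_ : _ + _ = 0) ?expR0 ?mul1r //; ring.
Qed.

Lemma vd_flatten a y : W y -> J a phi y = J (J a f y) psi (f y).
Proof.
by move=> Wy; apply/rowP => j; rewrite !vdjE; apply: (dd_comp oV oW WV sf a (spsi j) Wy).
Qed.

Lemma iso_flatten y a c : W y -> bil (h0 y) a c = dot (J a phi y) (J c phi y).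
Proof. by move=> Wy; rewrite !vd_flatten // -cf0 ?bil_conf ?iso //; apply: WV. Qed.

(** psi is isometric from g0 to Euclidean space and its Jacobian is invertible, so the tangential
    statement [dot_hess] determines the whole second derivative. *)
Lemma affine_flatten x u v : V x -> J u (J v psi) x = J (Gam false g0 x u v) psi x.
Proof.
move=> Vx; apply/eqP; rewrite -subr_eq0; apply/eqP; set X := _ - _.
have D w : dot X (J w psi x) = 0.
  by rewrite /dot bilBl -!/(dot _ _) (dot_hess oV mg0 spsi cf0 u v w Vx) subrr.
have Ju : jac false psi x \in unitmx.
  rewrite -row_free_unit -kermx_eq0; apply/eqP/row_matrixP => i; rewrite row0.
  have K : row i (kermx (jac false psi x)) *m jac false psi x = 0.
    by apply/sub_kermxP; exact: row_sub.
  apply/eqP/negP => /negP r0.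
  have [_ _ hp] := mg0; have := hp x Vx _ r0.
  by rewrite cf0 // vd_jac K /dot bil0l ltxx.
by apply: dot_eq0; rewrite -{2}(mulmxKV Ju X) -vd_jac D.
Qed.

(** A conformal change alters both connections by tangential terms and by multiples of h(u, v), so
    the form of [umb] persists; psi then preserves it by [affine_flatten]. *)
Lemma umbilic_flatten y : W y -> exists H, forall u v,
  J u (J v phi) y = J (Gam false h0 y u v) phi y + bil (h0 y) u v *: H.
Proof.
move=> Wy; have Vy := WV Wy; have [H EH] := umb Wy.
(* H together with the two gradients that [Gam_conf] multiplies by h(u, v), one from g and one from
   h. *)
pose C := H - gr false g so (f y) + J (gr false h (fun z => so (f z)) y) f y.
exists (expR (- (2 * so (f y))) *: J C psi (f y)) => u v.
have T : covphi false false g0 f u (J v f) y =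
    J (Gam false h0 y u v) f y + bil (h y) u v *: C.
  rewrite /covphi /g0 (Gam_conf oV mg sso) // /h0 (Gam_conf oW mh ssof) // -iso //.
  have := EH u v; rewrite /covphi => /(canRL (addrK _)) ->.
  rewrite -!(dd_comp oV oW WV sf _ sso Wy) /C.
  rewrite -!scaleNr !(vdDl, vdZl) !(scalerDr, scaleNr, scalerN).
  gen_vecs.
  apply: row_eq_ring => j; rewrite !(rowD, rowN, rowZ); gen_atoms; ring.
rewrite bil_conf scalerA -mulrA (mulrC (bil _ _ _)) mulrA -expRD subrr expR0 mul1r.
rewrite vd_flatten // -vdZl -vdDl -T; apply/rowP => j.
rewrite 2!vdjE (dd_eq oW u (g := dd false v (fun z => psi (f z) 0 j)) Wy); last by move=> z _; rewrite vdjE.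
rewrite (hess_comp g0 oV oW WV sf u v (spsi j) Wy) (bil_Hm g0 oV _ _ (spsi j) Vy).
have /rowP/(_ j) := affine_flatten (J u f y) (J v f y) Vy.
rewrite !vdjE => E.
rewrite (_ : dd _ _ _ _ = dd false (Gam false g0 (f y) (J u f y) (J v f y)) (fun z => psi z 0 j) (f y)).
  by rewrite subrr add0r.
by rewrite -E; apply: (dd_eq oV _ Vy) => z _; rewrite vdjE.
Qed.

End ConformallyFlat.

(** * Special conformal transformations *)

Section SpecialConformal.
Context {R : realType}.
Variables (n : nat) (beta : 'rV[R]_n).

(* [sct] is the special conformal transformation: inversion, translation by
   beta, inversion; its conformal factor is [(scf y)^-1]. *)
Definition scf (y : 'rV[R]_n) : R := 1 + 2 * dot beta y + dot beta beta * dot y y.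
Definition sct (y : 'rV[R]_n) : 'rV[R]_n := (scf y)^-1 *: (y + dot y y *: beta).

Variables (m : nat) (W : set 'rV[R]_m) (y : 'rV[R]_m -> 'rV[R]_n).
Hypotheses (oW : relopen false W) (sy : vsmooth false W y).
Hypothesis pos : forall x, W x -> 0 < scf (y x).
Local Notation J := (vd false).
Local Notation d := (dd false).

Let sb : vsmooth false W (fun=> beta) := vsmooth_cst oW beta.
Let sby : smooth_on false W (fun x => dot beta (y x)) := smooth_dot oW sb sy.
Let syy : smooth_on false W (fun x => dot (y x) (y x)) := smooth_dot oW sy sy.
Let sc c : smooth_on false W (fun=> c) := smooth_cst oW c.

Lemma smooth_scf : smooth_on false W (fun x => scf (y x)).
Proof.
rewrite /scf; apply: smoothD => //; last exact: smoothM.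
by apply: smoothD => //; apply: smoothM.
Qed.

Let A x := y x + dot (y x) (y x) *: beta.

Let sA : vsmooth false W A.
Proof. by apply: vsmoothD => //; apply: vsmoothZ. Qed.

Lemma smooth_sct : vsmooth false W (fun x => sct (y x)).
Proof.
apply: (vsmoothZ oW _ sA); apply: smoothV => //; first exact: smooth_scf.
by move=> x Wx; rewrite gt_eqF // pos.
Qed.

Let dby u x : W x -> d u (fun x => dot beta (y x)) x = dot beta (J u y x).
Proof.
move=> Wx; rewrite (dd_dot oW u sb sy Wx) (vd_cst oW) //.
by rewrite /dot bil0l add0r.
Qed.

Let dyy u x : W x -> d u (fun x => dot (y x) (y x)) x = 2 * dot (y x) (J u y x).
Proof. by move=> Wx; rewrite (dd_dot oW u sy sy Wx) (dotC (J u y x)) mulr_natl. Qed.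

Let dsc u x : W x -> d u (fun x => scf (y x)) x =
  2 * dot beta (J u y x) + 2 * (dot beta beta * dot (y x) (J u y x)).
Proof.
move=> Wx; have s2 : smooth_on false W (fun x => 2 * dot beta (y x)) by apply: smoothM.
have s3 : smooth_on false W (fun x => dot beta beta * dot (y x) (y x)) by apply: smoothM.
have s4 : smooth_on false W (fun x => 1 + 2 * dot beta (y x)) by apply: smoothD.
rewrite (ddD oW u s4 s3 Wx) (ddD oW u (sc 1) s2 Wx) (dd_cst oW) //.
by rewrite (ddZ oW u 2 sby Wx) (ddZ oW u _ syy Wx) dby // dyy //; ring.
Qed.

Let JA u x : W x -> J u A x = J u y x + (2 * dot (y x) (J u y x)) *: beta.
Proof.
move=> Wx; rewrite (vdD oW u sy (vsmoothZ oW syy sb) Wx) (vdZ oW u syy sb Wx).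
by rewrite (vd_cst oW) // scaler0 addr0 dyy.
Qed.

Let sctE x : W x -> scf (y x) *: sct (y x) = A x.
Proof. by move=> Wx; rewrite scalerA divff ?scale1r // gt_eqF // pos. Qed.

(** The derivative of [scf] times [sct] rather than of a quotient: in this form it can be
    differentiated again for [hess_sct]. *)
Lemma vd_sct u x : W x -> d u (fun x => scf (y x)) x *: sct (y x) +
  scf (y x) *: J u (fun x => sct (y x)) x = J u y x + (2 * dot (y x) (J u y x)) *: beta.
Proof.
move=> Wx; rewrite -JA // -(vdZ oW u smooth_scf smooth_sct Wx).
exact: (vd_eq oW u Wx).
Qed.

Lemma dot_sct u v x : W x ->
  dot (J u (fun x => sct (y x)) x) (J v (fun x => sct (y x)) x) =
  (scf (y x) ^+ 2)^-1 * dot (J u y x) (J v y x).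
Proof.
move=> Wx; have s0 : scf (y x) != 0 by rewrite gt_eqF // pos.
have D w : J w (fun x => sct (y x)) x = (scf (y x) ^+ 2)^-1 *:
    (scf (y x) *: (J w y x + (2 * dot (y x) (J w y x)) *: beta)
     - (2 * dot beta (J w y x) + 2 * (dot beta beta * dot (y x) (J w y x))) *: A x).
  have := vd_sct w Wx; rewrite dsc //; move: (J w y x + _) (2 * _ + _) => B ds /rowP EB.
  have := sctE Wx; move: (A x) => Ax /rowP EA; apply/rowP => j.
  rewrite !(rowZ, rowD, rowN) -EB -EA !(rowD, rowZ).
  move: s0; move: (scf _) (sct (y x) 0 j) (J w (fun z => sct (y z)) x 0 j) => s t T s0.
  by field.
rewrite !D /A /dot !(bilZl, bilZr, bilDl, bilDr, bilBl, bilBr, bilNl, bilNr) -!/(dot _ _).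
rewrite (dotC (J u y x) beta) (dotC (J u y x) (y x)).
rewrite (dotC (y x) beta).
move: s0; rewrite /scf.
move: (dot beta _) (dot beta (J u y x)) (dot beta (J v y x)) (dot (y x) _)
  (dot (y x) (J u y x)) (dot (y x) (J v y x)) (dot (J u y x) (J v y x)) (dot beta beta).
move=> q bu bv p yu yv uv bb s0.
by field.
Qed.

(** At the origin, where the map is tangent to the identity, the only new term that need not be
    tangent to the image is twice the inner product times beta; this is what allows a mean curvature
    vector to be removed. *)
Lemma hess_sct u v x : W x -> y x = 0 ->
  J u (J v (fun x => sct (y x))) x = J u (J v y) x + (2 * dot (J u y x) (J v y x)) *: beta
    - (2 * dot beta (J u y x)) *: J v (fun x => sct (y x)) x
    - (2 * dot beta (J v y x)) *: J u (fun x => sct (y x)) x.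
Proof.
move=> Wx y0; have ss := smooth_scf; have st := smooth_sct.
have s1 : scf (y x) = 1 by rewrite /scf y0 /dot !bil0r !mulr0 !addr0.
have t0 : sct (y x) = 0 by rewrite /sct y0 /dot bil0l scale0r addr0 scaler0.
have sJ : vsmooth false W (J v y) := smooth_vd oW v sy.
have sd : smooth_on false W (fun x => dot (y x) (J v y x)) := smooth_dot oW sy sJ.
have s2d : smooth_on false W (fun x => 2 * dot (y x) (J v y x)) by apply: smoothM.
have sds : smooth_on false W (d v (fun x => scf (y x))) by apply: (smooth_dd oW).
have sJt : vsmooth false W (J v (fun x => sct (y x))) := smooth_vd oW v st.
have : J u (fun x => d v (fun x => scf (y x)) x *: sct (y x) +
  scf (y x) *: J v (fun x => sct (y x)) x) x =
  J u (fun x => J v y x + (2 * dot (y x) (J v y x)) *: beta) x.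
  by apply: (vd_eq oW u Wx) => z Wz; rewrite vd_sct.
rewrite (vdD oW u (vsmoothZ oW sds st) (vsmoothZ oW ss sJt) Wx).
rewrite (vdZ oW u sds st Wx) (vdZ oW u ss sJt Wx).
rewrite (vdD oW u sJ (vsmoothZ oW s2d sb) Wx) (vdZ oW u s2d sb Wx) (vd_cst oW) //.
rewrite (ddZ oW u 2 sd Wx) (dd_dot oW u sy sJ Wx) !dsc // s1 t0 y0.
rewrite /dot !bil0l -!/(dot _ _) !mulr0 !addr0 !scaler0 !scale1r addr0 add0r => /eqP.
rewrite addrA addrC -subr_eq => /eqP <-.
by apply/rowP => j; rewrite !(rowD, rowN); ring.
Qed.

End SpecialConformal.

Section LocalFlat.
Context {R : realType}.
Variables (k n : nat) (V : set 'rV[R]_n) (W : set 'rV[R]_k).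
Variables (g : 'rV[R]_n -> 'M[R]_n) (h : 'rV[R]_k -> 'M[R]_k).
Variables (f : 'rV[R]_k -> 'rV[R]_n) (psi : 'rV[R]_n -> 'rV[R]_n) (om : 'rV[R]_n -> R).
Hypotheses (oV : relopen false V) (oW : relopen false W) (WV : forall y, W y -> V (f y)).
Hypotheses (mg : metric_on false V g) (mh : metric_on false W h).
Hypotheses (sf : vsmooth false W f) (spsi : vsmooth false V psi) (som : smooth_on false V om).
Local Notation J := (vd false).
Hypothesis iso : forall y a c, W y -> bil (h y) a c = bil (g (f y)) (J a f y) (J c f y).
Hypothesis umb : forall y, W y -> exists H, forall u v,
  covphi false false g f u (J v f) y = J (Gam false h y u v) f y + bil (h y) u v *: H.
Hypothesis cf : forall x a c, V x ->
  bil (g x) a c = expR (2 * om x) * dot (J a psi x) (J c psi x).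
Hypothesis k2 : (1 < k)%N.

(* After composing psi with a special conformal transformation fixing p, the
   mean curvature vector of the image of S at p vanishes. *)
Lemma umbilic_locally_flat p : W p -> exists (V' : set 'rV[R]_n) (om' : 'rV[R]_n -> R) (e : R),
  [/\ relopen false V' /\ V' `<=` V, smooth_on false V' om', 0 < e /\ box p e `<=` W,
   (forall y, box p e y -> V' (f y)) &
   let h0 := conf h (fun y => - om' (f y)) in
   metric_on false (box p e) h0 /\
   forall y u v w, box p e y -> Rm false h0 y u v w = 0].
Proof.
move=> Wp; pose phi y := psi (f y).
have sphi : vsmooth false W phi by apply: (smooth_flatten oV oW WV sf spsi).
have [H EH] := umbilic_flatten oV oW WV mg mh sf spsi som iso umb cf Wp.
have isf := iso_flatten oV oW WV sf spsi iso cf.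
(* By [hess_sct] the mean curvature vector H at p acquires 2 beta, so this beta cancels it. *)
pose c := phi p; pose beta := - 2^-1 *: H.
pose x' x := psi x - c.
have sx' : vsmooth false V x'.
  by apply: (vsmoothD oV spsi (Y := fun=> - c)); apply: (vsmooth_cst oV).
have ss := smooth_scf beta oV sx'.
pose V' := V `&` [set x | 0 < scf beta (x' x)].
have oV' : relopen false V' := relopen_pos oV ss.
have V'V : V' `<=` V by move=> x [].
have sx'' : vsmooth false V' x' by move=> j; apply: (smooth_sub V'V).
have pos x : V' x -> 0 < scf beta (x' x) by case.
have ss' := smooth_scf beta oV' sx''.
pose om' x := om x + ln (scf beta (x' x)).
have som' : smooth_on false V' om'.
  by apply: smoothD => //; [exact: (smooth_sub V'V)|apply: smooth_ln].
pose psi' x := sct beta (x' x).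
have spsi' : vsmooth false V' psi' := smooth_sct oV' sx'' pos.
pose W' := W `&` [set y | 0 < scf beta (phi y - c)].
have sy : vsmooth false W (fun y => phi y - c).
  by apply: (vsmoothD oW sphi (Y := fun=> - c)); apply: (vsmooth_cst oW).
have oW' : relopen false W' := relopen_pos oW (smooth_scf beta oW sy).
have W'W : W' `<=` W by move=> y [].
have W'V' y : W' y -> V' (f y) by move=> [Wy py]; split=> //; exact: WV.
have W'p : W' p by split=> //=; rewrite subrr /scf /dot !bil0r !mulr0 !addr0.
have Jx' a x : V x -> J a x' x = J a psi x.
  move=> Vx; rewrite (vdD oV a spsi (Y := fun=> - c) _ Vx) ?(vd_cst oV) ?addr0 //.
  exact: (vsmooth_cst oV).
have Jy a y : W y -> J a (fun y => phi y - c) y = J a phi y.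
  move=> Wy; rewrite (vdD oW a sphi (Y := fun=> - c) _ Wy) ?(vd_cst oW) ?addr0 //.
  exact: (vsmooth_cst oW).
have mg' := metric_on_sub V'V mg; have mh' := metric_on_sub W'W mh.
have sf' : vsmooth false W' f by move=> j; apply: (smooth_sub W'W).
have iso' y a e : W' y -> bil (h y) a e = bil (g (f y)) (J a f y) (J e f y).
  by move=> /W'W; apply: iso.
have umb' y : W' y -> exists H, forall u v,
  covphi false false g f u (J v f) y = J (Gam false h y u v) f y + bil (h y) u v *: H.
  by move=> /W'W; apply: umb.
have cf' x a e : V' x -> bil (g x) a e = expR (2 * om' x) * dot (J a psi' x) (J e psi' x).
  move=> V'x; rewrite (dot_sct oV' sx'' pos a e V'x) !Jx' ?cf; try exact: V'V.
  have px := pos _ V'x.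
  rewrite /om' mulrDr expRD (mulr_natl (ln _)) mulr2n expRD lnK ?posrE //.
  by move: px => /lt0r_neq0; move: (scf _ _) (expR _) => s E s0; gen_atoms; field.
have [H' EH'] := umbilic_flatten oV' oW' W'V' mg' mh' sf' spsi' som' iso' umb' cf' W'p.
have isf' := iso_flatten oV' oW' W'V' sf' spsi' iso' cf'.
have mh0 := metric_flatten oV' oW' W'V' mh' sf' som'.
have sphi' := smooth_flatten oV' oW' W'V' sf' spsi'.
pose h0 := conf h (fun y => - om (f y)).
pose h0' := conf h (fun y => - om' (f y)).
pose phi' y := psi' (f y).
have sy' : vsmooth false W' (fun y => phi y - c) by move=> j; apply: (smooth_sub W'W).
have pos' y : W' y -> 0 < scf beta (phi y - c) by case.
have J1 a : J a phi' p = J a phi p.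
  have := vd_sct oW' sy' pos' a W'p.
  rewrite subrr Jy // /dot !bil0l mulr0 scale0r addr0.
  have -> : sct beta 0 = 0 by rewrite /sct /dot bil0l scale0r addr0 scaler0.
  by rewrite scaler0 add0r {1}/scf /dot !bil0r !mulr0 !addr0 scale1r.
have J2 u v : J u (J v (fun y => phi y - c)) p = J u (J v phi) p.
  by apply: (vd_eq oW u Wp) => z Wz; rewrite Jy.
(* With this beta, all second derivatives of phi' at p are tangent to the image. *)
have K u v : exists X, J u (J v phi') p = J X phi' p.
  exists (Gam false h0 p u v - (2 * dot beta (J u phi p)) *: v - (2 * dot beta (J v phi p)) *: u).
  have := hess_sct oW' sy' pos' u v W'p (subrr _).
  rewrite J2 !Jy // EH -isf // => ->.
  rewrite !(vdDl, vdNl, vdZl) !J1 /beta scalerA.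
  apply: row_eq_ring => j; rewrite !(rowD, rowN, rowZ).
  by gen_atoms; field.
have orth w : dot H' (J w phi' p) = 0.
  pose e0 : 'rV[R]_k := delta_mx 0 (Ordinal k2).
  have := dot_hess oW' mh0 sphi' isf' e0 e0 w W'p; rewrite EH' /dot bilDl bilZl => /eqP.
  rewrite addrC -subr_eq0 addrK mulf_eq0 gt_eqF /=; first by move/eqP.
  by case: mh0 => _ _; apply => //; exact: delta_neq0.
(* H' is normal by [orth], and a multiple of it is tangent by [K]. *)
have H0 : H' = 0.
  pose e0 : 'rV[R]_k := delta_mx 0 (Ordinal k2).
  have h1 : bil (h0' p) e0 e0 != 0.
    by rewrite gt_eqF //; case: mh0 => _ _; apply => //; exact: delta_neq0.
  apply: dot_eq0; apply: (mulfI h1); rewrite mulr0.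
  have [X EX] := K e0 e0; have := EH' e0 e0; rewrite EX addrC => /eqP; rewrite -subr_eq => /eqP E.
  by rewrite /dot -bilZr -E -vdNl -vdDl -/(dot _ _) orth.
have [e e0 [eW flat]] := umbilic_flat oW' mh0 sphi' isf'
  (fun y W'y => umbilic_flatten oV' oW' W'V' mg' mh' sf' spsi' som' iso' umb' cf' W'y) k2 W'p
  (fun u v => etrans (EH' u v) (etrans (congr1 (fun H => _ + _ *: H) H0)
     (etrans (congr1 _ (scaler0 _ _)) (addr0 _)))).
exists V', om', e; split=> //.
- by split=> //; apply: subset_trans W'W.
- by move=> y /eW /W'V'.
- by split=> //; apply: (metric_on_sub eW).
Qed.

End LocalFlat.

Lemma iter_nlap_eq (R : realType) b n (V : set 'rV[R]_n) g f f' l : relopen b V ->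
  (forall y, V y -> f y = f' y) ->
  forall y, V y -> iter l (nlap b g) f y = iter l (nlap b g) f' y.
Proof.
move=> oV ff; elim: l => [|l IH] y Vy /=; first exact: ff.
by congr (- _); apply: (laplacian_eq oV (g' := g) _ Vy).
Qed.

(** * The GJMS operator in coordinates *)

Section Local.
Context {R : realType}.
Variables (k : nat) (V : set 'rV[R]_k.+1) (g : 'rV[R]_k.+1 -> 'M[R]_k.+1).
Variables (r a0 : 'rV[R]_k.+1 -> R) (hp : 'rV[R]_k.+1 -> 'M[R]_k.+1).
Hypotheses (oV : relopen true V) (Vproj : forall x, V x -> V (wall_proj x)).
Hypotheses (mg : metric_on true V g) (sr : smooth_on true V r).
Hypotheses (r0 : forall x, wall V x -> r x = 0) (rp : forall x, V x -> 0 < x 0 ord0 -> 0 < r x).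
Hypothesis dr1 : forall x, wall V x -> dd true (gr true g r x) r x = 1.
Hypothesis hpE : forall x, V x -> 0 < x 0 ord0 -> g x = r x ^+ 2 *: hp x.
Hypothesis hyp : forall x, V x -> 0 < x 0 ord0 -> sectional_curvature_eq true hp (-1) x.
Hypothesis sa0 : smooth_on true V a0.
Variables (W : set 'rV[R]_k) (h : 'rV[R]_k -> 'M[R]_k) (j : 'rV[R]_k -> 'rV[R]_k.+1).
Variable sigma : 'rV[R]_k -> R.
Hypotheses (oW : relopen false W) (sj : vsmooth false W j).
Hypotheses (jW : forall y, W y -> wall V (j y)) (jsurj : forall x, wall V x -> exists2 y, W y & j y = x).
Hypothesis iso : forall y a c, W y ->
  bil (h y) a c = bil (g (j y)) (vd false a j y) (vd false c j y).
Hypothesis a0j : forall y, W y -> a0 (j y) = sigma y.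
Hypothesis mh : metric_on false W (conf h sigma).
Hypothesis flat : forall y u v w, W y -> Rm false (conf h sigma) y u v w = 0.
Hypothesis k3 : (3 <= k)%N.
Variable l : nat.
Hypothesis l1 : (1 <= l)%N.
Variable F : 'rV[R]_k.+1 -> R.
Hypothesis sF : smooth_on true V F.

Let s : R := k%:R / 2 - l%:R.
Let Lu x := laplacian true hp (fun y => r y `^ s * F y) x
  + ((k%:R / 2) ^+ 2 - l%:R ^+ 2) * (r x `^ s * F x).

Hypothesis bound : forall y, W y -> exists C, \forall t \near 0^'+,
  `|Lu (up (j y) t)| <= C * r (up (j y) t) `^ (k%:R / 2 + l%:R).

Let sm f := smooth_on true V f.
Let Vi := V `&` [set x | 0 < x 0 ord0].
Let oVi : relopen true Vi.
Proof. by apply: relopen_pos => //; apply: smooth_coord. Qed.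

Let vr : van V 1 r. Proof. by move=> x wx [|i] // _; apply: r0. Qed.

Lemma r_lim x : wall V x -> r (up x t) / t @[t --> 0^'+] --> pd true ord0 r x.
Proof.
move=> wx; have := taylor_lim oV (N := 1) sr wx (fun i i1 => van_tc vr i1 wx).
by have := @tcS R k 0 r x; rewrite mul1r tc0 => ->.
Qed.

Lemma pd_r_neq0 x : wall V x -> pd true ord0 r x != 0.
Proof.
move=> wx; have := dr1 wx; rewrite (van_dd_wall oV sr vr wx) => /eqP; apply: contraTneq => ->.
by rewrite mulr0 eq_sym oner_eq0.
Qed.

Lemma up_Vi x : wall V x -> \forall t \near 0^'+, Vi (up x t) /\ 0 < t.
Proof.
move=> wx; have [e e0 He] := up_near oV wx.
near=> t; have t0 : 0 < t by near: t; apply: nbhs_right_gt.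
split=> //; split; first by apply: He; rewrite ltW //=; near: t; exact: nbhs_right_le.
by rewrite /= stepE wx.2 eqxx mulr1 add0r.
Unshelve. all: by end_near.
Qed.

(** With rho = r exp(a) and F' = exp(-s a) F the function u is unchanged, so the hypotheses on [Lu]
    become the vanishing of Q to order 2l and a limit for its next coefficient, which [tc_Q]
    evaluates. The exponentials in the conclusion are those relating the two pairs at the wall. *)
Lemma gjms_local y0 L : W y0 ->
  gjms_const l * (r (up (j y0) t) `^ (- (k%:R / 2) - l%:R) * Lu (up (j y0) t)) @[t --> 0^'+] --> L ->
  L = expR ((k%:R / 2 + l%:R) * sigma y0) *
    iter l (nlap false (conf h sigma)) (fun z => expR (- s * sigma z) * F (j z)) y0.
Proof.
(* 2l + 2 is the order of the eikonal equation under which [tc_Q] is available. *)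
move=> Wy0 hL; have [a [sa aw] va] := eikonal_solution oV mg sr r0 dr1 sa0 Vproj (2 * l + 2).
pose rho x := r x * expR (a x); pose F' x := expR (- s * a x) * F x.
have sc c : sm (fun=> c) by apply: smooth_cst.
have sea : sm (fun x => expR (a x)) by apply: smooth_exp.
have srho : sm rho by apply: smoothM.
have sexp c : sm (fun x => expR (c * a x)).
  by apply: (smooth_exp oV); exact: (smoothM oV (sc c) sa).
have sF' : sm F' := smoothM oV (sexp _) sF.
have mc := metric_conf oV mg sa.
have rho0 x : wall V x -> rho x = 0 by move=> wx; rewrite /rho r0 // mul0r.
have rhop x : V x -> 0 < x 0 ord0 -> 0 < rho x.
  by move=> Vx x0; rewrite mulr_gt0 ?expR_gt0 // rp.
have E2 x : rho x ^+ 2 = expR (2 * a x) * r x ^+ 2.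
  by rewrite /rho exprMn mulrC expr2 -expRD mulrDl mul1r.
have hpE' x : V x -> 0 < x 0 ord0 -> hp x = (rho x ^+ 2)^-1 *: conf g a x.
  move=> Vx x0; rewrite /conf E2 hpE // !scalerA -[LHS]scale1r; congr (_ *: _).
  have e0 := expR_gt0 (2 * a x); have rx := rp Vx x0.
  move: (expR _) (r x) e0 rx => e z /lt0r_neq0 e0 /lt0r_neq0 z0.
  by field; rewrite e0 z0.
have ve : van V (2 * l + 2) (eik (conf g a) rho).
  by apply: (van_eq oV _ va) => x Vx; rewrite (eik_conf oV mg sr sa Vx).
pose Q := Qop true (conf g a) rho F' l%:R s.
have sQ : sm Q by apply: (smooth_Q oV mc srho _ sF').
have LuE x : Vi x -> Lu x = rho x `^ s * Q x.
  move=> Vix; have [Vx x0] := Vix; have ViV : Vi `<=` V by move=> z [].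
  have := lap_model oVi (metric_on_sub ViV mc) (smooth_sub ViV srho)
    (fun x Vx => rhop x Vx.1 Vx.2) (smooth_sub ViV sF') l%:R Vix.
  rewrite -/s -/Q => <-.
  have uE z : Vi z -> r z `^ s * F z = rho z `^ s * F' z.
    move=> [Vz z0]; rewrite /rho powRM ?expR_ge0 ?ltW ?rp // -expRM /F' mulrA.
    rewrite -(mulrA (r z `^ s)) -expRD (_ : _ + _ = 0) ?expR0 ?mulr1 //; ring.
  by rewrite /Lu (laplacian_eq oVi (fun z Viz => hpE' z Viz.1 Viz.2) Vix uE) uE.
have QE x : Vi x -> Q x = expR (- s * a x) * r x `^ (- s) * Lu x.
  move=> Vix; have [Vx x0] := Vix; rewrite LuE // /rho powRM ?expR_ge0 ?ltW ?rp //.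
  rewrite -expRM.
  have e1 : expR (- s * a x) * expR (a x * s) = 1.
    by rewrite -expRD (_ : _ + _ = 0) ?expR0 //; ring.
  have e2 : r x `^ (- s) * r x `^ s = 1.
    by rewrite -powRD ?addNr ?powRr0 //; apply/implyP => _; rewrite gt_eqF // rp.
  transitivity ((expR (- s * a x) * expR (a x * s)) * (r x `^ (- s) * r x `^ s) * Q x).
    by rewrite e1 e2 !mul1r.
  by move: (expR _) (expR _) (powR _ _) (powR _ _) (Q x) => *; ring.
have rpw x : Vi x -> r x `^ (- s) * r x `^ (k%:R / 2 + l%:R) = r x ^+ (2 * l).
  move=> [Vx x0]; have rx := rp Vx x0; rewrite -powR_mulrn ?ltW //.
  rewrite -powRD; last by apply/implyP => _; rewrite gt_eqF.
  by congr (_ `^ _); rewrite /s natrM; ring.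
have vQ : van V (2 * l) Q.
  move=> x wx i il; have [y Wy yx] := jsurj wx; rewrite -yx in wx *.
  have [C hC] := bound Wy.
  have T : tc i Q (j y) = 0.
    (* The bound on [Lu], transported to Q and divided by t^(2l). It converges, so the constant G0 +
       1 dominates it near 0; C itself may be negative, whence its absolute value. *)
    pose G t := `|C| * expR (- s * a (up (j y) t)) * (r (up (j y) t) / t) ^+ (2 * l).
    have GL : G t @[t --> 0^'+] --> `|C| * expR (- s * a (j y)) * (pd true ord0 r (j y)) ^+ (2 * l).
      apply: cvgM; first by apply: cvgM; [exact: cvg_cst|exact: (cont_up oV (sexp _) wx)].
      exact: (cvg_comp _ _ (r_lim wx) (@exprn_continuous _ _ _)).
    set G0 := `|C| * _ * _ in GL.
    apply: (tc_bound oV (C := G0 + 1) sQ wx _ il).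
    have GB : \forall t \near 0^'+, G t < G0 + 1.
      by move/cvgrPdist_lt : GL => /(_ 1 ltr01); apply: filterS => t;
        rewrite distrC ltr_norml => /andP[_]; rewrite ltrBlDr addrC.
    near=> t; have [Vit t0] : Vi (up (j y) t) /\ 0 < t by near: t; exact: up_Vi.
    have : `|Lu (up (j y) t)| <= C * r (up (j y) t) `^ (k%:R / 2 + l%:R) by near: t; exact: hC.
    have : G t < G0 + 1 by near: t; exact: GB.
    rewrite QE // normrM ger0_norm; last by rewrite mulr_ge0 ?expR_ge0 ?powR_ge0.
    rewrite /G expr_div_n -(rpw _ Vit).
    have e0 := expR_gt0 (- s * a (up (j y) t)).
    have p0 : 0 <= r (up (j y) t) `^ (- s) := powR_ge0 _ _.
    have q0 : 0 <= r (up (j y) t) `^ (k%:R / 2 + l%:R) := powR_ge0 _ _.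
    have tl : 0 < t ^+ (2 * l) by rewrite exprn_gt0.
    move: (powR _ (- s)) p0 (powR _ _) q0 (expR _) e0 (Lu _) (t ^+ _) tl => p p0 q q0 e e0 u T T0 H1 H2.
    have H3 : `|u| <= `|C| * q by apply: le_trans H2 _; rewrite ler_wpM2r // ler_norm.
    apply: le_trans (_ : e * p * (`|C| * q) <= _).
      by apply: ler_wpM2l => //; rewrite mulr_ge0 // ltW.
    rewrite -ler_pdivrMr //; apply: le_trans (ltW H1).
    by rewrite le_eqVlt; apply/orP; left; apply/eqP; ring.
  have := T; rewrite /tc => /eqP; rewrite mulf_eq0 invr_eq0 pnatr_eq0.
  by rewrite -leqn0 leqNgt fact_gt0 orbF => /eqP.
have wx := jW Wy0.
have iso' y b c : W y -> bil (conf h sigma y) b c =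
    bil (conf g a (j y)) (vd false b j y) (vd false c j y).
  by move=> Wy; rewrite !bil_conf iso // aw ?a0j //; apply: jW.
have K := tc_Q oV mc srho rho0 rhop hpE' hyp l1 (leqnn _) ve oW mh sj jW jsurj iso' flat k3 sF' vQ Wy0.
have pdrho : pd true ord0 rho (j y0) = expR (sigma y0) * pd true ord0 r (j y0).
  rewrite -!dd_delta (ddM oV _ sr sea wx.1) r0 // mul0r addr0 aw // a0j // mulrC //.
(* The powers of r in the definition of P are compared with t^(2l): r / t tends to d_0 r. *)
have lim2 : gjms_const l * (expR (s * a (up (j y0) t)) *
     (Q (up (j y0) t) / t ^+ (2 * l)) * ((r (up (j y0) t) / t) ^+ (2 * l))^-1) @[t --> 0^'+] -->
   gjms_const l * (expR (s * a (j y0)) * tc (2 * l) Q (j y0) * ((pd true ord0 r (j y0)) ^+ (2 * l))^-1).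
  apply: cvgM; first exact: cvg_cst.
  apply: cvgM; first apply: cvgM.
  - exact: (cont_up oV (sexp _) wx).
  - exact: (taylor_lim oV sQ wx (fun i il => van_tc vQ il wx)).
  - apply: cvgV; first by rewrite expf_neq0 // pd_r_neq0.
    exact: (cvg_comp _ _ (r_lim wx) (@exprn_continuous _ _ _)).
have -> : L = gjms_const l * (expR (s * a (j y0)) * tc (2 * l) Q (j y0) * ((pd true ord0 r (j y0)) ^+ (2 * l))^-1).
  apply: (cvg_unique _ hL) => //; apply: cvg_trans lim2.
  apply: near_eq_cvg; near=> t; have [Vit t0] : Vi (up (j y0) t) /\ 0 < t by near: t; exact: up_Vi.
  congr (_ * _); rewrite QE //.
  have rx : 0 < r (up (j y0) t) by apply: rp; case: Vit.
  rewrite expr_div_n -rpw //.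
  have -> : - (k%:R / 2) - l%:R = - (k%:R / 2 + l%:R) :> R by ring.
  rewrite (powRN _ (k%:R / 2 + l%:R)).
  have e1 : expR (s * a (up (j y0) t)) * expR (- s * a (up (j y0) t)) = 1.
    by rewrite -expRD (_ : _ + _ = 0) ?expR0 //; ring.
  have p0 : 0 < r (up (j y0) t) `^ (- s) by rewrite powR_gt0.
  have q0 : 0 < r (up (j y0) t) `^ (k%:R / 2 + l%:R) by rewrite powR_gt0.
  have tl : 0 < t ^+ (2 * l) by rewrite exprn_gt0.
  move: (expR _) (expR _) e1 (powR _ (- s)) p0 (powR _ _) q0 (Lu _) (t ^+ _) tl => e e' e1 p p0 q q0 u T T0.
  transitivity ((e' * e) * (q^-1 * u)); last by rewrite e1 mul1r.
  by field; rewrite !gt_eqF.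
have -> : gjms_const l * (expR (s * a (j y0)) * tc (2 * l) Q (j y0) * (pd true ord0 r (j y0) ^+ (2 * l))^-1) =
   expR (s * a (j y0)) * (pd true ord0 r (j y0) ^+ (2 * l))^-1 * (gjms_const l * tc (2 * l) Q (j y0)) by ring.
rewrite K pdrho exprMn -expRM_natl aw // a0j //.
have r1 : pd true ord0 r (j y0) ^+ (2 * l) != 0 by rewrite expf_neq0 // pd_r_neq0.
(* k/2 + l = s + 2l: the first factor comes from conjugating by powers of rho and r, the second from
   d_0 rho = exp(sigma) d_0 r. *)
have -> : expR ((k%:R / 2 + l%:R) * sigma y0) = expR (s * sigma y0) * expR ((2 * l)%:R * sigma y0).
  by rewrite -expRD; congr expR; rewrite /s natrM; ring.
have -> : iter l (nlap false (conf h sigma)) (fun z => F' (j z)) y0 =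
    iter l (nlap false (conf h sigma)) (fun z => expR (- s * sigma z) * F (j z)) y0.
  apply: (@iter_nlap_eq _ _ _ W) => // y Wy.
  by rewrite /F' aw ?a0j //; apply: jW.
move: (iter _ _ _ _) (expR _) (expR _) (pd _ _ _ _ ^+ _) r1 => I e e' p p0.
by field.
Unshelve. all: by end_near.
Qed.

End Local.

(** * Charts *)

Section Relopen.
Context {R : realType}.

Lemma relopenI b n (V W : set 'rV[R]_n) : relopen b V -> relopen b W -> relopen b (V `&` W).
Proof.
move=> oV oW; split=> [x [/(oV.1) //]|x [Vx Wx]].
have [e e0 he] := oV.2 _ Vx; have [d d0 hd] := oW.2 _ Wx.
exists (Num.min d e); first by rewrite lt_min d0 e0.
move=> y [my hy]; split; [apply: he|apply: hd]; split=> // i.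
  by have := hy i; rewrite lt_min => /andP[].
by have := hy i; rewrite lt_min => /andP[].
Qed.

Lemma vcont_boxP b m n (W : set 'rV[R]_m) (f : 'rV[R]_m -> 'rV[R]_n) x (e : R) :
  vsmooth b W f -> W x -> 0 < e ->
  exists2 d, 0 < d & forall y, W y -> box x d y -> box (f x) e (f y).
Proof.
move=> sf Wx e0.
have /choice[d hd] i : exists d, 0 < d /\ forall y, W y -> box x d y -> `|f x 0 i - f y 0 i| < e.
  by have /cont_boxP/(_ x Wx _ e0)[d d0 hd] := smooth_cont (sf i); exists d.
exists (\big[Num.min/1]_i d i).
  by elim/big_ind: _ => [//|a c a0 c0|i _]; [rewrite lt_min a0 c0|case: (hd i)].
move=> y Wy hy i; rewrite distrC; apply: (hd i).2 => // i'.
by apply: lt_le_trans (hy i') _; apply: bigmin_le_cond.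
Qed.

Lemma relopen_preim b b' m n (W : set 'rV[R]_m) (V : set 'rV[R]_n) f :
  relopen b W -> vsmooth b W f -> relopen b' V -> (forall y, W y -> model b' (f y)) ->
  relopen b (W `&` [set y | V (f y)]).
Proof.
move=> oW sf oV mf; split=> [x [/(oW.1) //]|x [Wx Vx]].
have [e e0 he] := oV.2 _ Vx; have [d d0 hd] := vcont_boxP sf Wx e0.
have [c c0 hc] := oW.2 _ Wx.
exists (Num.min c d); first by rewrite lt_min d0 c0.
move=> y [my hy]; have Wy : W y.
  by apply: hc; split=> // i; have := hy i; rewrite lt_min => /andP[].
split=> //; apply: he; split; first exact: mf.
by apply: hd => // i; have := hy i; rewrite lt_min => /andP[].
Qed.

End Relopen.

Section Charts.
Context {R : realType}.

Lemma chart_relopen (T : topologicalType) b n (c : chart R T n) (A : set T) :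
  is_chart b c -> open A -> relopen b (chart_map c @` (chart_dom c `&` A)).
Proof.
move=> [odom [G [oG EG]] cK _ ci] oA; split=> [x [p [dp _] <-]|x [p [dp Ap] <-]].
  have : (chart_map c @` chart_dom c) (chart_map c p) by exists p.
  by rewrite EG => - [].
have Ip : (chart_map c @` chart_dom c) (chart_map c p) by exists p.
have [Op _] : (G `&` model b (n := n)) (chart_map c p) by rewrite -EG.
have /nbhs_boxP[d d0 hd] : nbhs (chart_map c p) G by apply: open_nbhs_nbhs.
have nA : nbhs (chart_inv c (chart_map c p)) A by rewrite cK //; apply: open_nbhs_nbhs.
have /subspace_continuousP/(_ _ Ip)/(_ _ nA) := ci; rewrite /= /within /= => /nbhs_boxP[e e0 he].
exists (Num.min d e); first by rewrite lt_min d0 e0.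
move=> y [my hy]; have : (chart_map c @` chart_dom c) y.
  rewrite EG; split=> //; apply: hd => i.
  by have := hy i; rewrite lt_min => /andP[].
move=> Iy; have [q dq qy] := Iy; exists q => //; split=> //.
rewrite -(cK q dq) qy; apply: he => // i.
by have := hy i; rewrite lt_min => /andP[].
Qed.

Lemma metric_chart (T : Type) b n (A : set (chart R T n)) D g c (V : set 'rV[R]_n) :
  is_metric b A D g -> A c -> V `<=` chart_map c @` (D `&` chart_dom c) -> metric_on b V (g c).
Proof.
move=> [s1 s2 s3 _] Ac VI; split=> [i j|x /VI[p [Dp dp] <-]|x /VI[p [Dp dp] <-] v v0].
- exact: (smooth_sub VI (s1 c Ac i j)).
- exact: s2.
- by have := s3 c p Ac Dp dp v v0; rewrite /inner bil_def.
Qed.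

End Charts.

Section Coordinates.
Context {R : realType}.

Lemma grad_norm2E b n (g : 'rV[R]_n -> 'M[R]_n) f x :
  grad_norm2 b g f x = dd b (gr b g f x) f x.
Proof.
rewrite ddE /grad_norm2 exchange_big /=; apply: eq_bigr => j _.
rewrite !mxE mulr_suml; apply: eq_bigr => i _; rewrite mxE; ring.
Qed.

Variables (b b' : bool) (m n : nat) (V : set 'rV[R]_n) (W : set 'rV[R]_m).
Variables (g : 'rV[R]_n -> 'M[R]_n) (h : 'rV[R]_m -> 'M[R]_m) (phi : 'rV[R]_m -> 'rV[R]_n).
Hypotheses (oV : relopen b V) (oW : relopen b' W).
Hypotheses (WV : forall y, W y -> V (phi y)) (sphi : vsmooth b' W phi).
Hypotheses (mg : metric_on b V g).
Hypothesis hE : forall y, W y -> h y = jac b' phi y *m g (phi y) *m (jac b' phi y)^T.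

Lemma iso_pullback y a c : W y ->
  bil (h y) a c = bil (g (phi y)) (vd b' a phi y) (vd b' c phi y).
Proof. by move=> Wy; rewrite hE // !vd_jac bil_mulmx. Qed.

Lemma metric_pullback : (forall y, W y -> row_free (jac b' phi y)) -> metric_on b' W h.
Proof.
move=> rf; split=> [i j|y Wy|y Wy v v0].
- have sJ u : vsmooth b' W (vd b' u phi) := smooth_vd oW u sphi.
  have sg : msmooth b' W (fun y => g (phi y)) := smooth_gphi oV oW WV sphi mg.
  apply: (smooth_eq oW _ (smooth_bil oW sg (sJ (delta_mx 0 i)) (sJ (delta_mx 0 j)))) => y Wy.
  by rewrite -iso_pullback // bil_delta.
- by rewrite hE // !trmx_mul trmxK mulmxA; case: mg => _ -> //; apply: WV.
- rewrite iso_pullback //; case: mg => _ _; apply; first exact: WV.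
  rewrite vd_jac; apply: contraNneq v0 => v0.
  by rewrite -(mul0mx _ (jac b' phi y)) in v0; rewrite (row_free_inj (rf y Wy) v0).
Qed.

Hypothesis mh : metric_on b' W h.

Lemma sff_cov y a e : sff b' b h g phi y a e =
  covphi b b' g phi (delta_mx 0 a) (vd b' (delta_mx 0 e) phi) y
  - vd b' (Gam b' h y (delta_mx 0 a) (delta_mx 0 e)) phi y.
Proof.
apply/rowP => p; rewrite /covphi mxE !(rowD, rowN).
have -> : vd b' (delta_mx 0 a) (vd b' (delta_mx 0 e) phi) y 0 p =
    pd b' a (pd b' e (fun z => phi z 0 p)) y.
  by rewrite vdjE vdE dd_delta; congr (pd _ _ _ _); apply/funext => z; rewrite dd_delta.
rewrite vdjE.
rewrite [in RHS]addrAC; congr (_ - _ + _).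
  by rewrite ddE; apply: eq_bigr => c _; rewrite GamjE bil_delta !mxE.
rewrite GamjE bilE; apply: eq_bigr => i _; apply: eq_bigr => c _.
by rewrite !mxE !dd_delta; ring.
Qed.

Lemma cov_extend y (H : 'rV[R]_n) : W y ->
  (forall a e, sff b' b h g phi y a e - h y a e *: H = 0) -> forall u v,
  covphi b b' g phi u (vd b' v phi) y = vd b' (Gam b' h y u v) phi y + bil (h y) u v *: H.
Proof.
move=> Wy sff0 u v; have [_ hs _] := mh.
pose T u v := covphi b b' g phi u (vd b' v phi) y - vd b' (Gam b' h y u v) phi y - bil (h y) u v *: H.
have TC a c : T a c = T c a.
  by rewrite /T (covphiC oV oW WV sphi mg) // (GamC oW mh) // bilC ?hs.
have TD a a' c : T (a + a') c = T a c + T a' c.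
  rewrite /T /covphi !vdDl !GamDl vdDl bilDl.
  apply: row_eq_ring => q; rewrite !(rowD, rowN, rowZ); move: (Gam _ _ _ _ _) => A; gen_atoms; ring.
have TZ x a c : T (x *: a) c = x *: T a c.
  rewrite /T /covphi !vdZl !GamZl vdZl bilZl.
  by apply: row_eq_ring => q; rewrite !(rowD, rowN, rowZ); ring.
have T0 a c : T (delta_mx 0 a) (delta_mx 0 c) = 0.
  by rewrite /T -sff_cov bil_delta sff0.
have Ts a : (forall i, T (delta_mx 0 i) a = 0) -> forall c, T c a = 0.
  move=> Ti c; rewrite (row_sum_delta c).
  elim/big_ind: _ => [|p q p0 q0|i _]; last by rewrite TZ Ti scaler0.
    by rewrite -(scale0r (0 : 'rV_m)) TZ scale0r.
  by rewrite TD p0 q0 addr0.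
have : T u v = 0 by apply: (Ts) => i; rewrite TC; apply: (Ts) => c; exact: T0.
by rewrite /T -addrA -opprD => /eqP; rewrite subr_eq0 => /eqP.
Qed.

End Coordinates.

(** * Boundary points and collar charts *)

Section Boundary.
Context {R : realType}.

(** Off the wall small steps of both signs are allowed, and a nonzero derivative would make f
    negative on one side. *)
Lemma pd_min k (D : set 'rV[R]_k.+1) f x i : relopen true D -> smooth_on true D f -> D x ->
  0 < x 0 ord0 -> f x = 0 -> (forall y, D y -> 0 <= f y) -> pd true i f x = 0.
Proof.
move=> oD sf Dx x0 fx f0; apply/eqP/negP => /negP l0.
set l := pd true i f x in l0.
have L : is_pd true i f x l := smooth_is_pd sf Dx.
have nl : 0 < `|l| by rewrite normr_gt0.
move/cvgrPdist_lt : L => /(_ _ nl) /incr_nearP[e e0 he].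
have /incr_nearP[d d0 hd] := relopen_near i oD Dx.
pose m := Num.min (x 0 ord0) (Num.min e d) / 2.
have mn : 0 < Num.min (x 0 ord0) (Num.min e d) by rewrite !lt_min x0 e0.
have m0 : 0 < m by rewrite divr_gt0.
have mm : m < Num.min (x 0 ord0) (Num.min e d) by rewrite ltr_pdivrMr // ltr_pMr // ltr1n.
move: mm; rewrite !lt_min => /and3P[mx me md].
have [s [s1 sl]] : exists s : R, `|s| = 1 /\ s * l < 0.
  have [lt0|lt0|le] := ltgtP l 0.
  - by exists 1; rewrite normr1 mul1r.
  - by exists (-1); rewrite normrN1 mulN1r oppr_lt0.
  - by rewrite le eqxx in l0.
pose t := s * m.
have tm : `|t| = m by rewrite normrM s1 mul1r gtr0_norm.
have t0 : t != 0 by rewrite -normr_gt0 tm.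
have mt : model true (x + t *: delta_mx 0 i).
  move=> _ a a0; rewrite stepE.
  have -> : a = ord0 by apply: val_inj.
  have xt : 0 <= x 0 ord0 + t.
    by rewrite -lerBlDr sub0r; apply: le_trans (ltW mx); rewrite -tm -normrN ler_norm.
  by case: eqP => _; rewrite ?mulr1 // mulr0 addr0 ltW.
have := he t t0; rewrite tm => /(_ me mt) /=.
have /f0 : D (x + t *: delta_mx 0 i) by apply: hd => //; rewrite tm.
rewrite /diff_quot fx subr0; move: (f _) => z z0; apply/negP; rewrite -leNgt.
have s2 : s != 0 by rewrite -normr_gt0 s1.
rewrite -[leLHS]mul1r -[leRHS]mul1r -!s1 -!normrM mulrBr.
have sz : 0 <= s * (t^-1 * z).
  have -> : s * (t^-1 * z) = m^-1 * z by rewrite /t; field; rewrite s2 lt0r_neq0.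
  by rewrite mulr_ge0 // invr_ge0 ltW.
move: (s * l) sl (s * (t^-1 * z)) sz => u u0 w w0.
have uw : u - w <= 0 by rewrite subr_le0; exact: le_trans (ltW u0) w0.
by rewrite (ler0_norm (ltW u0)) (ler0_norm uw) opprB lerDr.
Qed.

(** If q were interior for c', the first coordinate of c, as a function of the coordinates of c',
    would have an interior minimum at q. Its gradient would vanish, against the chain rule for a
    change of charts and its inverse. *)
Lemma boundary_chart k (Y : manifold R true k.+1) c c' q : atlas (m:=Y) c -> atlas (m:=Y) c' ->
  chart_dom c q -> chart_dom c' q -> chart_map c q 0 ord0 = 0 -> chart_map c' q 0 ord0 = 0.
Proof.
move=> Ac Ac' dq dq' q0; apply/eqP/negP => /negP q'0.
have [ic ic'] := (atlas_chart Ac, atlas_chart Ac').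
have [_ sT] := atlas_compat Y.
pose D := chart_map c' @` (chart_dom c' `&` chart_dom c).
pose E := chart_map c @` (chart_dom c `&` chart_dom c').
have oD : relopen true D by apply: chart_relopen => //; case: ic.
have oE : relopen true E by apply: chart_relopen => //; case: ic'.
have [_ _ cK _ _] := ic; have [_ _ cK' _ _] := ic'.
pose tau := in_charts c' c (@id Y); pose tau' := in_charts c c' (@id Y).
have st i : smooth_on true D (fun x => tau x 0 i) := sT c' c Ac' Ac i.
have st' : vsmooth true E tau' := sT c c' Ac Ac'.
have ED x : E x -> D (tau' x) /\ tau (tau' x) = x.
  by move=> [p [dp dp'] <-]; rewrite /tau' /tau /in_charts cK // cK' //; split=> //; exists p.
have Eq : E (chart_map c q) by exists q.
have tq : tau' (chart_map c q) = chart_map c' q by rewrite /tau' /in_charts cK.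
have Dq : D (chart_map c' q) by exists q.
have mq : 0 < chart_map c' q 0 ord0 by rewrite lt0r q'0; apply: (oD.1 _ Dq).
have := dd_comp oD oE (fun x Ex => (ED x Ex).1) st' (delta_mx 0 ord0) (st ord0) Eq.
rewrite (dd_eq oE _ (g := fun x => x 0 ord0) Eq); last by move=> x /ED[_ ->].
rewrite (dd_coord oE _ _ Eq) mxE !eqxx tq ddE big1 => [/eqP|i _]; first by rewrite oner_eq0.
rewrite (pd_min i oD (st ord0) Dq mq) ?mulr0 //; first by rewrite -tq (ED _ Eq).2.
move=> _ [p [dp' dp] <-]; rewrite /tau /in_charts cK' //.
have Ep : E (chart_map c p) by exists p.
exact: (oE.1 _ Ep).
Qed.

Definition ord_tail n (i : 'I_n) : 'I_n.+1 := @rshift 1 n i.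

Lemma collar_map0 (T : Type) n (c : chart R T n) eps q :
  chart_map (collar_chart eps c) q 0 ord0 = q.2.
Proof.
rewrite (_ : ord0 = @lshift 1 n ord0); last exact: val_inj.
by rewrite /= (@row_mxEl _ 1 1 n) mxE.
Qed.

Lemma collar_map_tail (T : Type) n (c : chart R T n) eps q i :
  chart_map (collar_chart eps c) q 0 (ord_tail i) = chart_map c q.1 0 i.
Proof. by rewrite /= (@row_mxEr _ 1 1 n). Qed.

Lemma collar_relopen (M : topologicalType) n (c : chart R M n) eps (G : set (M * R)) :
  is_chart false c -> open G ->
  relopen true (chart_map (collar_chart eps c) @`
    ((G `&` [set q | 0 < q.2]) `&` chart_dom (collar_chart eps c))).
Proof.
move=> ic oG; split=> [_ [q [[_ q0] _] <-] _ i i0|].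
  by rewrite (_ : i = ord0) ?collar_map0 ?ltW //; apply: val_inj.
move=> _ [[p t] [[Gp t0] [dp te']] <-]; have {te'} te : t < eps by case/andP: te'.
have X0 := collar_map0 c eps (p, t); have XS := collar_map_tail c eps (p, t).
move: (chart_map _ _) X0 XS => X X0 XS.
have [[A B] /= [nA nB] AB] : nbhs (p, t) G by apply: open_nbhs_nbhs.
have [_ _ cK _ _] := ic.
have oV := chart_relopen ic (@open_interior _ A).
have /oV.2[e e0 he] : (chart_map c @` (chart_dom c `&` A^°)) (chart_map c p) by exists p.
have [d /= d0 hd] := nB.
exists (Num.min (Num.min e d) (Num.min t (eps - t))).
  by rewrite !lt_min e0 d0 t0 subr_gt0 te.
move=> y [_ hy].
have hy0 := hy ord0; rewrite X0 !lt_min /= in hy0.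
move: hy0 => /andP[/andP[_ h1] /andP[h2 h3]].
set t' := y 0 ord0 in h1 h2 h3.
have [q [dq Aq] qy] : (chart_map c @` (chart_dom c `&` A^°)) (rsubmx (y : 'rV_(1 + n))).
  apply: he; split=> // i; have := hy (ord_tail i).
  by rewrite XS mxE !lt_min => /andP[/andP[]].
have t'0 : 0 < t' by move: h2; rewrite ltr_norml => /andP[a1 _]; lra.
have t'e : t' < eps by move: h3; rewrite ltr_norml => /andP[_ a1]; lra.
exists (q, t') => /=; last first.
  rewrite qy; have -> : const_mx t' = lsubmx (y : 'rV_(1 + n)).
    by apply/rowP => i; rewrite !mxE ord1 /t'; congr (y 0 _); exact: val_inj.
  exact: (@hsubmxK _ 1 1 n y).
split; last by split=> //; rewrite ltW.
split=> //; apply: AB; split=> /=; first exact: interior_subset.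
by apply: hd; rewrite /= distrC.
Qed.

End Boundary.

Section Auxiliary.
Context {R : realType}.

Lemma sectional_totally_geodesic b b' m n (V : set 'rV[R]_n) (W : set 'rV[R]_m) g h phi kap :
  relopen b V -> relopen b' W -> (forall y, W y -> V (phi y)) -> vsmooth b' W phi ->
  metric_on b V g -> metric_on b' W h ->
  (forall y a c, W y -> bil (h y) a c = bil (g (phi y)) (vd b' a phi y) (vd b' c phi y)) ->
  (forall u v y, W y -> covphi b b' g phi u (vd b' v phi) y = vd b' (Gam b' h y u v) phi y) ->
  (forall x, V x -> sectional_curvature_eq b g kap x) ->
  forall y, W y -> sectional_curvature_eq b' h kap y.
Proof.
move=> oV oW WV sphi mg mh iso tg sec y Wy u v.
rewrite /inner -!bil_def Rm_uvv !iso // (gauss_totally_geodesic oV oW WV sphi mg mh tg) //.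
by have := sec _ (WV y Wy) (vd b' u phi y) (vd b' v phi y); rewrite /inner -!bil_def Rm_uvv.
Qed.

Lemma Rm_delta b n (g : 'rV[R]_n -> 'M[R]_n) x (i j p m : 'I_n) :
  Rm b g x (delta_mx 0 i) (delta_mx 0 j) (delta_mx 0 p) 0 m = riemann b g i j p m x.
Proof.
rewrite mxE (bigD1 i) //= (bigD1 j) //= (bigD1 p) //= !mxE !eqxx !mul1r.
rewrite big1 => [|q qp]; last by rewrite !mxE (negPf qp) mulr0 mul0r.
rewrite big1 => [|q qj]; last by rewrite big1 // => ? _; rewrite !mxE (negPf qj) mulr0 !mul0r.
rewrite big1 => [|q qi]; first by rewrite !addr0.
by rewrite big1 // => ? _; rewrite big1 // => ? _; rewrite !mxE (negPf qi) !mul0r.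
Qed.

Lemma ricci_flat b n (g : 'rV[R]_n -> 'M[R]_n) x :
  (forall u v w, Rm b g x u v w = 0) -> ricci b g x = 0.
Proof.
by move=> R0; apply/matrixP => i p; rewrite !mxE big1 // => q _; rewrite -Rm_delta R0 mxE.
Qed.

Lemma einstein_product0 k (h0 : 'rV[R]_k -> 'M[R]_k) l f :
  einstein_product h0 0 l f = iter l (nlap false h0) f.
Proof.
rewrite /einstein_product; move: (iota _ _) (size_iota 1 l) => s.
elim: s l => [|m s IH] [|l] //= [sl].
by apply/funext => x; rewrite (IH l sl) !mul0r addr0.
Qed.

Lemma open_relopen n (V : set 'rV[R]_n) : open V <-> relopen false V.
Proof.
split=> [oV|oV]; first split=> // x Vx.
  have /nbhs_boxP[e e0 he] : nbhs x V by apply: open_nbhs_nbhs.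
  by exists e => // y [_ /he].
rewrite openE => x /oV.2[e e0 he]; apply/nbhs_boxP; exists e => // y hy; exact: he.
Qed.

Lemma chart_preim_open (T : topologicalType) b n (c : chart R T n) B :
  is_chart b c -> open B -> open (chart_dom c `&` chart_map c @^-1` B).
Proof.
move=> [odom _ _ cc _] oB; rewrite openE => p [dp Bp].
have nB : nbhs (chart_map c p) B by apply: open_nbhs_nbhs.
have /subspace_continuousP/(_ _ dp)/(_ _ nB) := cc; rewrite /= /within /= => nb.
have nd : nbhs p (chart_dom c) by apply: open_nbhs_nbhs.
by apply: filterS (filterI nd nb) => q [dq hq]; split=> //; exact: hq.
Qed.

(** The limits of the GJMS construction run over all interior points; restricted to a normal segment
    they become limits in one variable. *)
Lemma up_within k (V Im : set 'rV[R]_k.+1) x : relopen true V -> wall V x -> V `<=` Im ->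
  up x t @[t --> 0^'+] --> within [set z | Im z /\ 0 < z 0 ord0] (nbhs x).
Proof.
move=> oV wx VI P; rewrite /within /= => /nbhs_boxP[e e0 he].
have [d d0 hd] := up_near oV wx.
suff : \forall t \near 0^'+, P (up x t) by [].
near=> t; have t0 : 0 < t by near: t; apply: nbhs_right_gt.
have td : t <= d by near: t; exact: nbhs_right_le.
have te : t < e by near: t; exact: nbhs_right_lt.
apply: he; last split.
- move=> i; rewrite stepE addrAC subrr add0r.
  by case: eqP; rewrite ?mulr1 ?mulr0 ?normr0 // gtr0_norm.
- by apply: VI; apply: hd; rewrite ltW.
- by rewrite /up stepE wx.2 eqxx mulr1 add0r.
Unshelve. all: by end_near.
Qed.

End Auxiliary.

(** * Local flat representatives for umbilic submanifolds *)

Section FlatRepresentative.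
Context {R : realType}.
Variables (n k : nat) (M : manifold R false n) (g : @tensor2 R M n) (S : manifold R false k).
Variables (i : S -> M) (h : @tensor2 R S k).
Hypothesis k2 : (1 < k)%N.
Hypothesis hg : is_metric false (atlas (m:=M)) setT g.
Hypothesis hlcf : locally_conformally_flat (atlas (m:=M)) g.
Hypothesis hi : embedding false (atlas (m:=S)) (atlas (m:=M)) i.
Hypothesis hh : is_pullback false (atlas (m:=S)) (atlas (m:=M)) setT i g h.
Hypothesis humb : umbilic (atlas (m:=S)) (atlas (m:=M)) i h g.

Lemma umbilic_flat_representative c c' p : atlas (m:=S) c -> atlas (m:=M) c' ->
  chart_dom c p -> chart_dom c' (i p) ->
  let f := in_charts c c' i in
  exists (V : set 'rV[R]_n) (om : 'rV[R]_n -> R) (e : R),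
  [/\ relopen false V, smooth_on false V om,
    0 < e /\ box (chart_map c p) e `<=` chart_map c @` (chart_dom c `&` i @^-1` chart_dom c'),
    forall y, box (chart_map c p) e y -> V (f y) &
    let h0 := conf (h c) (fun y => - om (f y)) in
    metric_on false (box (chart_map c p) e) h0 /\
    forall y u v w, box (chart_map c p) e y -> Rm false h0 y u v w = 0].
Proof.
move=> Ac Ac' dp dip f; have [[ci si] rfi _ _] := hi.
have ic := atlas_chart Ac; have [odom' _ _ _ _] := atlas_chart Ac'.
have [V0 [psi [om [oV0 V0p V0I _ [spsi som gE]]]]] := hlcf Ac' dip.
pose W1 := chart_map c @` (chart_dom c `&` i @^-1` chart_dom c').
have oW1 : relopen false W1.
  by apply: chart_relopen => //; move/continuousP: ci; apply.
have sf1 : vsmooth false W1 f := si c c' Ac Ac'.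
have {}oV0 : relopen false V0 by apply/open_relopen.
pose W0 := W1 `&` [set y | V0 (f y)].
have oW0 : relopen false W0 by apply: (relopen_preim oW1 sf1 oV0).
have sf0 : vsmooth false W0 f by move=> q; apply: (smooth_sub _ (sf1 q)) => y [].
have WV y : W0 y -> V0 (f y) by case.
have mg : metric_on false V0 (g c').
  by apply: (metric_chart hg Ac') => x /V0I[q dq <-]; exists q.
have [_ _ cK _ _] := ic.
have WP y : W0 y -> exists q, [/\ chart_dom c q, chart_dom c' (i q), chart_map c q = y &
    f y = chart_map c' (i q)].
  by move=> [[q [dq diq] <-] _]; exists q; split=> //; rewrite /f /in_charts cK.
have hE y : W0 y -> h c y = jac false f y *m g c' (f y) *m (jac false f y)^T.
  by move=> /WP[q [dq diq <- ->]]; exact: hh.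
have rf y : W0 y -> row_free (jac false f y).
  by move=> /WP[q [dq diq <- _]]; exact: rfi.
have mh : metric_on false W0 (h c) := metric_pullback oV0 oW0 WV sf0 mg hE rf.
have iso := iso_pullback hE.
have umb y : W0 y -> exists H, forall u v,
  covphi false false (g c') f u (vd false v f) y =
  vd false (Gam false (h c) y u v) f y + bil (h c y) u v *: H.
  move=> Wy; exists (mean_curv false false (h c) (g c') f y).
  apply: (cov_extend oV0 oW0 WV sf0 mg mh Wy) => a b.
  by have [q [dq diq <- _]] := WP y Wy; exact: humb.
have cf x a b : V0 x -> bil (g c' x) a b =
    expR (2 * om x) * dot (vd false a psi x) (vd false b psi x).
  by move=> Vx; rewrite gE // bilMZ !vd_jac /dot -bil_mulmx mulmx1.
have W0p : W0 (chart_map c p).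
  by split; [exists p|rewrite /= /f /in_charts cK].
have [V' [om' [e [[oV' _] som' [e0 eW] eV' R0]]]] :=
  umbilic_locally_flat oV0 oW0 WV mg mh sf0 spsi som iso umb cf k2 W0p.
by exists V', om', e; split=> //; split=> // y /eW[].
Qed.

End FlatRepresentative.

Theorem proposition4p11 (R : realType) (n k l : nat)
  (hk : (3 <= k)%N) (hkn : (k <= n - 1)%N) (hl : (1 <= l)%N)
  (M : manifold R false n) (g : tensor2 M n)
  (hg : is_metric false (atlas (m:=M)) setT g)
  (hlcf : locally_conformally_flat (atlas (m:=M)) g)
  (S : manifold R false k) (i : S -> M)
  (hi : embedding false (atlas (m:=S)) (atlas (m:=M)) i)
  (h : tensor2 S k)
  (hh : is_pullback false (atlas (m:=S)) (atlas (m:=M)) setT i g h)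
  (humb : umbilic (atlas (m:=S)) (atlas (m:=M)) i h g)
  (P Pbar : (S -> R) -> S -> R)
  (hP : is_minimal_extrinsic g i h l P)
  (hPbar : is_intrinsic_gjms h l Pbar) :
  forall f : S -> R, smooth_fun false (atlas (m:=S)) setT f -> P f = Pbar f.
Proof.
move=> f sf; apply/funext => p.
have [eps [N [gp [Y [j [Phi [hp]]]]]]] := hP.
move=> [[eps0 [G [oG NE]] N0] [mgp hypgp _] [ej rj eP rP [Phij Phi0]] [pbP tgP] gj].
have [r [F [dF sF Fj HF]]] := gj f sf.
have [sr r0 rp [gbar [mgb gbE gr1 pbj]]] := dF.
have [c Ac dp] := atlas_cover p; have [c' Ac' dip] := atlas_cover (i p).
have [cY AY djp] := atlas_cover (j p).
pose cX := collar_chart eps c'; have AX : collar_atlas eps (atlas (m:=M)) cX by exists c'.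
have [V' [om' [e [oV' som' [e0 eW] eV' [mh0 flat]]]]] :=
  umbilic_flat_representative (ltnW hk) hg hlcf hi hh humb Ac Ac' dp dip.
have ic := atlas_chart Ac; have [_ _ cK _ _] := ic.
have ic' := atlas_chart Ac'; have [odom' _ _ _ _] := ic'.
have icY := atlas_chart AY; have [odomY _ cYK _ _] := icY.
have [[cj sjm] rfj _ topj] := ej; have [[cP sPm] rfP _ _] := eP.
pose jh := in_charts c cY j; pose Ph := in_charts cY cX Phi; pose fh := in_charts c c' i.
(* The component of Phi in M, in the chart c'. On the wall it is the immersion i, so functions on M
   composed with it extend functions on S into Y. *)
pose tl x : 'rV[R]_n := \row_q Ph x 0 (ord_tail q).
have domX q : chart_dom c' (Phi q).1 -> chart_dom cX (Phi q).
  move=> dq; split=> //; have /rP : range Phi (Phi q) by exists q.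
  by rewrite NE => - [].
have wallP q : chart_dom cY q -> chart_map cY q 0 ord0 = 0 <-> range j q.
  move=> dq; rewrite rj; split=> [q0|[c1 [A1 d1 q0]]]; first by exists cY.
  exact: (boundary_chart A1 AY d1 dq q0).
have tlE q : chart_dom cY q -> tl (chart_map cY q) = chart_map c' (Phi q).1.
  move=> dq; apply/rowP => a; rewrite mxE /Ph /in_charts cYK //; exact: collar_map_tail.
(* As j is a topological embedding, an open set D of Y cuts out exactly the box on S. Hence every
   wall point of V below comes from W, as [jsurj] requires. *)
have [D oD jD] := topj _ (chart_preim_open ic ((@open_relopen R k _).2 (relopen_box (chart_map c p) e))).
have oA2 : open [set q | chart_dom c' (Phi q).1].
  have cP1 : continuous (fun q => (Phi q).1).
    by move=> q; apply: (cvg_comp _ _ (cP q)); exact: cvg_fst.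
  by move/continuousP : cP1; apply.
pose D0 := chart_map cY @` (chart_dom cY `&` (D `&` [set q | chart_dom c' (Phi q).1])).
have oD0 : relopen true D0 by apply: chart_relopen => //; apply: openI.
have D0P x : D0 x -> exists q, [/\ chart_dom cY q, D q, chart_dom cX (Phi q) & chart_map cY q = x].
  by move=> [q [dq [Dq dPq]] <-]; exists q; split=> //; exact: domX.
have sPh : vsmooth true D0 Ph.
  move=> a; apply: (smooth_sub _ (sPm cY cX AY AX a)) => x /D0P[q [dq _ dPq <-]].
  by exists q.
have stl : vsmooth true D0 tl.
  by move=> a; apply: (smooth_eq oD0 _ (sPh (ord_tail a))) => x _; rewrite /tl [RHS]mxE.
pose D1 := D0 `&` [set x | V' (tl x)].
have oD1 : relopen true D1 by apply: (relopen_preim oD0 stl oV').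
pose z0 := chart_map cY (j p).
have z00 : z0 0 ord0 = 0 by apply/(wallP _ djp); exists p.
have bp : box (chart_map c p) e (chart_map c p) by move=> a; rewrite subrr normr0.
have D1z : D1 z0.
  split; first exists (j p) => //.
    split=> //; split; last by rewrite /= Phij.
    have : (j @^-1` D) p by rewrite -jD; split.
    by [].
  by rewrite /= /z0 tlE // Phij /=; have := eV' _ bp; rewrite /in_charts cK.
have [d d0 hd] := oD1.2 _ D1z.
(* A half-box centred at a wall point is stable under [wall_proj]. *)
pose V : set 'rV[R]_k.+1 := model true (n := k.+1) `&` box z0 d.
have VD1 : V `<=` D1 := hd.
have oV : relopen true V.
  split=> [x []//|x [mx bx]].
  have [d1 d10 hd1] := (relopen_box z0 d).2 _ bx.
  by exists d1 => // y [my by_]; split=> //; apply: hd1; split.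
have Vproj x : V x -> V (wall_proj x).
  move=> [mx bx]; split=> [_ a a0|a]; rewrite mxE.
    by rewrite (_ : a = ord0) ?eqxx //; apply: val_inj.
  by case: eqP => [->|_]; [rewrite z00 subrr normr0|exact: bx].
have VD0 : V `<=` D0 by move=> x /VD1[].
have VP x : V x -> exists q, [/\ chart_dom cY q, D q, chart_dom cX (Phi q) & chart_map cY q = x].
  by move=> /VD0/D0P.
have VI : V `<=` chart_map cY @` chart_dom cY by move=> x /VP[q [dq _ _ <-]]; exists q.
have VT : V `<=` chart_map cY @` (setT `&` chart_dom cY).
  by move=> x /VI[q dq <-]; exists q.
have mgV : metric_on true V (gbar cY) := metric_chart mgb AY VT.
pose rh := r \o chart_inv cY; pose Fh := F \o chart_inv cY.
have srV : smooth_on true V rh := smooth_sub VT (sr cY AY).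
have sFV : smooth_on true V Fh := smooth_sub VT (sF cY AY).
have interior q : chart_dom cY q -> 0 < chart_map cY q 0 ord0 -> ~ boundary (atlas (m:=Y)) q.
  by move=> dq q0; rewrite -rj => /(wallP _ dq) E; rewrite E ltxx in q0.
have r0V x : wall V x -> rh x = 0.
  move=> [/VP[q [dq _ _ <-]] /(wallP _ dq) bq]; rewrite /rh /= cYK //; apply: r0 => //.
  by rewrite -rj.
have rpV x : V x -> 0 < x 0 ord0 -> 0 < rh x.
  move=> /VP[q [dq _ _ <-]] q0; rewrite /rh /= cYK //.
  by apply: (rp cY) => //; exact: interior.
have dr1V x : wall V x -> dd true (gr true (gbar cY) rh x) rh x = 1.
  move=> [/VP[q [dq _ _ <-]] /(wallP _ dq) bq]; rewrite -grad_norm2E.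
  by apply: gr1 => //; rewrite -rj.
have hpE x : V x -> 0 < x 0 ord0 -> gbar cY x = rh x ^+ 2 *: hp cY x.
  move=> /VP[q [dq _ _ <-]] q0; rewrite /rh /= cYK //.
  by apply: gbE => //; exact: interior.
(* The Gauss equation for Phi, totally geodesic in a metric of curvature -1. *)
have hyp x : V x -> 0 < x 0 ord0 -> sectional_curvature_eq true (hp cY) (-1) x.
  move=> Vx x0; pose VX := chart_map cX @` ((N `&` [set q | 0 < q.2]) `&` chart_dom cX).
  have oVX : relopen true VX.
    rewrite /VX (_ : _ `&` _ = (G `&` [set q | 0 < q.2]) `&` chart_dom cX); first exact: collar_relopen.
    rewrite NE; apply/seteqP; split=> q [[]]; first by case=> Gq _ q0 dq.
    by move=> Gq q0 dq; split=> //; split=> //; split=> //; case: dq.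
  pose WY := V `&` [set x | 0 < x 0 ord0].
  have oWY : relopen true WY by apply: (relopen_pos oV); exact: smooth_coord.
  have WYP y : WY y -> exists q, [/\ chart_dom cY q, (~` boundary (atlas (m:=Y))) q,
      chart_dom cX (Phi q), chart_map cY q = y & Ph y = chart_map cX (Phi q) /\
      (N `&` [set q | 0 < q.2]) (Phi q)].
    move=> [/VP[q [dq _ dPq <-]] q0]; exists q; split=> //; first exact: interior.
    split; first by rewrite /Ph /in_charts cYK.
    split; first by apply: rP; exists q.
    case: dPq => _ /andP[P0 _]; rewrite /= lt0r P0 andbT; apply/eqP => /Phi0 /(wallP _ dq) E.
    by move: q0; rewrite /= E ltxx.
  have WVX y : WY y -> VX (Ph y).
    by move=> /WYP[q [_ _ dPq _ [-> Nq]]]; exists (Phi q).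
  have sPW : vsmooth true WY Ph.
    by move=> a; apply: (smooth_sub _ (sPh a)) => y [/VD0].
  have mgX : metric_on true VX (gp cX) := metric_chart mgp AX (@subset_refl _ _).
  have hE y : WY y -> hp cY y = jac true Ph y *m gp cX (Ph y) *m (jac true Ph y)^T.
    by move=> /WYP[q [dq bq dPq <- [-> _]]]; exact: pbP.
  have rf y : WY y -> row_free (jac true Ph y).
    by move=> /WYP[q [dq bq dPq <- _]]; exact: rfP.
  have mhp := metric_pullback oVX oWY WVX sPW mgX hE rf.
  apply: (sectional_totally_geodesic oVX oWY WVX sPW mgX mhp (iso_pullback hE)) => //.
    move=> u v y WYy; rewrite (cov_extend oVX oWY WVX sPW mgX mhp (H := 0) WYy) ?scaler0 ?addr0 //.
    move=> a b; have [q [dq bq dPq <- _]] := WYP y WYy.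
    by rewrite scaler0 subr0; apply: tgP.
  by move=> _ [q [Nq dq] <-]; exact: hypgp.
pose sig y := - om' (fh y).
(* The extension of the conformal exponent to Y; along j it equals [sig] because Phi (j q) = (i q,
   0). *)
pose a0 x := - om' (tl x).
have tlV x : V x -> V' (tl x) by move=> /VD1[].
have sa0 : smooth_on true V a0.
  have stV : vsmooth true V tl by move=> a; apply: (smooth_sub VD0 (stl a)).
  exact: (smoothN oV (smooth_comp oV' oV tlV stV som')).
pose W1 := chart_map c @` (chart_dom c `&` j @^-1` chart_dom cY).
have oW1 : relopen false W1 by apply: chart_relopen => //; move/continuousP: cj; apply.
have sj1 : vsmooth false W1 jh := sjm c cY Ac AY.
have jm y : W1 y -> model true (jh y).
  move=> [q [dq djq] <-]; rewrite /jh /in_charts cK //.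
  have [_ [G' [_ EG]] _ _ _] := icY.
  have : (chart_map cY @` chart_dom cY) (chart_map cY (j q)) by exists (j q).
  by rewrite EG => -[].
pose W := (W1 `&` [set y | V (jh y)]) `&` box (chart_map c p) e.
have oW : relopen false W by apply: relopenI; [exact: (relopen_preim oW1 sj1 oV)|exact: relopen_box].
have WB : W `<=` box (chart_map c p) e by move=> y [].
have WW1 : W `<=` W1 by move=> y [[]].
have WP y : W y -> exists q, [/\ chart_dom c q, chart_dom cY (j q), chart_dom c' (i q),
    chart_map c q = y & jh y = chart_map cY (j q) /\ fh y = chart_map c' (i q)].
  move=> Wy; have [q [dq djq] qy] := WW1 _ Wy.
  have [q' [dq' diq'] q'y] := eW _ (WB _ Wy).
  have E : q = q' by rewrite -(cK q dq) -(cK q' dq') qy q'y.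
  exists q; split=> //; first by rewrite E.
  by rewrite -qy /jh /fh /in_charts cK.
have Wp : W (chart_map c p).
  split=> //; split; first by exists p.
  by rewrite /= /jh /in_charts cK //; split; [exact: (oD1.1 _ D1z)|move=> a; rewrite subrr normr0].
have sj : vsmooth false W jh by move=> a; apply: (smooth_sub WW1 (sj1 a)).
have jW y : W y -> wall V (jh y).
  move=> Wy; have [q [dq djq _ _ [Eq _]]] := WP y Wy; split; first by case: Wy => -[].
  by rewrite Eq; apply/(wallP _ djq); exists q.
have jsurj x : wall V x -> exists2 y, W y & jh y = x.
  move=> [Vx x0]; have [q [dq Dq _ qx]] := VP x Vx; move: x0; rewrite -qx => /(wallP _ dq)[t _ tq].
  have [dt bt] : (chart_dom c `&` chart_map c @^-1` box (chart_map c p) e) t.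
    by rewrite jD /= tq.
  have jt : jh (chart_map c t) = chart_map cY q by rewrite /jh /in_charts cK // tq.
  exists (chart_map c t) => //; split=> //; split; last by rewrite /= jt qx.
  by exists t => //; split=> //=; rewrite tq.
have iso y a b : W y ->
    bil (h c y) a b = bil (gbar cY (jh y)) (vd false a jh y) (vd false b jh y).
  apply: (@iso_pullback _ _ _ _ W) => {}y /WP[q [dq djq _ <- [-> _]]].
  exact: pbj.
have a0j y : W y -> a0 (jh y) = sig y.
  move=> /WP[q [dq djq _ _ [Ej Ef]]]; rewrite /a0 /sig Ej Ef tlE // Phij //.
have bound y : W y -> exists C, \forall t \near 0^'+,
    `|laplacian true (hp cY) (fun y => rh y `^ (k%:R / 2 - l%:R) * Fh y) (up (jh y) t)
      + ((k%:R / 2) ^+ 2 - l%:R ^+ 2) * (rh (up (jh y) t) `^ (k%:R / 2 - l%:R) * Fh (up (jh y) t))|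
    <= C * rh (up (jh y) t) `^ (k%:R / 2 + l%:R).
  move=> Wy; have [q [dq djq _ _ [Ej _]]] := WP y Wy.
  have [[C hC] _] := HF cY q AY djq; exists C.
  have := up_within oV (jW _ Wy) VI; rewrite Ej => uw.
  exact: (uw _ hC).
have lim : gjms_const l * (rh (up (jh (chart_map c p)) t) `^ (- (k%:R / 2) - l%:R) *
    (laplacian true (hp cY) (fun y => rh y `^ (k%:R / 2 - l%:R) * Fh y) (up (jh (chart_map c p)) t)
      + ((k%:R / 2) ^+ 2 - l%:R ^+ 2) *
        (rh (up (jh (chart_map c p)) t) `^ (k%:R / 2 - l%:R) * Fh (up (jh (chart_map c p)) t))))
    @[t --> 0^'+] --> P f p.
  have := up_within oV (jW _ Wp) VI; rewrite /jh /in_charts cK // => uw.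
  have [_ hL] := HF cY p AY djp.
  exact: (cvg_comp _ _ uw hL).
have := gjms_local oV Vproj mgV srV r0V rpV dr1V hpE hyp sa0 oW sj jW jsurj iso a0j
  (metric_on_sub WB mh0) (fun y u v w Wy => flat y u v w (WB _ Wy)) hk hl sFV bound Wp lim.
move=> ->.
have sfh : smooth_on false W (fun y => om' (fh y)).
  have [[_ sim] _ _ _] := hi.
  have sf1 : vsmooth false W fh.
    by move=> a; apply: (smooth_sub _ (sim c c' Ac Ac' a)) => y /WB/eW.
  by apply: (smooth_comp oV' oW _ sf1 som') => y /WB/eV'.
(* The flat metric is the local Einstein representative with constant 0, so h = exp(2 om') h0 and
   the product is a pure power of the negative Laplacian. *)
have := hPbar c W (conf (h c) sig) (fun y => om' (fh y)) 0 Ac ((@open_relopen R k _).2 oW) _ sfh _ _ f sf _ Wp.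
rewrite einstein_product0 cK // => ->.
- congr (_ * _); first by congr expR; rewrite /sig; ring.
  apply: (iter_nlap_eq _ _ oW _ Wp) => y Wy; congr (_ * _).
    by congr expR; rewrite /sig; ring.
  have [q [dq djq _ <- [Ej _]]] := WP y Wy.
  by rewrite /Fh /= Ej cYK // Fj cK.
- by move=> y /WP[q [dq _ _ <- _]]; exists q.
- move=> y Wy; rewrite /conf /sig scalerA -expRD.
  by rewrite (_ : _ + _ = 0) ?expR0 ?scale1r //; ring.
- move=> y Wy; rewrite mul0r scale0r; apply: ricci_flat => u v w.
  by apply: flat; apply: WB.
Qed.
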